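(* The class $\mathcal{K}^\mu$ has the amalgamation property with respect to self-sufficient embeddings: whenever $B,M,A\in\mathcal{K}^\mu$ with $B\le M$ and $B\le A$, there are $M'\in\mathcal{K}^\mu$ with $M\le M'$ and $A'$ with $B\le A'\le M'$ such that $A$ and $A'$ are isomorphic over $B$.
   Context: Fix $q$ ($0$ or a prime) and an integer $p\ge 2$. Let $\mathbb{C}$ be a sufficiently saturated algebraically closed field of characteristic $q$, in the ring language $L$. $\operatorname{MR}$ is Morley rank in $\mathbb{C}$; $\operatorname{acl},\operatorname{dcl}$ are algebraic and definable closure in $\mathbb{C}$ ($\operatorname{dcl}(X)$ is the perfect hull of the field generated by $X$); independence is algebraic independence. If $\vec a$ realizes $\chi(\vec x,\vec b)$ and $B\supseteq\vec b$, $\vec a$ is $B$-generic if $\operatorname{MR}(\vec a/B)=\operatorname{MR}(\chi(\vec x,\vec b))$; ''generic'' means $\vec b$-generic. Codes: a code $\alpha$ consists of natural numbers $n_\alpha,m_\alpha,k_\alpha$ and $L$-formulas $\varphi_\alpha(\vec x,\vec y)$, $\psi_\alpha(\vec x_1,\dots,\vec x_{m_\alpha},\vec y)$ with $|\vec x|=|\vec x_i|=n_\alpha$, $\theta_\alpha(\vec y)=\exists\vec x\,\varphi_\alpha(\vec x,\vec y)$, such that: (C1) if $\models\theta_\alpha(\vec b)$ then $\varphi_\alpha(\vec x,\vec b)$ has Morley rank $k_\alpha$ and degree $1$; (C2) if $\vec a$ is a generic realization of $\varphi_\alpha(\vec x,\vec b)$, $\vec a'$ realizes $\varphi_\alpha(\vec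 x,\vec b')$, $s\subseteq\{1,\dots,n_\alpha\}$, $a_s=\{a_j\}_{j\in s}$, $i\le n_\alpha$, then $a_i\in\operatorname{acl}(a_s,\vec b)\Rightarrow a'_i\in\operatorname{acl}(a'_s,\vec b')$, $a_i\in a_s\vec b\Rightarrow a'_i\in a'_s\vec b'$, $a_i\notin a_s\vec b\Rightarrow a'_i\notin a'_s\vec b'$ ($a_i\in a_s\vec b$ meaning $a_i$ equals a coordinate of $a_s$ or $\vec b$); (C3) if $\models\theta_\alpha(\vec b)$ and $\operatorname{MR}(\varphi_\alpha(\vec x,\vec b)\triangle\varphi_\alpha(\vec x,\vec b'))<k_\alpha$ then $\vec b=\vec b'$; (C4) $\models\psi_\alpha(\vec x_1,\dots,\vec x_{m_\alpha},\vec b)$ implies $\vec b\in\operatorname{dcl}(\vec x_1,\dots,\vec x_{m_\alpha})$; (C5) $\psi_\alpha(\vec x_1,\dots,\vec x_{m_\alpha},\vec b)$ is consistent for all $\vec b\models\theta_\alpha$; (C6) if $\models\psi_\alpha(\vec a_1,\dots,\vec a_{m_\alpha},\vec b)$ and $\vec a'$ is a generic realization of $\varphi_\alpha(\vec x,\vec b)$ independent from $\vec a_1,\dots,\vec a_{m_\alpha}$ over $\vec b$, then $\models\psi_\alpha(\vec a_1,\dots,\vec a_{i-1},\vec a',\vec a_{i+1},\dots,\vec a_{m_\alpha},\vec b)$ for all $i$. Codes are identified if their formulas are equivalent in $\mathbb{C}$. For a permutation $\sigma$ of $\{1,\dots,n_\alpha\}$, $\alpha^\sigma$ is obtained by permuting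 the variables of each of $\vec x,\vec x_1,\dots,\vec x_{m_\alpha}$ in $\varphi_\alpha,\psi_\alpha$ by $\sigma$. Codes $\alpha,\alpha'$ are equivalent if $n_\alpha=n_{\alpha'}$, $m_\alpha=m_{\alpha'}$, and for every $\vec b\models\theta_\alpha$ there is $\vec b'$ with $\varphi_\alpha(\vec x,\vec b)\equiv\varphi_{\alpha'}(\vec x,\vec b')$ and $\psi_\alpha(\vec x_1,\dots,\vec x_{m_\alpha},\vec b)\equiv\psi_{\alpha'}(\vec x_1,\dots,\vec x_{m_\alpha},\vec b')$, and symmetrically. Fixed set of codes: $\mathcal{C}$ is a fixed set of codes such that (P1) for each non-empty definable set $X$ of Morley degree 1 there are $\alpha\in\mathcal{C}$ and $\vec b$ with $\operatorname{MR}(\varphi_\alpha(\vec x,\vec b)\triangle X)<k_\alpha$; (P2) if $\alpha,\alpha'\in\mathcal{C}$, $\models\theta_\alpha(\vec b)$ and $\operatorname{MR}(\varphi_\alpha(\vec x,\vec b)\triangle\varphi_{\alpha'}(\vec x,\vec b'))<k_\alpha$ then $\alpha=\alpha'$; (P3) every permutation of a code in $\mathcal{C}$ is equivalent to a code in $\mathcal{C}$. Colored sets and $\delta$: $L^*=L\cup\{N\}$. A colored subset of $\mathbb{C}$ is a set $A\subseteq\mathbb{C}$ with a subset $N(A)$ of black points (others white); $A\subseteq B$ for colored sets means $A$ is a subset of $B$ and $N(A)=A\cap N(B)$. For finite $A$, $\delta(A)=p\cdot\operatorname{trdeg}(A)-|N(A)|$ (transcendence degree of the generated field over the prime field); $\delta(A/B)=\delta(A\cup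 B)-\delta(B)$ for finite $A,B$; for finite $A$ and arbitrary $Y$, $\delta(A/Y)=\inf\{\delta(A/C):C\text{ finite},A\cap Y\subseteq C\subseteq Y\}$. $Y\le X$ (self-sufficient) means $\delta(A/Y)\ge0$ for all finite $A\subseteq X$. An isomorphism between colored sets $A$ and $A'$ is a bijection mapping $N(A)$ onto $N(A')$ which is an elementary partial map of $\mathbb{C}$ (in $L$); ''over $B$'' means it fixes $B$ pointwise. A code $\alpha$ is good if $n_\alpha=p\,k_\alpha$; $\varphi_\alpha(\vec x,\vec y)$ implies that the $x_i$ are pairwise distinct and distinct from the components of $\vec y$; and whenever $\models\varphi_\alpha(\vec a,\vec b)$, for each $\emptyset\ne s\subsetneq\{1,\dots,n_\alpha\}$, $p\cdot\operatorname{trdeg}(\vec a/\vec a_s\vec b)<n_\alpha-|s|$. $\mathcal{C}_g$ is the set of good codes in $\mathcal{C}$. Fix $\mu^*:\mathcal{C}_g\to\mathbb{N}$ such that for each $n$ its restriction to $\{\alpha\in\mathcal{C}_g:n_\alpha=n\}$ is finite-to-one, $\mu^*(\beta)=\mu^*(\alpha)$ whenever $\beta$ is equivalent to a permutation of $\alpha$, and $\mu^*(\alpha)\ge m_\alpha-1$; put $\mu(\alpha)=((p-1)(n_\alpha-1)+1)m_\alpha+\mu^*(\alpha)$. For $\alpha\in\mathcal{C}_g$ and $\vec b\models\theta_\alpha$, a pseudo-Morley sequence for $\alpha$ over $\vec b$ is a finite sequence $\vec a_1,\dots,\vec a_r$ of pairwise disjoint realizations of $\varphi_\alpha(\vec x,\vec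 b)$, all coordinates black, such that any $m_\alpha$ distinct members $\vec a_{i_1},\dots,\vec a_{i_{m_\alpha}}$ satisfy $\psi_\alpha(\vec a_{i_1},\dots,\vec a_{i_{m_\alpha}},\vec b)$; its length is $r$; it is in a colored set $M$ if all coordinates of all members are black points of $M$. $\mathcal{K}^\mu$ is the class of colored subsets $M$ of $\mathbb{C}$ such that $\emptyset\le M$ (i.e. $\delta(A)\ge0$ for all finite $A\subseteq M$) and no $\alpha\in\mathcal{C}_g$ has a pseudo-Morley sequence (over any $\vec b$) in $M$ of length greater than $\mu(\alpha)$.
   Formalization: Members of K^mu are assumed small (cardinality below the saturation cardinal of C, the usual convention); otherwise M = C all white, B empty and A one black transcendental point is a counterexample. Codes have n_alpha >= 1, since a 0-ary code would make K^mu empty. *)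

(* Defs.v *)
From mathcomp Require Import all_boot all_order all_fingroup all_algebra.
From mathcomp Require Import finmap mpoly.
From mathcomp Require Import mathcomp_extra boolp classical_sets functions.
From mathcomp Require Import cardinality.

Set Implicit Arguments.
Unset Strict Implicit.
Unset Printing Implicit Defensive.

Import Order.TTheory GRing.Theory Num.Theory.

Local Open Scope classical_set_scope.
Local Open Scope ring_scope.

(** * Formulas and saturation *)

(* [Lformula X f]: f is a first-order formula in the language of rings whose
   parameters all lie in X.  [GRing.formula] also offers the inverse and the
   unit predicate, which are not in this language. *)
Fixpoint Lterm (C : Type) (X : set C) (t : GRing.term C) : Prop :=
  match t with
  | GRing.Var _ => True
  | GRing.Const c => X c
  | GRing.NatConst _ => True
  | GRing.Add t1 t2 => Lterm X t1 /\ Lterm X t2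
  | GRing.Opp t1 => Lterm X t1
  | GRing.NatMul t1 _ => Lterm X t1
  | GRing.Mul t1 t2 => Lterm X t1 /\ Lterm X t2
  | GRing.Inv _ => False
  | GRing.Exp t1 _ => Lterm X t1
  end.

Fixpoint Lformula (C : Type) (X : set C) (f : GRing.formula C) : Prop :=
  match f with
  | GRing.Bool _ => True
  | GRing.Equal t1 t2 => Lterm X t1 /\ Lterm X t2
  | GRing.Unit _ => False
  | GRing.And f1 f2 => Lformula X f1 /\ Lformula X f2
  | GRing.Or f1 f2 => Lformula X f1 /\ Lformula X f2
  | GRing.Implies f1 f2 => Lformula X f1 /\ Lformula X f2
  | GRing.Not f1 => Lformula X f1
  | GRing.Exists _ f1 => Lformula X f1
  | GRing.Forall _ f1 => Lformula X f1
  end.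

(* The cardinal kappa is given by a type: |X| < |kappa|. *)
Definition small (kappa : Type) (C : Type) (X : set C) : Prop :=
  ~ ([set: kappa] #<= X)%card.

Definition saturated (kappa : Type) (C : closedFieldType) : Prop :=
  forall X : set C, small kappa X ->
  forall Sigma : set (GRing.formula C),
    (forall f, Sigma f -> Lformula X f) ->
    (forall S0 : set (GRing.formula C), finite_set S0 -> S0 `<=` Sigma ->
       exists x : C, forall f, S0 f -> GRing.holds [:: x] f) ->
  exists x : C, forall f, Sigma f -> GRing.holds [:: x] f.

Definition sufficiently_saturated (kappa : Type) (C : closedFieldType) : Prop :=
  ~ countable [set: kappa] /\ saturated kappa C.

Definition has_characteristic (C : closedFieldType) (q : nat) : Prop :=
  (q = 0%N /\ [pchar C] =i pred0) \/ (prime q /\ q \in [pchar C]).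

Definition definable (C : closedFieldType) (X : set C) (n : nat)
    (S : set (n.-tuple C)) : Prop :=
  exists2 f, Lformula X f & forall v : n.-tuple C, S v <-> GRing.holds v f.

Definition acl (C : closedFieldType) (X : set C) : set C :=
  [set x | exists f, [/\ Lformula X f, GRing.holds [:: x] f
                       & finite_set [set y | GRing.holds [:: y] f]]].

Definition dcl (C : closedFieldType) (X : set C) : set C :=
  [set x | exists2 f, Lformula X f
                    & forall y, GRing.holds [:: y] f <-> y = x].

(** * Morley rank *)

(* [MRge k S]: MR(S) >= k, for a definable set S.  Natural numbers suffice,
   since definable sets have finite Morley rank in algebraically closed fields;
   the empty set has rank -oo, so that [~ MRge 0 S] means S is empty. *)
Fixpoint MRge (C : closedFieldType) (n k : nat) (S : set (n.-tuple C)) : Prop :=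
  match k with
  | 0 => S !=set0
  | k'.+1 => exists F : nat -> set (n.-tuple C),
      [/\ forall i, definable setT (F i), forall i, F i `<=` S,
          trivIset setT F & forall i, MRge k' (F i)]
  end.

Definition MReq (C : closedFieldType) (n k : nat) (S : set (n.-tuple C)) :=
  MRge k S /\ ~ MRge k.+1 S.

Definition MRlt (C : closedFieldType) (n k : nat) (S : set (n.-tuple C)) :=
  ~ MRge k S.

Definition rank_degree1 (C : closedFieldType) (n k : nat)
    (S : set (n.-tuple C)) : Prop :=
  MReq k S /\
  ~ exists T, [/\ definable setT T, MRge k (S `&` T) & MRge k (S `\` T)].

(* MR(a/B), the least Morley rank of a B-definable set containing a *)
Definition MRge_type (C : closedFieldType) (n k : nat) (a : n.-tuple C)
    (B : set C) : Prop :=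
  forall S : set (n.-tuple C), definable B S -> S a -> MRge k S.

(* MR(a/B) = MR(S), as an equality of cuts *)
Definition generic_in (C : closedFieldType) (n : nat) (a : n.-tuple C)
    (B : set C) (S : set (n.-tuple C)) : Prop :=
  S a /\ forall k, MRge_type k a B <-> MRge k S.

(** * Transcendence degree *)

Definition gen_field (F : fieldType) (X : set F) : set F :=
  [set x | forall K : {pred F}, divring_closed K -> X `<=` [set` K] -> x \in K].

Definition alg_indep (F : fieldType) (X : set F) (s : seq F) : Prop :=
  forall P : {mpoly F[size s]}, (forall m, gen_field X (P@_m)) ->
    P.@[tnth (in_tuple s)] = 0 -> P = 0.

(* trdeg(A/X), for A finite; the junk value 0 of [supremum] is not used then. *)
Definition trdeg (F : fieldType) (X A : set F) : nat :=
  supremum 0%N [set size s | s in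
    [set s : seq F | [set` s] `<=` gen_field (X `|` A) /\ alg_indep X s]].

Definition indep_over (F : fieldType) (B A D : set F) : Prop :=
  trdeg (B `|` D) A = trdeg B A.

(** * Codes *)

(* The data of a code with n_alpha = n.  Formulas are represented by the
   relations they define, so that codes with equivalent formulas are equal;
   definability without parameters is part of [is_code]. *)
Record code (C : closedFieldType) (n : nat) := Code {
  cl : nat;
  cm : nat;
  ck : nat;
  phi : n.-tuple C -> cl.-tuple C -> Prop;
  psi : cm.-tuple (n.-tuple C) -> cl.-tuple C -> Prop }.
Arguments phi {C n} c x y : rename.
Arguments psi {C n} c xs y : rename.
Arguments cl {C n} c : rename.
Arguments cm {C n} c : rename.
Arguments ck {C n} c : rename.

Definition theta (C : closedFieldType) n (al : code C n) (b : (cl al).-tuple C) :=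
  exists x, phi al x b.
Arguments theta {C n} al b.

Definition phi_at (C : closedFieldType) n (al : code C n)
    (b : (cl al).-tuple C) : set (n.-tuple C) := [set x | phi al x b].
Arguments phi_at {C n} al b.

Definition coords (C : closedFieldType) n (s : {set 'I_n}) (a : n.-tuple C) :
    set C := [set x | exists2 j, j \in s & x = tnth a j].

Definition all_coords (C : closedFieldType) n m (a : m.-tuple (n.-tuple C)) :
    set C := [set x | exists i j, x = tnth (tnth a i) j].

(* Variable tuples are non-empty: a code with n = 0 would be good, and the empty
   tuple repeated would give arbitrarily long pseudo-Morley sequences. *)
Record is_code (C : closedFieldType) (n : nat) (al : code C n) : Prop := IsCode {
  code_n_gt0 : (0 < n)%N;
  code_phi_def : exists2 f : GRing.formula C, Lformula set0 f &
    forall x y, phi al x y <-> GRing.holds (x ++ y) f;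
  code_psi_def : exists2 f : GRing.formula C, Lformula set0 f &
    forall xs y, psi al xs y <->
      GRing.holds (flatten [seq val x | x <- xs] ++ y) f;
  code_C1 : forall b, theta al b -> rank_degree1 (ck al) (phi_at al b);
  code_C2 : forall (b b' : (cl al).-tuple C) (a a' : n.-tuple C),
    generic_in a [set` b] (phi_at al b) -> phi al a' b' ->
    forall (s : {set 'I_n}) (i : 'I_n),
    let asb := coords s a `|` [set` b] in
    let asb' := coords s a' `|` [set` b'] in
    [/\ acl asb (tnth a i) -> acl asb' (tnth a' i),
        asb (tnth a i) -> asb' (tnth a' i)
      & ~ asb (tnth a i) -> ~ asb' (tnth a' i)];
  code_C3 : forall b b', theta al b ->
    MRlt (ck al) (phi_at al b `+` phi_at al b') -> b = b';
  code_C4 : forall xs b, psi al xs b -> [set` b] `<=` dcl (all_coords xs);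
  code_C5 : forall b, theta al b -> exists xs, psi al xs b;
  code_C6 : forall (a : (cm al).-tuple (n.-tuple C)) b a', psi al a b ->
    generic_in a' [set` b] (phi_at al b) ->
    indep_over [set` b] [set` a'] (all_coords a) ->
    forall i : 'I_(cm al),
      psi al [tuple if j == i then a' else tnth a j | j < cm al] b }.

Definition permute_tuple (C : closedFieldType) n (s : {perm 'I_n})
    (x : n.-tuple C) : n.-tuple C := [tuple tnth x (s i) | i < n].

Definition permute_code (C : closedFieldType) n (s : {perm 'I_n})
    (al : code C n) : code C n :=
  {| cl := cl al; cm := cm al; ck := ck al;
     phi := fun x y => phi al (permute_tuple s x) y;
     psi := fun xs y => psi al (map_tuple (permute_tuple s) xs) y |}.

(* [val xs = val ys] identifies m_al-tuples with m_be-tuples. *)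
Definition code_le (C : closedFieldType) n (al be : code C n) : Prop :=
  forall b, theta al b -> exists b' : (cl be).-tuple C,
    (forall x, phi al x b <-> phi be x b') /\
    (forall (xs : (cm al).-tuple (n.-tuple C)) (ys : (cm be).-tuple (n.-tuple C)),
        val xs = val ys -> (psi al xs b <-> psi be ys b')).

Definition code_equiv (C : closedFieldType) n (al be : code C n) : Prop :=
  [/\ cm al = cm be, code_le al be & code_le be al].

Record code_family (C : closedFieldType) (CC : forall n, set (code C n)) : Prop :=
  CodeFamily {
  family_code : forall n al, CC n al -> is_code al;
  family_P1 : forall n (X : set (n.-tuple C)), (0 < n)%N ->
    definable setT X -> X !=set0 -> (exists k, rank_degree1 k X) ->
    exists2 al : code C n, CC n al &
      exists b, MRlt (ck al) (phi_at al b `+` X);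
  family_P2 : forall n (al al' : code C n) b b', CC n al -> CC n al' ->
    theta al b -> MRlt (ck al) (phi_at al b `+` phi_at al' b') ->
    al = al';
  family_P3 : forall n (al : code C n) (s : {perm 'I_n}), CC n al ->
    exists2 be : code C n, CC n be & code_equiv (permute_code s al) be }.

Record good (p : nat) (C : closedFieldType) n (al : code C n) : Prop := Good {
  good_n : n = (p * ck al)%N;
  good_distinct : forall a b, phi al a b -> uniq a /\ (forall x, x \in a -> x \notin b);
  good_trdeg : forall a b, phi al a b -> forall s : {set 'I_n},
    (0 < #|s| < n)%N ->
    (p * trdeg (coords s a `|` [set` b]) [set` a] < n - #|s|)%N }.

Definition good_codes (p : nat) (C : closedFieldType)
    (CC : forall n, set (code C n)) n : set (code C n) :=
  [set al | CC n al /\ good p al].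

Record mustar_ok (p : nat) (C : closedFieldType) (CC : forall n, set (code C n))
    (mustar : forall n, code C n -> nat) : Prop := MustarOk {
  mustar_finite : forall n j,
    finite_set [set al : code C n | good_codes p CC al /\ mustar n al = j];
  mustar_equiv : forall n (al be : code C n) (s : {perm 'I_n}),
    good_codes p CC al -> good_codes p CC be ->
    code_equiv be (permute_code s al) -> mustar n be = mustar n al;
  mustar_ge : forall n (al : code C n), good_codes p CC al ->
    (cm al - 1 <= mustar n al)%N }.

Definition mu (p : nat) (C : closedFieldType)
    (mustar : forall n, code C n -> nat) n (al : code C n) : nat :=
  (((p - 1) * (n - 1) + 1) * cm al + mustar n al)%N.

(** * Colored sets *)

Record colored (C : Type) := Colored {
  pts : set C;
  black : set C;
  black_sub : black `<=` pts }.

Definition colored0 (C : Type) : colored C := Colored (@sub0set C set0).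

Definition colored_sub (C : Type) (A B : colored C) : Prop :=
  pts A `<=` pts B /\ black A = pts A `&` black B.

Section Delta.
Local Open Scope fset_scope.

(* delta of a finite set A, where N is the set of black points *)
Definition delta (p : nat) (C : closedFieldType) (N : set C) (A : {fset C}) : int :=
  (p * trdeg set0 [set` A])%:Z - (#|` [fset x in A | x \in N]|)%:Z.

Definition delta_fin (p : nat) (C : closedFieldType) (N : set C)
    (A B : {fset C}) : int :=
  delta p N (A `|` B) - delta p N B.

(* The set is non-empty and bounded below, so this is its minimum. *)
Definition delta_over (p : nat) (C : closedFieldType) (N : set C)
    (A : {fset C}) (Y : set C) : int :=
  infimum 0 [set delta_fin p N A D | D in
    [set D : {fset C} | ([set` A] `&` Y `<=` [set` D])%classic
                        /\ ([set` D] `<=` Y)%classic]].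
End Delta.

Definition self_sufficient (p : nat) (C : closedFieldType) (Y X : colored C) : Prop :=
  colored_sub Y X /\
  forall A : {fset C}, [set` A] `<=` pts X -> 0 <= delta_over p (black X) A (pts Y).

Definition elementary_on (C : closedFieldType) (A : set C) (g : C -> C) : Prop :=
  forall f, Lformula set0 f -> forall s : seq C, [set` s] `<=` A ->
    (GRing.holds s f <-> GRing.holds (map g s) f).

Definition isomorphic_over (C : closedFieldType) (B A A' : colored C) : Prop :=
  exists g : C -> C,
    [/\ set_bij (pts A) (pts A') g, g @` black A = black A',
        elementary_on (pts A) g & forall x, pts B x -> g x = x].

(** * The class K^mu *)

Record pseudo_morley (C : closedFieldType) (M : colored C) n (al : code C n)
    (b : (cl al).-tuple C) (r : nat) (a : 'I_r -> n.-tuple C) : Prop :=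
  PseudoMorley {
  pm_real : forall i, phi al (a i) b;
  pm_disj : forall i j, i != j -> forall x, x \in a i -> x \notin a j;
  pm_black : forall i, [set` a i] `<=` black M;
  pm_psi : forall h : 'I_(cm al) -> 'I_r, injective h ->
    psi al [tuple a (h i) | i < cm al] b }.

(* As usual when working in a saturated model, colored sets are small. *)
Record Kmu (kappa : Type) (p : nat) (C : closedFieldType)
    (CC : forall n, set (code C n)) (mustar : forall n, code C n -> nat)
    (M : colored C) : Prop := InKmu {
  Kmu_small : small kappa (pts M);
  Kmu_strong : self_sufficient p (colored0 C) M;
  Kmu_bound : forall n (al : code C n), good_codes p CC al ->
    forall b, theta al b -> forall r (a : 'I_r -> n.-tuple C),
    pseudo_morley M b a -> (r <= mu p mustar al)%N }.

(* Main.v *)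
(* Algebraic independence is a pregeometry whose rank [rk] is the transcendence
   degree, and Y is self-sufficient in X iff every finite set of black points s of
   X outside Y satisfies |s| <= p rk(s/Y).

   By Zorn's lemma, choose a maximal partial isomorphism over B from a self-
   sufficient subset of A onto a self-sufficient subset B0 of M, and extend it
   to a partial isomorphism on A whose image is independent from M over B0;
   replace A by this image. Then the union of M and A is the required amalgam.
   Indeed, suppose that it contained a pseudo-Morley sequence for a good code
   over b of length greater than mu. A count of delta shows that b is algebraic
   over M or over A. As M and A satisfy the bound, some member leaves the side
   over which b is algebraic; it is generic over that side and lies in the other
   one, hence b is algebraic over B0. So there are members a in A and a' in M
   which are generic over B0 in the same set of Morley degree 1. They have the
   same type over B0, and a -> a' extends the maximal map, a contradiction. *)
Require Import Defs.
From mathcomp Require Import all_boot all_order all_fingroup all_algebra.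
From mathcomp Require Import finmap mpoly.
From mathcomp Require Import mathcomp_extra boolp classical_sets functions.
From mathcomp Require Import cardinality.
From HB Require Import structures.
From mathcomp Require Import zify ring.

Set Implicit Arguments.
Unset Strict Implicit.
Unset Printing Implicit Defensive.

Import Order.TTheory GRing.Theory Num.Theory.

Local Open Scope classical_set_scope.
Local Open Scope ring_scope.

(** * Algebraic closure as a pregeometry *)

(** The obstacle is a long pseudo-Morley sequence spread over both sides whose parameter b belongs
    to neither. The size of [mu] excludes it: as [mustar] is at least m - 1 (m = [cm]), a sequence
    longer than [mu] has at least ((p-1)(n-1)+1)m + m members, which forces b to be algebraic over M
    or m members to miss M. In the latter case they lie in A and define b by C4.

    The map a -> a' extends the maximal one because a good code has n = p k: over the domain and
    over the image the new tuple consists of n black points and has rank at most k, so its delta is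
    at most 0 and adjoining it preserves self-sufficiency on both sides. It is new because a lies
    outside M and a' outside A.

    Independence of the image of A from M over B0 has two uses: tuples of A have the same rank over
    M as over B0, and common points outside B0 must be white, so that the colorings agree.

    Morley rank is compared with transcendence degree in one direction only; upper bounds come from
    C1. That polynomial equations determine types is obtained by back-and-forth in the saturated
    field. *)

Section SwapRoot.
Variables (K F : fieldType) (i : {rmorphism K -> F}) (x : F).

(** Both sums are the value at (x, y) of the same two-variable polynomial, grouped by powers of y
    and then of x. This symmetry is the source of the exchange property. *)
Lemma swap_root (Q : {poly {poly K}}) (y : F) :
  (\sum_(n < size Q) (map_poly i Q`_n).[x] * y ^+ n = 0) ->
  \sum_(n < size (swapXY Q)) (map_poly i (swapXY Q)`_n).[y] * x ^+ n = 0.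
Proof.
have E (T : {poly {poly K}}) a b : \sum_(n < size T) (map_poly i T`_n).[a] * b ^+ n
    = (map_poly (map_poly i) T).[b%:P].[a].
  have [->|T0] := eqVneq T 0; first by rewrite size_poly0 big_ord0 rmorph0 !horner0.
  rewrite [X in _ = X.[a]]horner_coef size_map_poly_id0; last first.
    by rewrite map_poly_eq0 lead_coef_eq0.
  by rewrite horner_sum; apply: eq_bigr => n _; rewrite coef_map hornerM -polyC_exp hornerC.
by rewrite !E -swapXY_map horner2_swapXY.
Qed.
End SwapRoot.

Section GenField.
Variable F : fieldType.
Implicit Types X Y : set F.

Lemma sub_gen_field X : X `<=` gen_field X.
Proof. by move=> x Xx K _ XK; apply: XK. Qed.

(** A boolean form of [gen_field], from which the generated field is built as a type [gsub X];
    polynomials over it and morphisms out of it then make sense. *)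
Definition gfp X : {pred F} := fun x => `[< gen_field X x >].

Lemma gfpP X x : reflect (gen_field X x) (x \in gfp X).
Proof. exact: asboolP. Qed.

Lemma gfp_divring X : divring_closed (gfp X).
Proof.
split; first by apply/gfpP => K [].
- move=> x y /gfpP Xx /gfpP Xy; apply/gfpP => K KP XK; case: (KP) => _ + _.
  by apply; [apply: Xx | apply: Xy].
- move=> x y /gfpP Xx /gfpP Xy; apply/gfpP => K KP XK; case: (KP) => _ _.
  by apply; [apply: Xx | apply: Xy].
Qed.

HB.instance Definition _ X := GRing.isDivringClosed.Build F (gfp X) (gfp_divring X).

Definition gsub X := {x : F | x \in gfp X}.
HB.instance Definition _ X := Choice.on (gsub X).
HB.instance Definition _ X := SubChoice.on (gsub X).
HB.instance Definition _ X := [SubChoice_isSubIntegralDomain of gsub X by <:].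
HB.instance Definition _ X := [SubIntegralDomain_isSubField of gsub X by <:].

Definition emb X (a : gsub X) : F := val a.
HB.instance Definition _ X := GRing.RMorphism.copy (@emb X) (val : gsub X -> F).


Lemma emb_mem X a : gen_field X (@emb X a).
Proof. exact/gfpP/valP. Qed.

Lemma emb_surj X x : gen_field X x -> exists a, x = @emb X a.
Proof. by move=> /gfpP Xx; exists (Sub x Xx : gsub X). Qed.

Lemma gen_field_min X (K : {pred F}) :
  divring_closed K -> X `<=` [set` K] -> gen_field X `<=` [set` K].
Proof. by move=> KP XK x; apply. Qed.

Lemma gen_fieldS X Y : X `<=` gen_field Y -> gen_field X `<=` gen_field Y.
Proof.
move=> XY x /(gen_field_min (gfp_divring Y)) h; apply/gfpP/h => y /XY /gfpP //.
Qed.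

(** Closure in the sense of fields, used in place of the model-theoretic [acl]; [cl_term] and
    [dcl_cl] relate it to formulas. *)
Definition algcl X : set F := [set x | algebraicOver (@emb X) x].

Lemma clP X x : algcl X x <->
  exists P : {poly F}, [/\ P != 0, forall i, gen_field X P`_i & root P x].
Proof.
split=> [[P P0 Px]|[P [P0 PX Px]]].
  exists (map_poly (@emb X) P); split=> //; first by rewrite map_poly_eq0.
  by move=> i; rewrite coef_map; apply: emb_mem.
have PX' i : P`_i \in gfp X by apply/gfpP.
pose Q : {poly gsub X} := \poly_(i < size P) (Sub (P`_i) (PX' i) : gsub X).
have QP : map_poly (@emb X) Q = P.
  apply/polyP => i; rewrite coef_map /= coef_poly; case: ltnP => //= h.
  by rewrite nth_default.
exists Q; last by rewrite QP.
by apply: contraNneq P0 => Q0; rewrite -QP Q0 rmorph0.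
Qed.

Lemma gen_field_cl X : gen_field X `<=` algcl X.
Proof. by move=> x /emb_surj[a ->]; exact: algebraic_id. Qed.

Lemma sub_cl X : X `<=` algcl X.
Proof. exact: subset_trans (@sub_gen_field X) (@gen_field_cl X). Qed.

Lemma clS X Y : X `<=` algcl Y -> algcl X `<=` algcl Y.
Proof.
move=> XY.
have gXY : gen_field X `<=` algcl Y.
  have h : divring_closed (fun x => `[< algcl Y x >]).
    split; first by apply/asboolP/algebraic1.
      by move=> x y /asboolP xY /asboolP yY; apply/asboolP/algebraic_sub.
    by move=> x y /asboolP xY /asboolP yY; apply/asboolP/algebraic_div.
  move=> x /(gen_field_min h) hx; apply/asboolP/hx => y /XY Yy.
  exact/asboolP.
move=> x /clP [P [P0 PX Px]].
apply/integral_algebraic/(integral_root P0 Px) => _ /(nthP 0)[i _ <-].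
by apply/integral_algebraic/gXY/PX.
Qed.

Lemma cl_subset X Y : X `<=` Y -> algcl X `<=` algcl Y.
Proof. by move=> XY; apply: clS; apply: subset_trans XY (@sub_cl Y). Qed.

Lemma gen_field_finite X x : gen_field X x ->
  exists2 s : seq F, [set` s] `<=` X & gen_field [set` s] x.
Proof.
pose K : {pred F} := fun x => `[< exists2 s : seq F, [set` s] `<=` X
  & gen_field [set` s] x >].
have h : divring_closed K.
  have mono (s t : seq F) y : gen_field [set` s] y ->
      gen_field [set` s ++ t] y /\ gen_field [set` t ++ s] y.
    by move=> sy; split; apply: gen_fieldS sy => z sz; apply: sub_gen_field;
      rewrite /= mem_cat sz ?orbT.
  have capp (s t : seq F) : [set` s] `<=` X -> [set` t] `<=` X -> [set` s ++ t] `<=` X.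
    by move=> sX tX z /=; rewrite mem_cat => /orP[/sX|/tX].
  split; first by apply/asboolP; exists nil => //; apply/gfpP/rpred1.
  - move=> y z /asboolP[s sX sy] /asboolP[t tX tz]; apply/asboolP.
    exists (s ++ t); first exact: capp.
    by apply/gfpP/rpredB; apply/gfpP; [have [] := mono s t _ sy|have [] := mono t s _ tz].
  - move=> y z /asboolP[s sX sy] /asboolP[t tX tz]; apply/asboolP.
    exists (s ++ t); first exact: capp.
    by apply/gfpP/rpred_div; apply/gfpP; [have [] := mono s t _ sy|have [] := mono t s _ tz].
move=> /(gen_field_min h) hx; apply/asboolP/hx => y Xy; apply/asboolP.
by exists [:: y]; [move=> z /=; rewrite inE => /eqP ->|
                  apply: sub_gen_field; rewrite /= inE].
Qed.

Lemma cl_finite X x : algcl X x ->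
  exists2 s : seq F, [set` s] `<=` X & algcl [set` s] x.
Proof.
move=> /clP [P [P0 PX Px]].
suff [s sX sP] : exists2 s : seq F, [set` s] `<=` X
    & forall i, (i < size P)%N -> gen_field [set` s] P`_i.
  exists s => //; apply/clP; exists P; split=> // i.
  have [/sP//|/(nth_default 0) ->] := ltnP i (size P).
  exact/gfpP/rpred0.
elim: (size P) => [|n [s sX IH]]; first by exists nil.
have [t tX tn] := gen_field_finite (PX n).
exists (s ++ t); first by move=> z /=; rewrite mem_cat => /orP[/sX|/tX].
have st : [set` s] `<=` [set` s ++ t] by move=> z /=; rewrite mem_cat => ->.
have ts : [set` t] `<=` [set` s ++ t] by move=> z /=; rewrite mem_cat orbC => ->.
move=> i; rewrite ltnS leq_eqVlt => /orP[/eqP ->|/IH].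
  by apply: gen_fieldS tn; apply: subset_trans (@sub_gen_field _).
by apply: gen_fieldS; apply: subset_trans (@sub_gen_field _).
Qed.

Section Fractions.
Variables (R : comNzRingType) (e : {rmorphism R -> F}).

(** In the applications [R] is a polynomial ring and [e] an evaluation. Rational functions are thus
    avoided, and [clear_denominators] can return to polynomial relations. *)
Lemma gen_field_frac X z : (forall y, X y -> exists u, y = e u) ->
  gen_field X z -> exists u v, e v != 0 /\ z = e u / e v.
Proof.
move=> XR; pose K : {pred F} := fun z => `[< exists u v, e v != 0 /\ z = e u / e v >].
have h : divring_closed K.
  split.
  - by apply/asboolP; exists 1, 1; rewrite rmorph1 divr1 oner_neq0.
  - move=> y1 y2 /asboolP[u1 [v1 [v10 ->]]] /asboolP[u2 [v2 [v20 ->]]].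
    apply/asboolP; exists (u1 * v2 - u2 * v1), (v1 * v2).
    rewrite rmorphB !rmorphM; split; first by rewrite mulf_neq0.
    by field; rewrite v10 v20.
  - move=> y1 y2 /asboolP[u1 [v1 [v10 ->]]] /asboolP[u2 [v2 [v20 ->]]].
    apply/asboolP; have [u20|u20] := eqVneq (e u2) 0.
      by exists 0, 1; rewrite u20 rmorph0 rmorph1 !(mul0r, invr0, mulr0) oner_neq0.
    exists (u1 * v2), (v1 * u2).
    rewrite !rmorphM; split; first by rewrite mulf_neq0.
    by field; rewrite u20 v10 v20.
move=> /(gen_field_min h) hz; apply/asboolP/hz => y /XR[u ->]; apply/asboolP.
by exists u, 1; rewrite rmorph1 divr1 oner_neq0.
Qed.

Lemma clear_denominators (P : {poly F}) :
  (forall n, exists u v, e v != 0 /\ P`_n = e u / e v) ->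
  exists d (Q : {poly R}), e d != 0 /\ forall n, e d * P`_n = e Q`_n.
Proof.
elim/poly_ind: P => [|P c IH] PX.
  by exists 1, 0; rewrite rmorph1 oner_neq0; split=> // n;
    rewrite !coef0 mulr0 rmorph0.
have [n|d [Q [d0 dP]]] := IH.
  by have := PX n.+1; rewrite coefD coefMX coefC /= addr0.
have := PX 0%N; rewrite coefD coefMX coefC /= add0r => -[u [v [v0 ->]]].
exists (d * v), (v *: Q * 'X + (d * u)%:P); split.
  by rewrite rmorphM mulf_neq0.
case=> [|n]; rewrite !coefD !coefMX !coefC /= rmorphM.
  by rewrite !add0r rmorphM; field.
by rewrite !addr0 coefZ rmorphM -dP mulrAC mulrC mulrA.
Qed.

End Fractions.

(** Clearing denominators turns an equation of y over X(x) into a relation Q(x, y) = 0 over X.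
    Regrouped by powers of x, it is an equation of x over X(y), provided that its coefficients do
    not all vanish. *)
Lemma cl_exchange X x y : algcl (X `|` [set x]) y -> ~ algcl X y -> algcl (X `|` [set y]) x.
Proof.
move=> /clP [P [P0 PX /rootP Py]] nXy.
pose e : {rmorphism {poly gsub X} -> F} := horner_eval x \o map_poly (@emb X).
have eE u : e u = (map_poly (@emb X) u).[x] by [].
have [n|d [Q [d0 dP]]] := @clear_denominators _ e P.
  apply: gen_field_frac (PX n) => z [Xz|->].
    have [a ->] := emb_surj (sub_gen_field Xz).
    by exists a%:P; rewrite eE map_polyC hornerC.
  by exists 'X; rewrite eE map_polyX hornerX.
rewrite eE in d0 dP.
have {}dP n : (map_poly (@emb X) d).[x] * P`_n = (map_poly (@emb X) Q`_n).[x] by rewrite dP.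
have Q0 : Q != 0.
  apply: contraNneq P0 => Q0; apply/eqP/polyP => n; rewrite coef0.
  by apply: (mulfI d0); rewrite dP Q0 coef0 rmorph0 hornerC mulr0.
have Qx : \sum_(n < size Q) (map_poly (@emb X) Q`_n).[x] * y ^+ n = 0.
  under eq_bigr do rewrite -dP -mulrA.
  rewrite -mulr_sumr -(@horner_coef_wide _ (size Q)) ?Py ?mulr0 //.
  apply/leq_sizeP => j hj; apply: (mulfI d0).
  by rewrite dP nth_default // rmorph0 hornerC mulr0.
have := swap_root Qx.
set R := swapXY Q => Rx.
have R0 : R != 0 by rewrite swapXY_eq0.
pose S := \poly_(n < size R) (map_poly (@emb X) R`_n).[y] : {poly F}.
have Sc n : S`_n = (map_poly (@emb X) R`_n).[y].
  by rewrite coef_poly; case: ltnP => // h; rewrite nth_default // rmorph0 hornerC.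
have Sx : S.[x] = 0 by rewrite horner_poly.
(* If all coefficients vanish at y, any nonzero coefficient of [R] makes y algebraic over X. *)
have [S0|S0] := eqVneq S 0.
  case: nXy; have [n Rn] : exists n, R`_n != 0.
    by exists (size R).-1; rewrite -lead_coefE lead_coef_eq0.
  apply/clP; exists (map_poly (@emb X) R`_n); split; first by rewrite map_poly_eq0.
    by move=> j; rewrite coef_map; apply: emb_mem.
  by apply/rootP; rewrite -Sc S0 coef0.
apply/clP; exists S; split=> //; last exact/rootP.
move=> n; rewrite Sc.
have sub : gen_field X `<=` gen_field (X `|` [set y]).
  by apply: gen_fieldS => z Xz; apply: sub_gen_field; left.
apply/gfpP/rpred_horner; last by apply/gfpP/sub_gen_field; right.
by apply/polyOverP => j; rewrite coef_map; apply/gfpP/sub/emb_mem.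
Qed.

End GenField.

Section Rank.
Variable F : fieldType.
Implicit Types (X Y : set F) (s t : seq F) (a b : F).

(** Elements are counted one after the other, each tested over [X] and its predecessors. Additivity
    under concatenation is built in; independence of the order is where the exchange property enters
    ([rk_swap]). *)
Fixpoint rk X s : nat :=
  if s is a :: s' then (~~ `[< algcl X a >] + rk (X `|` [set a]) s')%N else 0%N.

Lemma setU_seq1 X a s : X `|` [set` a :: s] = X `|` [set a] `|` [set` s].
Proof.
rewrite -setUA; congr (_ `|` _); apply/seteqP; split=> z /=.
  by rewrite inE => /orP[/eqP|]; [left|right].
by rewrite inE => -[->|->]; rewrite ?eqxx ?orbT.
Qed.

Lemma rk_anti X Y s : X `<=` algcl Y -> (rk Y s <= rk X s)%N.
Proof.
elim: s X Y => //= a s IH X Y XY; apply: leq_add.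
  rewrite leq_eqVlt; case: asboolP => //; case: asboolP => //= Xa Ya.
  by case: Ya; apply: clS Xa.
apply: IH => z [/XY|->]; last by apply: sub_cl; right.
by apply: cl_subset => ?; left.
Qed.

Lemma rk_cl X Y s : X `<=` algcl Y -> Y `<=` algcl X -> rk X s = rk Y s.
Proof. by move=> XY YX; apply/eqP; rewrite eqn_leq !rk_anti. Qed.

Lemma rk_cat X s t : rk X (s ++ t) = (rk X s + rk (X `|` [set` s]) t)%N.
Proof.
elim: s X => [|a s IH] X /=.
  by rewrite add0n; apply: rk_cl => z Xz; apply: sub_cl; [left|case: Xz].
by rewrite IH addnA -setU_seq1.
Qed.

Lemma rk_swap X a b s : rk X [:: a, b & s] = rk X [:: b, a & s].
Proof.
rewrite /= !addnA setUAC; congr addn.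
have m1 : algcl X a -> algcl (X `|` [set b]) a by apply: cl_subset => ?; left.
have m2 : algcl X b -> algcl (X `|` [set a]) b by apply: cl_subset => ?; left.
have i1 : algcl X a -> algcl (X `|` [set a]) b -> algcl X b.
  by move=> h; apply: clS => z [|->//]; exact: sub_cl.
have i2 : algcl X b -> algcl (X `|` [set b]) a -> algcl X a.
  by move=> h; apply: clS => z [|->//]; exact: sub_cl.
have e1 : algcl (X `|` [set a]) b -> ~ algcl X b -> algcl (X `|` [set b]) a := @cl_exchange _ _ _ _.
have e2 : algcl (X `|` [set b]) a -> ~ algcl X a -> algcl (X `|` [set a]) b := @cl_exchange _ _ _ _.
by do 4![case: asboolP] => //=; tauto.
Qed.

Lemma rk_mid X a s t : rk X (s ++ a :: t) = rk X (a :: s ++ t).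
Proof. by elim: s X => // b s IH X; rewrite rk_swap [LHS]/= IH. Qed.

Lemma rk_perm X s t : perm_eq s t -> rk X s = rk X t.
Proof.
apply: (@catCA_perm_subst _ _ (rk X)) => s1 s2 s3.
elim: s2 X => [|a s2 IH] X //=.
by rewrite rk_mid /= IH.
Qed.

Lemma rk_eq0 X s : [set` s] `<=` algcl X -> rk X s = 0%N.
Proof.
elim: s X => //= a s IH X sX; rewrite asboolT ?IH //.
  by move=> z zs; apply: (cl_subset (X := X)); [left|apply: sX; rewrite /= inE zs orbT].
by apply: sX; rewrite /= mem_head.
Qed.

Lemma rk0_cl X s : rk X s = 0%N -> [set` s] `<=` algcl X.
Proof.
elim: s X => [|a s IH] X //=; case: asboolP => //= Xa /IH h z /=.
rewrite inE => /orP[/eqP->//|/h]; apply: clS => y [|->//]; exact: sub_cl.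
Qed.

Lemma rk_le X s t : [set` s] `<=` algcl (X `|` [set` t]) -> (rk X s <= rk X t)%N.
Proof.
move=> st; have := rk_cat X t s; rewrite [X in (_ + X)%N]rk_eq0 // addn0 => <-.
rewrite (@rk_perm X (t ++ s) (s ++ t)) ?rk_cat ?leq_addr //.
by rewrite perm_catC.
Qed.

Lemma rk_sub X s t : {subset s <= t} -> (rk X s <= rk X t)%N.
Proof. by move=> st; apply: rk_le => z zs; apply: sub_cl; right; apply: st. Qed.

Lemma rk_mem X s t : s =i t -> rk X s = rk X t.
Proof. by move=> st; apply/eqP; rewrite eqn_leq !rk_sub // => z; rewrite st. Qed.

Lemma rk_size X s : (rk X s <= size s)%N.
Proof. by elim: s X => //= a s IH X; rewrite -add1n leq_add //; case: asboolP. Qed.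

Lemma rk_finite X s : exists2 t : seq F, [set` t] `<=` X & rk [set` t] s = rk X s.
Proof.
suff [t tX tP] : exists2 t : seq F, [set` t] `<=` X & (rk [set` t] s <= rk X s)%N.
  exists t => //; apply/eqP; rewrite eqn_leq tP rk_anti //.
  exact: subset_trans tX (@sub_cl _ X).
elim: s X => [|a s IH] X; first by exists nil.
have [t1 t1X t1a] : exists2 t : seq F, [set` t] `<=` X & algcl X a -> algcl [set` t] a.
  case: (pselect (algcl X a)) => [/cl_finite[t tX ta]|]; first by exists t.
  by move=> nXa; exists nil.
have [t2 t2X t2s] := IH (X `|` [set a]).
(* The list [t2] lies in X together with a. Only its part in X is kept, since [rk] adjoins a
   again. *)
exists (t1 ++ [seq z <- t2 | `[< X z >]]).
  move=> z /=; rewrite mem_cat => /orP[/t1X//|].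
  by rewrite mem_filter => /andP[/asboolP].
rewrite /=; apply: leq_add.
  case: (asboolP (algcl X a)) => [/t1a h|_]; last by case: asboolP.
  by rewrite asboolT //; apply: cl_subset h => z /=; rewrite mem_cat => ->.
apply: leq_trans t2s; apply: rk_anti => z zt2; apply: sub_cl.
case: (t2X _ zt2) => [Xz|->]; last by right.
by left => /=; rewrite mem_cat mem_filter zt2 (asboolT Xz) orbT.
Qed.

Lemma rk_basis X s : exists2 t : seq F, {subset t <= s} & size t = rk X s /\ rk X t = size t.
Proof.
elim: s X => [|a s IH] X; first by exists nil.
have [t ts [szt rt]] := IH (X `|` [set a]).
rewrite /=; case: asboolP => Xa /=.
  have E u : rk (X `|` [set a]) u = rk X u.
    by apply: rk_cl => z; [case=> [|->//]; exact: sub_cl|move=> ?; apply: sub_cl; left].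
  exists t; first by move=> z /ts; rewrite inE => ->; rewrite orbT.
  by rewrite add0n -E.
exists (a :: t); first by move=> z; rewrite !inE => /orP[->//|/ts ->]; rewrite orbT.
by rewrite /= szt asboolF // rt szt.
Qed.

Lemma rk_catC X s t :
  (rk X s + rk (X `|` [set` s]) t = rk X t + rk (X `|` [set` t]) s)%N.
Proof. by rewrite -!rk_cat; apply: rk_perm; rewrite perm_catC. Qed.

End Rank.

(** * Transcendence degree *)

Section MpolyLast.
Variables (K : comNzRingType) (n : nat).

Definition munilast (Q : {poly {mpoly K[n]}}) : {mpoly K[n.+1]} :=
  (map_poly (@mwiden n K) Q).['X_ord_max].

Lemma muni_mwiden (q : {mpoly K[n]}) : muni (mwiden q) = q%:P.
Proof.
rewrite (mpolyE q) (raddf_sum (@mwiden n K)) (raddf_sum (@muni n K)) (raddf_sum polyC) /=.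
apply: eq_bigr => m _; rewrite mwidenZ mwidenX muniZ muniE msuppX big_seq1.
rewrite mcoeffX eqxx scale1r mnmwiden_ordmax expr0 -mul_mpolyC polyCM.
rewrite -!mul_polyC mulr1; congr (_ * _%:P); congr 'X_[_].
by apply/mnmP => j; rewrite mnmE mnmwiden_widen.
Qed.

Lemma muni_Xmax : muni ('X_ord_max : {mpoly K[n.+1]}) = 'X.
Proof.
rewrite muniE msuppX big_seq1 mcoeffX eqxx scale1r mnm1E eqxx expr1.
rewrite -[RHS]scale1r -mpolyX0; congr (_ *: _); congr 'X_[_].
apply/mnmP => j; rewrite mnmE mnm1E mnm0E; apply/eqP; rewrite eqb0.
by rewrite -val_eqE /= gtn_eqF.
Qed.

Lemma munilastK (Q : {poly {mpoly K[n]}}) : muni (munilast Q) = Q.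
Proof.
rewrite /munilast horner_coef rmorph_sum /=.
rewrite -[RHS]coefK poly_def (big_ord_widen (size Q) (fun j =>
   muni ((map_poly (mwiden (R:=K)) Q)`_j * 'X_ord_max ^+ j)) (size_poly _ _)).
rewrite big_mkcond; apply: eq_bigr => j _.
have E : muni ((map_poly (mwiden (R:=K)) Q)`_j * 'X_ord_max ^+ j) = Q`_j *: 'X^j.
  by rewrite rmorphM rmorphXn /= muni_Xmax coef_map /= muni_mwiden mul_polyC.
case: ifP => // /negbT; rewrite -leqNgt => h.
by rewrite -E nth_default // mul0r rmorph0.
Qed.

Lemma muni_eq0 (P : {mpoly K[n.+1]}) : muni P = 0 -> P = 0.
Proof.
move=> P0; apply/mpolyP => m; rewrite mcoeff0.
have := congr1 (fun Q : {poly _} => Q`_(m ord_max)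
   @_[multinom m (widen_ord (leqnSn n) i) | i < n]) P0.
rewrite /= coef0 mcoeff0 muniE coef_sum (raddf_sum (mcoeff _)) /= => <-.
rewrite {1}(mpolyE P) (raddf_sum (mcoeff _)) /=; apply: eq_bigr => m' _.
rewrite mcoeffZ mcoeffX !coefZ coefXn mulr_natr.
have [<-|mm'] := eqVneq m' m; first by rewrite !eqxx mulr1n mcoeffZ mcoeffX eqxx.
rewrite mulr0; case: eqP => e; last by rewrite mulr0n mcoeff0.
rewrite mulr1n mcoeffZ mcoeffX; case: eqP => [e'|]; last by rewrite mulr0.
case/eqP: mm'; apply/mnmP => j; have [->//|jmax] := eqVneq j ord_max.
have jn : (j < n)%N.
  by have := ltn_ord j; rewrite ltnS leq_eqVlt => /orP[h|//]; case/negP: jmax.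
have := congr1 (fun M : 'X_{1..n} => M (Ordinal jn)) e'.
rewrite !mnmE; suff -> : widen_ord (leqnSn n) (Ordinal jn) = j by [].
exact: val_inj.
Qed.

Variables (F : comNzRingType) (i : {rmorphism K -> F}).

Lemma mmap_muni (v : 'I_n.+1 -> F) (P : {mpoly K[n.+1]}) :
  mmap i v P =
  (map_poly (mmap i (fun j => v (widen_ord (leqnSn n) j))) (muni P)).[v ord_max].
Proof.
rewrite muniE {1}(mpolyE P) !raddf_sum horner_sum /=; apply: eq_bigr => m _.
rewrite mmapZ mmapX map_polyZ /= hornerZ map_polyXn hornerXn mmapZ mmapX -mulrA.
congr (_ * _); rewrite /mmap1 big_ord_recr /=; congr (_ * _).
by apply: eq_bigr => j _; rewrite mnmE.
Qed.

End MpolyLast.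

Section AlgIndep.
Variables (F : fieldType) (X : set F).

(** [alg_indep] with coefficients in the field type [gsub X] instead of coefficients in F subject to
    a membership condition; [alg_indep_rk] passes between the two. *)
Definition mfree n (v : 'I_n -> F) :=
  forall P : {mpoly (gsub X)[n]}, mmap (@emb F X) v P = 0 -> P = 0.

(** This reproduces the recursion of [rk] for polynomials. A relation of v is a polynomial in the
    last variable with coefficients evaluated at w; conversely, clearing denominators in an equation
    of the last coordinate gives a relation of v. *)
Lemma mfree_step n (v : 'I_n.+1 -> F) (w := fun j => v (widen_ord (leqnSn n) j)) :
  mfree v <-> mfree w /\ ~ algcl (X `|` range w) (v ord_max).
Proof.
pose ev : {rmorphism {mpoly (gsub X)[n]} -> F} := mmap (@emb F X) w.
have evE P : ev P = mmap (@emb F X) w P by [].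
have evX y : (X `|` range w) y -> exists u, y = ev u.
  case=> [Xy|[j _ <-]]; last by exists 'X_j; rewrite evE mmapX mmap1U.
  by have [a ->] := emb_surj (sub_gen_field Xy); exists a%:MP; rewrite evE mmapC.
have genev u : gen_field (X `|` range w) (ev u).
  apply/gfpP; rewrite evE /mmap; apply: rpred_sum => m _; apply: rpredM.
    apply/gfpP; apply: gen_fieldS (emb_mem _) => z Xz.
    by apply: sub_gen_field; left.
  apply: rpred_prod => j _; apply: rpredX.
  by apply/gfpP/sub_gen_field; right; exists j.
split=> [vfree|[wfree vcl] P P0]; last first.
  apply: muni_eq0; apply/polyP => j; rewrite coef0; apply: wfree.
  move: P0; rewrite mmap_muni -/w => P0; move/polyP/(_ j): (congr1 id (erefl (muni P))).
  pose Q := map_poly ev (muni P); have [Q0|Q0] := eqVneq Q 0.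
    by move=> _; have /polyP/(_ j) := Q0; rewrite coef_map coef0 => <-.
  case: vcl; apply/clP; exists Q; split=> //; last exact/rootP.
  by move=> k; rewrite coef_map; exact: genev.
split=> [P P0|/clP[P [P0 PX /rootP Px]]].
  have /vfree : mmap (@emb F X) v (munilast P%:P) = 0.
    by rewrite mmap_muni munilastK map_polyC hornerC.
  move=> /(congr1 (@muni _ _)); rewrite munilastK rmorph0 => /eqP.
  by rewrite polyC_eq0 => /eqP.
have [m|d [Q [d0 dP]]] := @clear_denominators _ _ ev P.
  exact: gen_field_frac evX (PX m).
have QP : map_poly ev Q = ev d *: P.
  by apply/polyP => m; rewrite coefZ coef_map dP.
have /vfree : mmap (@emb F X) v (munilast Q) = 0.
  by rewrite mmap_muni munilastK [map_poly _ _]QP hornerZ Px mulr0.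
move=> /(congr1 (@muni _ _)); rewrite munilastK rmorph0 => Q0.
move: QP; rewrite Q0 rmorph0 => /esym/eqP.
by rewrite scaler_eq0 (negbTE d0) (negbTE P0).
Qed.

Lemma mfree0 (v : 'I_0 -> F) : mfree v.
Proof.
move=> P; have -> : P = (P@_0%MM)%:MP.
  apply/mpolyP => m; have -> : m = 0%MM by apply/mnmP; case.
  by rewrite mcoeffC eqxx mulr1.
by rewrite mmapC => /eqP; rewrite fmorph_eq0 => /eqP ->.
Qed.

Lemma mfree_rk n (t : n.-tuple F) : mfree (tnth t) <-> rk X t = n.
Proof.
elim: n t => [|n IH] t.
  by rewrite tuple0 /=; split=> // _; exact: mfree0.
pose w := [tuple tnth t (widen_ord (leqnSn n) j) | j < n].
have tE : val t = rcons w (tnth t ord_max).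
  apply: (@eq_from_nth _ 0); first by rewrite size_rcons !size_tuple.
  rewrite size_tuple => j jn; rewrite nth_rcons size_tuple.
  have [jn'|jn'] := ltnP j n.
    rewrite (nth_map (Ordinal jn')) ?size_enum_ord // (tnth_nth 0) /=.
    by rewrite nth_enum_ord.
  have -> : j = n by apply/eqP; rewrite eqn_leq jn' -ltnS jn.
  by rewrite eqxx (tnth_nth 0).
have wE : (fun j => tnth t (widen_ord (leqnSn n) j)) = tnth w.
  by apply/funext => j; rewrite tnth_mktuple.
have rangew : range (tnth w) = [set` w].
  by apply/seteqP; split=> [_ [j _ <-]|x /tnthP[j ->]]; [exact: mem_tnth|exists j].
rewrite mfree_step wE IH rangew tE -cats1 rk_cat /= addn0.
have := rk_size X w; rewrite size_tuple; case: asboolP => h wn; split.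
- by case.
- by rewrite addn0 => e; move: wn; rewrite e ltnn.
- by case=> -> _; rewrite addn1.
- by rewrite addn1 => -[].
Qed.

Lemma meval_map_emb n (v : 'I_n -> F) (P : {mpoly (gsub X)[n]}) :
  (map_mpoly (@emb F X) P).@[v] = mmap (@emb F X) v P.
Proof.
rewrite {1}(mpolyE P) [RHS]/mmap (raddf_sum (map_mpoly (@emb F X))) raddf_sum /=.
apply: eq_bigr => m _; rewrite map_mpolyZ map_mpolyX mevalZ mevalX.
by [].
Qed.

Lemma alg_indep_rk s : alg_indep X s <-> rk X s = size s.
Proof.
rewrite -(mfree_rk (in_tuple s)); split=> h P.
  move=> P0; have Q0 : map_mpoly (@emb F X) P = 0.
    apply: h => [m|]; first by rewrite mcoeff_map_mpoly; exact: emb_mem.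
    by rewrite meval_map_emb.
  apply/mpolyP => m; rewrite mcoeff0; apply/eqP; rewrite -(fmorph_eq0 (@emb F X)).
  by rewrite -(@mcoeff_map_mpoly _ _ _ (@emb F X)) Q0 mcoeff0.
move=> PX P0; have /choice[c cP] : forall m, exists a, P@_m = @emb F X a.
  by move=> m; exact: emb_surj.
pose Q := \sum_(m <- msupp P) c m *: 'X_[m].
have QP : map_mpoly (@emb F X) Q = P.
  rewrite [RHS](mpolyE P) /Q (raddf_sum (map_mpoly (@emb F X))) /=.
  by apply: eq_bigr => m _; rewrite map_mpolyZ map_mpolyX cP.
have Q0 : Q = 0 by apply: h; rewrite -meval_map_emb QP.
by rewrite -QP Q0 rmorph0.
Qed.

(** The supremum in [trdeg] is attained by a basis extracted from s, and an independent list in the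
    generated field has its length equal to its rank, which is at most that of s. *)
Lemma trdegE A s : A = [set` s] -> trdeg X A = rk X s.
Proof.
move=> ->; rewrite /trdeg; set S := (X in supremum _ X).
have Sub : ubound S (rk X s).
  move=> _ [t [ts /alg_indep_rk <-] <-]; apply: rk_le.
  exact: subset_trans ts (@gen_field_cl _ _).
have Sin : S (rk X s).
  have [t ts [szt rt]] := rk_basis X s; exists t => //; split.
    by move=> z /ts zs; apply: sub_gen_field; right.
  by apply/alg_indep_rk; rewrite rt.
apply/eqP; rewrite eqn_leq; apply/andP; split; last first.
  have /ge_supremum_Nmem h : supremums S !=set0.
    by apply: nat_supremums_neq0; exists (rk X s).
  by have := h 0%N _ Sin; rewrite leEnat.
rewrite /supremum; case: ifPn => [//|_].
case: xgetP => [y _ [_ +]|//]; by apply.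
Qed.

End AlgIndep.

(** * Partial maps and small sets *)

Section PartialMaps.
Variable T : eqType.
Variable P : set T -> (T -> T) -> Prop.

Hypothesis P_ext : forall K g h, (forall x, K x -> g x = h x) -> P K g -> P K h.
(* In particular P passes to the union of a chain of partial maps. *)
Hypothesis P_local : forall K g,
  (forall s : seq T, [set` s] `<=` K ->
     exists K', [/\ [set` s] `<=` K', K' `<=` K & P K' g]) -> P K g.

(** A partial map is a domain with a total function whose values elsewhere are irrelevant; hence
    extension is only a preorder, and [P_ext] is required. Cardinals are compared, isomorphisms
    extended and the amalgam built with it. *)
Lemma maximal_partial_map K0 g0 : P K0 g0 ->
  exists K g, [/\ P K g, K0 `<=` K, forall x, K0 x -> g x = g0 x &
    forall K' g', P K' g' -> K `<=` K' -> (forall x, K x -> g' x = g x) ->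
      K' `<=` K].
Proof.
move=> P0.
pose D := {Kg : set T * (T -> T) | [/\ P Kg.1 Kg.2, K0 `<=` Kg.1 &
  forall x, K0 x -> Kg.2 x = g0 x]}.
pose R (a b : D) := `[< (sval a).1 `<=` (sval b).1 /\
  forall x, (sval a).1 x -> (sval b).2 x = (sval a).2 x >].
pose d0 : D := exist _ (K0, g0) (And3 P0 (fun _ h => h) (fun _ _ => erefl)).
have Rrefl t : R t t by apply/asboolP; split.
have Rtrans r s t : R r s -> R s t -> R r t.
  move=> /asboolP[rs rs'] /asboolP[st st']; apply/asboolP; split=> x xr.
    exact/st/rs.
  by rewrite st' ?rs' //; exact: rs.
have [|d dmax] := ZL_preorder d0 Rrefl Rtrans.
  move=> A Atot; have [[a0 Aa0]|A0] := pselect (exists a, A a); last first.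
    by exists d0 => s As; case: A0; exists s.
  pose K x := exists2 a, A a & (sval a).1 x.
  (* The members of the chain agree where they are defined, so one function can follow all of
     them. *)
  have /choice[g gP] : forall x, exists y, forall a, A a -> (sval a).1 x ->
      y = (sval a).2 x.
    move=> x; have [[a Aa ax]|nKx] := pselect (K x); last first.
      by exists x => a Aa ax; case: nKx; exists a.
    exists ((sval a).2 x) => b Ab bx.
    by have [/asboolP[_ ->]|/asboolP[_ ->]] := Atot _ _ Aa Ab.
  have dP : [/\ P K g, K0 `<=` K & forall x, K0 x -> g x = g0 x].
    split.
    - apply: P_local => s sK.
      suff [a Aa sa] : exists2 a, A a & [set` s] `<=` (sval a).1.
        exists (sval a).1; split=> // [x ax|]; first by exists a.
        case: (svalP a) => Pa _ _; apply: P_ext Pa => x ax.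
        by rewrite (gP x a).
      elim: s sK => [|x s IH] sK; first by exists a0.
      have [|a Aa sa] := IH.
        by move=> z zs; apply: sK; rewrite /= inE; apply/orP; right.
      have [b Ab bx] := sK x (mem_head _ _).
      have [/asboolP[ab _]|/asboolP[ba _]] := Atot _ _ Aa Ab.
        by exists b => // z /=; rewrite inE => /orP[/eqP->//|/sa/ab].
      by exists a => // z /=; rewrite inE => /orP[/eqP->|/sa//]; exact: ba.
    - by move=> x K0x; exists a0 => //; case: (svalP a0) => _ + _; exact.
    - move=> x K0x; case: (svalP a0) => _ h1 h2.
      by rewrite (gP x a0) ?h2 //; exact: h1.
  exists (exist _ (K, g) dP) => a Aa; apply/asboolP; split=> /= x ax.
    by exists a.
  by rewrite (gP x a).
exists (sval d).1, (sval d).2; case: (svalP d) => PK KK0 gg0.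
split=> // K' g' PK' KK' gg'.
have dP : [/\ P K' g', K0 `<=` K' & forall x, K0 x -> g' x = g0 x].
  split=> // [|x K0x]; first exact: (subset_trans KK0 KK').
  by rewrite gg' ?gg0 //; exact: (KK0).
suff /dmax/asboolP[] : R d (exist _ (K', g') dP) by [].
by apply/asboolP; split.
Qed.

End PartialMaps.

Lemma infinite_injection (T : Type) (B : set T) : infinite_set B ->
  exists s : nat -> T, injective s /\ forall n, B (s n).
Proof.
move=> /infiniteP/card_leP[f].
pose e n : [set: nat] := SigSub (mem_set (I : [set: nat] n)).
exists (fun n => val (f (e n))); split=> [n m /val_inj|n]; last exact/set_mem/valP.
by move/inj; rewrite !inE => /(_ I I)/(congr1 val).
Qed.

(** * Cardinal arithmetic behind unions of small sets *)

Section Cardinals.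
Variable T : choiceType.
Implicit Types A B X Y Z : set T.

Lemma card_le_fun (U : Type) A (B : set U) (f : T -> U) :
  (forall x, A x -> B (f x)) -> {in A &, injective f} -> (A #<= B)%card.
Proof.
move=> fAB fI; have := inj_card_eq fI; rewrite card_eq_sym.
move=> /card_eqPle[h _]; apply: card_le_trans h _.
by apply: subset_card_le => _ [x Ax <-]; exact: fAB.
Qed.

(** A maximal injective partial map from A to B is defined on all of A or reaches all of B;
    otherwise one more pair could be added. *)
Lemma comparable_injection A B :
  (exists f : T -> T, (forall x, A x -> B (f x)) /\ {in A &, injective f}) \/
  (exists f : T -> T, (forall x, B x -> A (f x)) /\ {in B &, injective f}).
Proof.
pose P K (g : T -> T) := [/\ K `<=` A, forall x, K x -> B (g x) &
  forall x y, K x -> K y -> g x = g y -> x = y].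
have [|||K [g [[KA gB gI] _ _ Kmax]]] := @maximal_partial_map T P _ _ set0 id.
- move=> K g h gh [KA gB gI]; split=> // [x Kx|x y Kx Ky].
    by rewrite -gh //; exact: gB.
  by rewrite -!gh //; exact: gI.
- move=> K g loc; split.
  + by move=> x Kx; have [|K' [xK' _ [+ _ _]]] := loc [:: x];
      [move=> z /=; rewrite inE => /eqP ->|apply; apply: xK'; rewrite /= mem_head].
  + by move=> x Kx; have [|K' [xK' _ [_ + _]]] := loc [:: x];
      [move=> z /=; rewrite inE => /eqP ->|apply; apply: xK'; rewrite /= mem_head].
  + move=> x y Kx Ky; have [|K' [xK' _ [_ _ +]]] := loc [:: x; y].
      by move=> z /=; rewrite !inE => /orP[] /eqP ->.
    by apply; apply: xK'; rewrite /= !inE eqxx ?orbT.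
- by split=> // x [].
have [AK|/existsNP[a /not_implyP[Aa nKa]]] := pselect (A `<=` K).
  left; exists g; split=> [x Ax|x y]; first exact/gB/AK.
  by rewrite !inE => Ax Ay; apply: gI; exact: AK.
have [BK|/existsNP[b /not_implyP[Bb nKb]]] := pselect (B `<=` g @` K).
  right; have /choice[f fP] : forall y, exists x, B y -> K x /\ g x = y.
    move=> y; have [/BK[x Kx <-]|nBy] := pselect (B y); first by exists x.
    by exists y.
  exists f; split=> [x Bx|x y]; first by have [? _] := fP _ Bx; exact: KA.
  by rewrite !inE => /fP[_ {2}<-] /fP[_ {2}<-] ->.
pose g' x := if x == a then b else g x.
have g'K x : K x -> g' x = g x.
  by move=> Kx; rewrite /g'; case: eqP => // xa; case: nKa; rewrite -xa.
exfalso; apply: nKa; apply: (Kmax (K `|` [set a]) g'); [|by left|exact: g'K|by right].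
have g'a : g' a = b by rewrite /g' eqxx.
split=> [x [/KA//|->//]|x [Kx|->]|x y [Kx|->] [Ky|->] //].
- by rewrite g'K //; exact: gB.
- by rewrite g'a.
- by rewrite !g'K //; exact: gI.
- by rewrite g'a g'K // => h; case: nKb; exists x.
- by rewrite g'a g'K // => h; case: nKb; exists y.
Qed.

(** A maximal family of disjoint injective sequences leaves only finitely many points uncovered, and
    these are prepended to one of its members. Splitting B into copies of the natural numbers serves
    to fit two copies of B into B. *)
Lemma sequence_partition B : infinite_set B ->
  exists F : set (nat -> T), [/\ forall s n, F s -> B (s n),
    forall x, B x -> exists2 s, F s & exists n, s n = x &
    forall s s' n m, F s -> F s' -> s n = s' m -> s = s' /\ n = m].
Proof.
move=> Binf.
pose Q (F : set (nat -> T)) := (forall s n, F s -> B (s n)) /\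
  forall s s' n m, F s -> F s' -> s n = s' m -> s = s' /\ n = m.
have [F|F [[FB FI] Fmax]] := @Zorn_bigcup _ Q.
  move=> FQ Ftot; split=> [s n [G FG Gs]|s s' n m [G FG Gs] [G' FG' Gs']].
    by have [+ _] := FQ _ FG; exact.
  have [GG'|G'G] := Ftot _ _ FG FG'.
    by have [_ +] := FQ _ FG'; apply=> //; exact: GG'.
  by have [_ +] := FQ _ FG; apply=> //; exact: G'G.
pose U := [set x | exists2 s, F s & exists n, s n = x].
have addseq (s : nat -> T) (F' := F `|` [set s]) : injective s -> (forall n, B (s n)) ->
    (forall n, ~ U (s n)) -> False.
  move=> sI sB sU; apply: (Fmax F').
    split=> [|h]; first by move=> t Ft; left.
    by apply: (sU 0%N); exists s; [apply: h; right|exists 0%N].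
  split=> [t n [/FB//|->//]|t t' n m [Ft|->] [Ft'|->]].
  - exact: FI.
  - by move=> e; case: (sU m); exists t => //; exists n.
  - by move=> e; case: (sU n); exists t' => //; exists m.
  - by move=> /sI.
have Rfin : finite_set (B `\` U).
  apply: contrapT => /infinite_injection[s [sI sB]].
  by apply: (addseq s) => // n; have [] := sB n.
have [s0 Fs0] : exists s, F s.
  apply: contrapT => nF; apply: Binf; apply: sub_finite_set Rfin => x Bx.
  by split=> // -[s Fs _]; apply: nF; exists s.
have /finite_seqP[r rE] := Rfin.
pose r' := undup r.
have r'E x : x \in r' <-> (B `\` U) x by rewrite rE /r' /= mem_undup.
pose k := size r'.
(* The uncovered points take the first k places and [s0] is shifted by k. *)
pose s1 n := if (n < k)%N then nth (s0 0%N) r' n else s0 (n - k)%N.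
have s1r n : (n < k)%N -> s1 n = nth (s0 0%N) r' n by rewrite /s1 => ->.
have s1s n : s1 (n + k)%N = s0 n by rewrite /s1 addnK ltnNge leq_addl.
have s1P n : (exists2 m, n = (m + k)%N & s1 n = s0 m) \/
    (n < k)%N /\ (B `\` U) (s1 n).
  have [nk|kn] := ltnP n k; last by left; exists (n - k)%N; rewrite ?subnK // -s1s subnK.
  by right; split=> //; apply/r'E; rewrite s1r // mem_nth.
exists ((F `\ s0) `|` [set s1]); split.
- move=> s n [[Fs _]|->]; first exact: FB.
  by have [[m _ ->]|[_ []]] := s1P n; first exact: FB.
- move=> x Bx; have [[s Fs [n sn]]|nUx] := pselect (U x); last first.
    have /(nthP (s0 0%N))[n nk nx] : x \in r' by apply/r'E.
    by exists s1; [right|exists n; rewrite s1r].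
  have [ss0|ss0] := pselect (s = s0); last by exists s; [left|exists n].
  by exists s1; [right|exists (n + k)%N; rewrite s1s -ss0].
have cross s n m : (F `\ s0) s -> s n = s1 m -> False.
  move=> [Fs ss0]; have [[m' _ ->]|[_ [_ nU]]] := s1P m.
    by case/(FI _ _ _ _ Fs Fs0) => e _; apply: ss0.
  by move=> e; apply: nU; exists s => //; exists n.
move=> s s' n m [Fs|->] [Fs'|->].
- by apply: FI; [case: Fs|case: Fs'].
- by move/(cross _ _ _ Fs).
- by move/esym/(cross _ _ _ Fs').
move=> e; split=> //; move: e.
have [[n' nE ->]|[nk nU]] := s1P n; have [[m' mE ->]|[mk mU]] := s1P m.
- by move=> /(FI _ _ _ _ Fs0 Fs0)[_ e]; rewrite nE mE e.
- by move=> e; case: mU => _; case; exists s0 => //; exists n'.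
- by move=> e; case: nU => _; case; exists s0 => //; exists m'.
- by rewrite !s1r // => /eqP; rewrite nth_uniq ?undup_uniq // => /eqP.
Qed.

Lemma infinite_double B : infinite_set B ->
  exists g : T -> bool -> T, (forall x b, B x -> B (g x b)) /\
    forall x y b c, B x -> B y -> g x b = g y c -> x = y /\ b = c.
Proof.
move=> /sequence_partition[F [FB Fcov FI]].
have /choice[h hP] : forall x, exists sn : (nat -> T) * nat,
    B x -> F sn.1 /\ sn.1 sn.2 = x.
  move=> x; have [/Fcov[s Fs [n snx]]|nBx] := pselect (B x).
    by exists (s, n).
  by exists (fun=> x, 0%N).
(* The point at place n of a sequence is sent to the places 2n and 2n + 1 of the same sequence. *)
exists (fun x (b : bool) => (h x).1 (b + (h x).2.*2)%N); split.
  by move=> x b /hP[Fs _]; exact: FB.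
move=> x y b c /hP[Fx xE] /hP[Fy yE] /(FI _ _ _ _ Fx Fy)[e1 e2].
have bc : b = c by have := congr1 odd e2; rewrite !oddD !odd_double !addbF !oddb.
split=> //; rewrite -xE -yE e1; congr ((h y).1 _).
by move: e2; rewrite bc => /addnI/(congr1 half); rewrite !doubleK.
Qed.

(** One of X and Y injects into the other, and the larger one contains two disjoint copies of
    itself. Closure of small sets under union rests on this. *)
Lemma infinite_setU_card_le Z X Y : infinite_set Z -> Z `<=` X `|` Y ->
  (Z #<= X)%card \/ (Z #<= Y)%card.
Proof.
move=> Zinf ZXY.
have key A B (h : T -> T) : Z `<=` A `|` B -> (forall x, A x -> B (h x)) ->
    {in A &, injective h} -> (Z #<= B)%card.
  move=> ZAB hAB hI.
  have [|g [gB gI]] := @infinite_double B.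
    move=> Bfin; apply: Zinf; apply: sub_finite_set ZAB _.
    rewrite finite_setU; split=> //.
    apply: card_le_finite Bfin; exact: card_le_fun hAB hI.
  pose f x := if `[< B x >] then g x false else g (h x) true.
  apply: (@card_le_fun _ _ _ f) => [x /ZAB ABx|x y].
    by rewrite /f; case: asboolP => [/gB//|nB]; apply: gB; case: ABx => // /hAB.
  rewrite !inE => /ZAB Zx /ZAB Zy; rewrite /f.
  case: asboolP => Bx; case: asboolP => By.
  - by case/gI.
  - by case/gI => //; apply: hAB; case: Zy.
  - by case/gI => //; apply: hAB; case: Zx.
  - have Ax : A x by case: Zx.
    have Ay : A y by case: Zy.
    by case/gI => [||/hI -> //]; rewrite ?inE //; exact: hAB.
have [[f [fXY fI]]|[f [fYX fI]]] := comparable_injection X Y.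
  by right; exact: key ZXY fXY fI.
by left; apply: key fYX fI; rewrite setUC.
Qed.

End Cardinals.

Section Small.
Variables (kappa : Type) (T : choiceType).
Hypothesis kappa_unc : ~ countable [set: kappa].
Implicit Types X Y : set T.

Lemma smallU X Y : small kappa X -> small kappa Y -> small kappa (X `|` Y).
Proof.
move=> sX sY /card_subP[Z ZK ZXY].
have Zinf : infinite_set Z.
  move=> Zfin; apply: kappa_unc; apply: finite_set_countable.
  by rewrite -(eq_finite_set ZK).
have KZ : ([set: kappa] #<= Z)%card by move: ZK; rewrite card_eq_sym => /card_eqPle[].
have [ZX|ZY] := infinite_setU_card_le Zinf ZXY.
  by apply: sX; exact: card_le_trans ZX.
by apply: sY; exact: card_le_trans ZY.
Qed.

Lemma small_countable X : countable X -> small kappa X.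
Proof. by move=> cX KX; apply: kappa_unc; exact: sub_countable KX cX. Qed.

Lemma small_finite X : finite_set X -> small kappa X.
Proof. by move=> /finite_set_countable; exact: small_countable. Qed.

Lemma smallS X Y : X `<=` Y -> small kappa Y -> small kappa X.
Proof. by move=> XY sY KX; apply: sY; apply: card_le_trans (subset_card_le XY). Qed.

Lemma small_image X (f : T -> T) : small kappa X -> small kappa (f @` X).
Proof. by move=> sX KX; apply: sX; exact: card_le_trans (card_image_le f X). Qed.

End Small.

(** * Terms, formulas and partial isomorphisms *)

Section Terms.
Variable C : closedFieldType.
Implicit Types (X Y : set C) (t : GRing.term C) (f : GRing.formula C) (g h : C -> C).

Fixpoint tmap g t : GRing.term C :=
  match t with
  | GRing.Var i => GRing.Var _ i
  | GRing.Const c => GRing.Const (g c)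
  | GRing.NatConst n => GRing.NatConst _ n
  | GRing.Add t1 t2 => GRing.Add (tmap g t1) (tmap g t2)
  | GRing.Opp t1 => GRing.Opp (tmap g t1)
  | GRing.NatMul t1 n => GRing.NatMul (tmap g t1) n
  | GRing.Mul t1 t2 => GRing.Mul (tmap g t1) (tmap g t2)
  | GRing.Inv t1 => GRing.Inv (tmap g t1)
  | GRing.Exp t1 n => GRing.Exp (tmap g t1) n
  end.

Fixpoint fmap g f : GRing.formula C :=
  match f with
  | GRing.Bool b => GRing.Bool b
  | GRing.Equal t1 t2 => GRing.Equal (tmap g t1) (tmap g t2)
  | GRing.Unit t1 => GRing.Unit (tmap g t1)
  | GRing.And f1 f2 => GRing.And (fmap g f1) (fmap g f2)
  | GRing.Or f1 f2 => GRing.Or (fmap g f1) (fmap g f2)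
  | GRing.Implies f1 f2 => GRing.Implies (fmap g f1) (fmap g f2)
  | GRing.Not f1 => GRing.Not (fmap g f1)
  | GRing.Exists i f1 => GRing.Exists i (fmap g f1)
  | GRing.Forall i f1 => GRing.Forall i (fmap g f1)
  end.

(** Turns the environment into parameters. A variable beyond its end has the default value 0 and
    becomes a numeral, so that no further parameter is introduced. *)
Fixpoint tinst (e : seq C) t : GRing.term C :=
  match t with
  | GRing.Var i => if (i < size e)%N then GRing.Const e`_i else GRing.NatConst _ 0
  | GRing.Const c => GRing.Const c
  | GRing.NatConst n => GRing.NatConst _ n
  | GRing.Add t1 t2 => GRing.Add (tinst e t1) (tinst e t2)
  | GRing.Opp t1 => GRing.Opp (tinst e t1)
  | GRing.NatMul t1 n => GRing.NatMul (tinst e t1) n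
  | GRing.Mul t1 t2 => GRing.Mul (tinst e t1) (tinst e t2)
  | GRing.Inv t1 => GRing.Inv (tinst e t1)
  | GRing.Exp t1 n => GRing.Exp (tinst e t1) n
  end.

Lemma eval_tinst e e' t : GRing.eval e' (tinst e t) = GRing.eval e t.
Proof.
elim: t => //= [i|t1 -> t2 ->|t ->|t -> n|t1 -> t2 ->|t ->|t -> n] //.
by case: ltnP => //= ?; rewrite nth_default.
Qed.

Lemma eval_tmap_tinst g e e' t :
  GRing.eval e' (tmap g (tinst e t)) = GRing.eval (map g e) (tmap g t).
Proof.
elim: t => //= [i|t1 -> t2 ->|t ->|t -> n|t1 -> t2 ->|t ->|t -> n] //.
case: ltnP => /= ?; first by rewrite (nth_map 0).
by rewrite nth_default ?size_map.
Qed.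

Lemma Lterm_tinst X e t : [set` e] `<=` X -> Lterm X t -> Lterm X (tinst e t).
Proof.
move=> eX; elim: t => //= [i _|t1 h1 t2 h2 []|t1 h1 t2 h2 []].
- by case: ltnP => //= ie; apply: eX; rewrite /= mem_nth.
- by move=> /h1 ? /h2.
- by move=> /h1 ? /h2.
Qed.

Lemma LtermS X Y t : X `<=` Y -> Lterm X t -> Lterm Y t.
Proof.
move=> XY; elim: t => //= [t1 h1 t2 h2 []|t1 h1 t2 h2 []].
- by move=> /h1 ? /h2.
- by move=> /h1 ? /h2.
Qed.

Lemma LformulaS X Y f : X `<=` Y -> Lformula X f -> Lformula Y f.
Proof.
move=> XY; elim: f => //= [t1 t2 []|f1 h1 f2 h2 []|f1 h1 f2 h2 []|f1 h1 f2 h2 []].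
- by move=> /(LtermS XY) ? /(LtermS XY).
- by move=> /h1 ? /h2.
- by move=> /h1 ? /h2.
- by move=> /h1 ? /h2.
Qed.

Lemma finite_support_and X (P1 P2 : set C -> Prop) :
  (forall Y Z : set C, Y `<=` Z -> P1 Y -> P1 Z) ->
  (forall Y Z : set C, Y `<=` Z -> P2 Y -> P2 Z) ->
  (exists2 s : seq C, [set` s] `<=` X & P1 [set` s]) ->
  (exists2 s : seq C, [set` s] `<=` X & P2 [set` s]) ->
  exists2 s : seq C, [set` s] `<=` X & P1 [set` s] /\ P2 [set` s].
Proof.
move=> m1 m2 [s1 s1X h1] [s2 s2X h2]; exists (s1 ++ s2).
  by move=> z /=; rewrite mem_cat => /orP[/s1X|/s2X].
by split; [apply: m1 h1|apply: m2 h2] => z /=; rewrite mem_cat => ->; rewrite ?orbT.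
Qed.

Lemma Lterm_finite X t : Lterm X t ->
  exists2 s : seq C, [set` s] `<=` X & Lterm [set` s] t.
Proof.
elim: t => //=; try by move=> *; exists nil.
- move=> c Xc; exists [:: c]; last by rewrite /= mem_head.
  by move=> z /=; rewrite inE => /eqP ->.
- move=> t1 h1 t2 h2 [/h1 i1 /h2 i2].
  by apply: (@finite_support_and X (@Lterm C ^~ t1) (@Lterm C ^~ t2))
    => // Y Z /= YZ; exact: LtermS.
- move=> t1 h1 t2 h2 [/h1 i1 /h2 i2].
  by apply: (@finite_support_and X (@Lterm C ^~ t1) (@Lterm C ^~ t2))
    => // Y Z /= YZ; exact: LtermS.
Qed.

Lemma Lformula_finite X f : Lformula X f ->
  exists2 s : seq C, [set` s] `<=` X & Lformula [set` s] f.
Proof.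
elim: f => //=; try by move=> *; exists nil.
- move=> t1 t2 [/Lterm_finite h1 /Lterm_finite h2].
  by apply: (@finite_support_and X (@Lterm C ^~ t1) (@Lterm C ^~ t2))
    => // Y Z /= YZ; exact: LtermS.
- move=> t1 h1 t2 h2 [/h1 i1 /h2 i2].
  by apply: (@finite_support_and X (@Lformula C ^~ t1) (@Lformula C ^~ t2))
    => // Y Z /= YZ; exact: LformulaS.
- move=> t1 h1 t2 h2 [/h1 i1 /h2 i2].
  by apply: (@finite_support_and X (@Lformula C ^~ t1) (@Lformula C ^~ t2))
    => // Y Z /= YZ; exact: LformulaS.
- move=> t1 h1 t2 h2 [/h1 i1 /h2 i2].
  by apply: (@finite_support_and X (@Lformula C ^~ t1) (@Lformula C ^~ t2))
    => // Y Z /= YZ; exact: LformulaS.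
Qed.

Lemma tmap_id X g t : (forall x, X x -> g x = x) -> Lterm X t -> tmap g t = t.
Proof.
move=> gX; elim: t => //= [c|t1 h1 t2 h2 []|t h|t h n|t1 h1 t2 h2 []|t h n].
- by move=> /gX ->.
- by move=> /h1 -> /h2 ->.
- by move=> /h ->.
- by move=> /h ->.
- by move=> /h1 -> /h2 ->.
- by move=> /h ->.
Qed.

Lemma eq_tmap X g h t : (forall x, X x -> g x = h x) -> Lterm X t -> tmap g t = tmap h t.
Proof.
move=> gX; elim: t => //= [c|t1 h1 t2 h2 []|t i|t i n|t1 h1 t2 h2 []|t i n].
- by move=> /gX ->.
- by move=> /h1 -> /h2 ->.
- by move=> /i ->.
- by move=> /i ->.
- by move=> /h1 -> /h2 ->.
- by move=> /i ->.
Qed.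

Lemma tmap_comp g h t : tmap g (tmap h t) = tmap (g \o h) t.
Proof.
by elim: t => //= [t1 -> t2 ->|t ->|t -> n|t1 -> t2 ->|t ->|t -> n].
Qed.

Lemma Lterm_tmap X Y g t : (forall x, X x -> Y (g x)) -> Lterm X t -> Lterm Y (tmap g t).
Proof.
move=> gX; elim: t => //= [t1 h1 t2 h2 []|t1 h1 t2 h2 []].
- by move=> /h1 ? /h2.
- by move=> /h1 ? /h2.
Qed.

Lemma fmap_id X g f : (forall x, X x -> g x = x) -> Lformula X f -> fmap g f = f.
Proof.
move=> gX; elim: f => //= [t1 t2 []|f1 h1 f2 h2 []|f1 h1 f2 h2 []|f1 h1 f2 h2 []|
  f1 h1|i f1 h1|i f1 h1].
- by move=> /(tmap_id gX) -> /(tmap_id gX) ->.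
- by move=> /h1 -> /h2 ->.
- by move=> /h1 -> /h2 ->.
- by move=> /h1 -> /h2 ->.
- by move=> /h1 ->.
- by move=> /h1 ->.
- by move=> /h1 ->.
Qed.

Lemma eq_fmap X g h f : (forall x, X x -> g x = h x) -> Lformula X f -> fmap g f = fmap h f.
Proof.
move=> gX; elim: f => //= [t1 t2 []|f1 h1 f2 h2 []|f1 h1 f2 h2 []|f1 h1 f2 h2 []|
  f1 h1|i f1 h1|i f1 h1].
- by move=> /(eq_tmap gX) -> /(eq_tmap gX) ->.
- by move=> /h1 -> /h2 ->.
- by move=> /h1 -> /h2 ->.
- by move=> /h1 -> /h2 ->.
- by move=> /h1 ->.
- by move=> /h1 ->.
- by move=> /h1 ->.
Qed.

(** The language has no inverse, so an element of the generated field is represented by a numerator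
    and a denominator. *)
Lemma gen_field_terms X z : gen_field X z -> exists u v,
  [/\ Lterm X u, Lterm X v, GRing.eval [::] v != 0 &
      z = GRing.eval [::] u / GRing.eval [::] v].
Proof.
pose K : {pred C} := fun z => `[< exists u v,
  [/\ Lterm X u, Lterm X v, GRing.eval [::] v != 0 &
      z = GRing.eval [::] u / GRing.eval [::] v] >].
have h : divring_closed K.
  split.
  - apply/asboolP; exists (GRing.NatConst _ 1), (GRing.NatConst _ 1).
    by split=> //=; rewrite ?oner_neq0 ?divr1.
  - move=> y1 y2 /asboolP[u1 [v1 [u1L v1L v10 ->]]] /asboolP[u2 [v2 [u2L v2L v20 ->]]].
    apply/asboolP; exists (GRing.Add (GRing.Mul u1 v2) (GRing.Opp (GRing.Mul u2 v1))),
      (GRing.Mul v1 v2); split=> //=; first by rewrite mulf_neq0.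
    by field; rewrite v10 v20.
  - move=> y1 y2 /asboolP[u1 [v1 [u1L v1L v10 ->]]] /asboolP[u2 [v2 [u2L v2L v20 ->]]].
    apply/asboolP; have [u20|u20] := eqVneq (GRing.eval [::] u2) 0.
      exists (GRing.NatConst _ 0), (GRing.NatConst _ 1).
      by split=> //=; rewrite ?oner_neq0 ?u20 ?(mul0r, invr0, mulr0).
    exists (GRing.Mul u1 v2), (GRing.Mul v1 u2); split=> //=; first by rewrite mulf_neq0.
    by field; rewrite u20 v10 v20.
move=> /(gen_field_min h) hz; apply/asboolP/hz => y Xy; apply/asboolP.
exists (GRing.Const y), (GRing.NatConst _ 1).
by split=> //=; rewrite ?oner_neq0 ?divr1.
Qed.

Lemma eval_gen_field X e t : Lterm X t -> [set` e] `<=` X -> gen_field X (GRing.eval e t).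
Proof.
move=> + eX; elim: t => //= [i _|c Xc|n _|t1 h1 t2 h2 [/h1 g1 /h2 g2]|t h /h g1|t h n /h g1|
    t1 h1 t2 h2 [/h1 g1 /h2 g2]|t h n /h g1].
- have [ie|ie] := ltnP i (size e); first by apply/sub_gen_field/eX; rewrite /= mem_nth.
  by rewrite nth_default //; exact/gfpP/rpred0.
- exact: sub_gen_field.
- exact/gfpP/rpred_nat.
- by apply/gfpP/rpredD; apply/gfpP.
- by apply/gfpP; rewrite rpredN; apply/gfpP.
- by apply/gfpP/rpredMn/gfpP.
- by apply/gfpP/rpredM; apply/gfpP.
- by apply/gfpP/rpredX/gfpP.
Qed.

Lemma term_poly X t : Lterm X t -> exists P : {poly C},
  (forall i, gen_field X P`_i) /\ forall y, GRing.eval [:: y] t = P.[y].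
Proof.
suff h : Lterm X t -> exists2 P : {poly C}, P \is a polyOver (gfp X) &
    forall y, GRing.eval [:: y] t = P.[y].
  by move=> /h[P /polyOverP PX PE]; exists P; split=> // i; exact/gfpP.
elim: t => //= [i _|c Xc|n _|t1 h1 t2 h2 [/h1[P1 P1X E1] /h2[P2 P2X E2]]|t h /h[P PX E]|
    t h n /h[P PX E]|t1 h1 t2 h2 [/h1[P1 P1X E1] /h2[P2 P2X E2]]|t h n /h[P PX E]].
- case: i => [|i]; [exists 'X|exists 0]; rewrite ?polyOverX ?rpred0 //= => y.
    by rewrite hornerX.
  by rewrite nth_default ?horner0.
- by exists c%:P; [rewrite polyOverC; apply/gfpP/sub_gen_field|move=> y; rewrite hornerC].
- by exists n%:R; [rewrite rpred_nat|move=> y; rewrite -polyC_natr hornerC].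
- by exists (P1 + P2); [rewrite rpredD|move=> y; rewrite hornerD E1 E2].
- by exists (- P); [rewrite rpredN|move=> y; rewrite hornerN E].
- by exists (P *+ n); [rewrite rpredMn|move=> y; rewrite hornerMn E].
- by exists (P1 * P2); [rewrite rpredM|move=> y; rewrite hornerM E1 E2].
- by exists (P ^+ n); [rewrite rpredX|move=> y; rewrite horner_exp E].
Qed.

Lemma poly_term X (P : {poly C}) : (forall i, gen_field X P`_i) ->
  exists t (d : C), [/\ Lterm X t, d != 0 & forall y, GRing.eval [:: y] t = d * P.[y]].
Proof.
(* The common denominator is also carried as a term d', because the next coefficient has to be
   multiplied by it. *)
move=> PX; suff [t [_ [d [tX _ d0 _ E]]]] : exists t d' (d : C), [/\ Lterm X t, Lterm X d', d != 0,
    forall e, GRing.eval e d' = d & forall y, GRing.eval [:: y] t = d * P.[y]].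
  by exists t, d.
elim/poly_ind: P PX => [|P c IH] PX.
  exists (GRing.NatConst _ 0), (GRing.NatConst _ 1), 1.
  by split=> //= *; rewrite ?oner_neq0 ?horner0 ?mulr0.
have [n|t [d' [d [tX dX d0 dE E]]]] := IH.
  by have := PX n.+1; rewrite coefD coefMX coefC /= addr0.
have := PX 0%N; rewrite coefD coefMX coefC /= add0r => /gen_field_terms.
move=> [u [v [uX vX v0 ->]]].
(* The variables of u and v were read as 0; [tinst [::]] closes these terms so that they do not see
   y. *)
exists (GRing.Add (GRing.Mul (tinst [::] v) (GRing.Mul t (GRing.Var _ 0)))
  (GRing.Mul d' (tinst [::] u))), (GRing.Mul d' (tinst [::] v)), (d * GRing.eval [::] v).
split=> /=; rewrite ?mulf_neq0 //.
- by do !split=> //; apply: Lterm_tinst.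
- by split=> //; apply: Lterm_tinst.
- by move=> e; rewrite eval_tinst dE.
- by move=> y; rewrite !eval_tinst E dE hornerD hornerM hornerX hornerC; field.
Qed.

(** This expresses algebraicity by equations of the language, the form in which saturation and
    [iso_holds] can be applied. *)
Lemma cl_term X x : algcl X x <-> exists t,
  [/\ Lterm X t, GRing.eval [:: x] t = 0 & exists y, GRing.eval [:: y] t <> 0].
Proof.
rewrite clP; split=> [[P [P0 PX /rootP Px]]|[t [/term_poly[P [PX E]] tx [y ty]]]].
  have [t [d [tX d0 E]]] := poly_term PX; exists t; split=> //.
    by rewrite E Px mulr0.
  have /closed_nonrootP[y /rootP Py] := P0.
  by exists y; rewrite E => /eqP; rewrite mulf_eq0 (negbTE d0) => /eqP.
exists P; split=> //; last by apply/rootP; rewrite -E.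
by apply/eqP => P0; apply: ty; rewrite E P0 horner0.
Qed.

End Terms.

Section Iso.
Variable C : closedFieldType.
Implicit Types (X Y W : set C) (t : GRing.term C) (g h : C -> C) (x : C).

(* A partial isomorphism: the ring generated by Y is mapped isomorphically onto
   the one generated by g Y.  Elementarity is only obtained in [iso_holds]. *)
Definition iso Y g := forall t, Lterm Y t ->
  (GRing.eval [::] t = 0 <-> GRing.eval [::] (tmap g t) = 0).

Lemma iso_eval Y g t e : iso Y g -> Lterm Y t -> [set` e] `<=` Y ->
  (GRing.eval e t = 0 <-> GRing.eval (map g e) (tmap g t) = 0).
Proof.
move=> gI tY eY; rewrite -(eval_tinst e [::]) -(eval_tmap_tinst g e [::]).
exact/gI/Lterm_tinst.
Qed.

Lemma iso_eqval Y g t1 t2 e : iso Y g -> Lterm Y t1 -> Lterm Y t2 -> [set` e] `<=` Y ->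
  (GRing.eval e t1 = GRing.eval e t2 <->
   GRing.eval (map g e) (tmap g t1) = GRing.eval (map g e) (tmap g t2)).
Proof.
move=> gI t1Y t2Y eY.
have := @iso_eval Y g (GRing.Add t1 (GRing.Opp t2)) e gI (conj t1Y t2Y) eY.
by move=> /= h; split=> /eqP; rewrite -subr_eq0 => /eqP /h /eqP; rewrite subr_eq0 => /eqP.
Qed.

Lemma iso_inj Y g x y : iso Y g -> Y x -> Y y -> g x = g y -> x = y.
Proof.
by move=> gI Yx Yy; case: (@iso_eqval Y g (GRing.Const x) (GRing.Const y) [::] gI).
Qed.

Lemma eq_iso Y g h : (forall x, Y x -> g x = h x) -> iso Y g -> iso Y h.
Proof. by move=> gh gI t tY; rewrite -(eq_tmap gh) //; exact: gI. Qed.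

Lemma iso_id Y g : (forall x, Y x -> g x = x) -> iso Y g.
Proof. by move=> gh t tY; rewrite (tmap_id gh). Qed.

Lemma isoS X Y g : X `<=` Y -> iso Y g -> iso X g.
Proof. by move=> XY gI t /(LtermS XY); exact: gI. Qed.

Lemma iso_comp Y g h : iso Y g -> iso (g @` Y) h -> iso Y (h \o g).
Proof.
move=> gI hI t tY; rewrite -tmap_comp (gI t tY); apply: hI.
by apply: Lterm_tmap tY => x Yx; exists x.
Qed.

Lemma iso_inverse Y g : iso Y g ->
  exists h, iso (g @` Y) h /\ forall x, Y x -> h (g x) = x.
Proof.
move=> gI; have /choice[h hP] : forall y, exists x, (g @` Y) y -> Y x /\ g x = y.
  move=> y; have [[x Yx <-]|nY] := pselect ((g @` Y) y); first by exists x.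
  by exists y.
exists h; split=> [t tY|x Yx]; last first.
  by have [] := hP (g x); [exists x|move=> ? ?; exact: iso_inj gI _ _ _].
rewrite -[t in X in X <-> _](@tmap_id _ (g @` Y) (g \o h)) //; last first.
  by move=> y /hP[].
rewrite -tmap_comp -gI //.
by apply: Lterm_tmap tY => y /hP[].
Qed.

Lemma iso_local Y g :
  (forall s : seq C, [set` s] `<=` Y -> exists2 K, [set` s] `<=` K & iso K g) -> iso Y g.
Proof.
move=> loc t /Lterm_finite[s /loc[K sK KI] ts]; apply: KI.
exact: LtermS sK ts.
Qed.

(** Equality of two fractions is, after cross multiplication, the vanishing of a term, so the
    correspondence passes to the field. The morphism serves to move coefficients of polynomials. *)
Lemma iso_rmorph Y g : iso Y g -> exists j : {rmorphism gsub Y -> C},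
  (forall t a, Lterm Y t -> emb a = GRing.eval [::] t ->
     j a = GRing.eval [::] (tmap g t)) /\
  forall a, gen_field (g @` Y) (j a).
Proof.
move=> gI.
have /choice[nd ndP] : forall a : gsub Y, exists nd : GRing.term C * GRing.term C,
    [/\ Lterm Y nd.1, Lterm Y nd.2, GRing.eval [::] nd.2 != 0 &
      emb a = GRing.eval [::] nd.1 / GRing.eval [::] nd.2].
  by move=> a; have [u [v []]] := gen_field_terms (emb_mem a); exists (u, v).
pose ev t := GRing.eval [::] t; pose ev' t := GRing.eval [::] (tmap g t).
pose f a := ev' (nd a).1 / ev' (nd a).2.
have nz t : Lterm Y t -> ev t != 0 -> ev' t != 0.
  by move=> tY; apply: contra_neq => /(gI _ tY).
have fE a u v : Lterm Y u -> Lterm Y v -> ev v != 0 -> emb a * ev v = ev u ->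
    f a = ev' u / ev' v.
  move=> uY vY v0 auv; have [nY dY d0 E] := ndP a.
  have := @gI (GRing.Add (GRing.Mul (nd a).1 v) (GRing.Opp (GRing.Mul u (nd a).2))).
  case=> [//|/= h _]; apply/eqP; rewrite /f eqr_div ?nz // -subr_eq0; apply/eqP.
  apply: h; rewrite -/(ev v) -/(ev u) -auv E -/(ev _) -/(ev _); field.
  exact: d0.
have eqf a u v : Lterm Y u -> Lterm Y v -> ev v != 0 -> emb a = ev u / ev v ->
    f a = ev' u / ev' v.
  by move=> uY vY v0 E; apply: fE => //; rewrite E divfK.
have fB : {morph f : a b / a - b}.
  move=> a b; have [n1 d1 d10 E1] := ndP a; have [n2 d2 d20 E2] := ndP b.
  rewrite (eqf _ (GRing.Add (GRing.Mul (nd a).1 (nd b).2)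
    (GRing.Opp (GRing.Mul (nd b).1 (nd a).2))) (GRing.Mul (nd a).2 (nd b).2)) //.
  - by rewrite /f /ev' /=; field; rewrite !nz.
  - by rewrite /ev /= mulf_neq0.
  - by rewrite rmorphB /= E1 E2 /ev /=; field; rewrite d10 d20.
have f1 : f 1 = 1.
  rewrite (eqf _ (GRing.NatConst _ 1) (GRing.NatConst _ 1)) //.
  - by rewrite /ev' /= divr1.
  - by rewrite /ev /= oner_neq0.
  - by rewrite rmorph1 /ev /= divr1.
have fM : {morph f : a b / a * b}.
  move=> a b; have [n1 d1 d10 E1] := ndP a; have [n2 d2 d20 E2] := ndP b.
  rewrite (eqf _ (GRing.Mul (nd a).1 (nd b).1) (GRing.Mul (nd a).2 (nd b).2)) //.
  - by rewrite /f /ev' /=; field; rewrite !nz.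
  - by rewrite /ev /= mulf_neq0.
  - by rewrite rmorphM /= E1 E2 /ev /=; field; rewrite d10 d20.
pose j : {rmorphism gsub Y -> C} := HB.pack f
  (GRing.isZmodMorphism.Build _ _ f fB) (GRing.isMonoidMorphism.Build _ _ f (f1, fM)).
exists j; split=> [t a tY E|a]; last first.
  have [n1 d1 _ _] := ndP a; apply/gfpP.
  have gY t : Lterm Y t -> ev' t \in gfp (g @` Y).
    move=> tY; apply/gfpP/eval_gen_field => [|z //].
    by apply: Lterm_tmap tY => x Yx; exists x.
  by apply: rpred_div; exact: gY.
rewrite [j a](eqf a t (GRing.NatConst _ 1)) //.
- by rewrite /ev' /= divr1.
- by rewrite /ev /= oner_neq0.
- by rewrite /ev /= divr1.
Qed.

(** Take for x' a root of the image under j of the minimal polynomial m of x. A polynomial P not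
    divisible by m is coprime to it, and a Bezout relation then keeps P from vanishing at x'. *)
Lemma algebraic_extension (K : fieldType) (i j : {rmorphism K -> C}) x :
  algebraicOver i x -> exists x', forall P : {poly K},
    (map_poly i P).[x] = 0 <-> (map_poly j P).[x'] = 0.
Proof.
move=> [P0 P00 P0x].
pose Q n := `[< exists P : {poly K}, [/\ P != 0, (map_poly i P).[x] = 0 & size P = n] >].
have [|n /asboolP[m [m0 mx mn]] nmin] := @ex_minnP Q.
  by exists (size P0); apply/asboolP; exists P0; split=> //; exact/rootP.
have mmin P : (map_poly i P).[x] = 0 -> m %| P.
  move=> Px; apply/eqP; apply: contrapT => /eqP r0.
  have : Q (size (P %% m)).
    apply/asboolP; exists (P %% m); split=> //.
    have := congr1 (fun R => (map_poly i R).[x]) (divp_eq P m).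
    by rewrite rmorphD rmorphM !hornerE Px mx mulr0 add0r.
  by move/nmin; rewrite -mn leqNgt ltn_modp m0.
have [x' /rootP jx'] : exists x', root (map_poly j m) x'.
  apply/closed_rootP; rewrite size_map_poly; apply/eqP => sz1.
  have [c c0 mE] : exists2 c, c != 0 & m = c%:P by apply/size_poly1P; rewrite sz1.
  by move/eqP: mx; rewrite mE map_polyC hornerC fmorph_eq0 (negbTE c0).
exists x' => P; split=> [/mmin/dvdpP[q ->]|Px'].
  by rewrite rmorphM hornerM jx' mulr0.
apply: contrapT => Px; have nmP : ~~ (m %| P).
  by apply/negP => /dvdpP[q PE]; apply: Px; rewrite PE rmorphM hornerM mx mulr0.
have gm : gcdp m P %| m := dvdp_gcdl m P.
have cop : coprimep m P.
  rewrite /coprimep; apply: contraNT nmP => g1.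
  have gx : (map_poly i (gcdp m P)).[x] = 0.
    apply: contrapT => gx.
    have [q qE] := dvdpP _ _ gm.
    have qx : (map_poly i q).[x] = 0.
      move: mx; rewrite {1}qE rmorphM hornerM => /eqP; rewrite mulf_eq0.
      by case/orP => /eqP.
    have q0 : q != 0 by apply: contraNneq m0 => q0; rewrite qE q0 mul0r.
    have g0 : gcdp m P != 0 by rewrite gcdp_eq0 (negbTE m0).
    have : Q (size q) by apply/asboolP; exists q.
    move=> /nmin; rewrite -mn {1}qE size_mul // leqNgt; apply/negP; rewrite negbK.
    move: g1 g0; rewrite -size_poly_eq0; case: (size (gcdp m P)) => [|[|k]] //.
    by rewrite !addnS /= => _ _; rewrite ltnS leq_addr.
  by apply: dvdp_trans (mmin _ gx) (dvdp_gcdr m P).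
have [[u v] /= /eqpP[[c1 c2] /= /andP[c10 c20]]] := Bezout_coprimepP _ _ cop.
move=> /(congr1 (fun R => (map_poly j R).[x'])).
rewrite !map_polyZ /= rmorphD !rmorphM /= rmorph1 !hornerE jx' Px' !mulr0 addr0 mulr0.
by move/esym/eqP; rewrite ?mulr1 fmorph_eq0 (negbTE c20).
Qed.

Definition upd g x x' y := if y == x then x' else g y.

Lemma iso_upd Y g (j : {rmorphism gsub Y -> C}) x x' :
  (forall t a, Lterm Y t -> emb a = GRing.eval [::] t ->
     j a = GRing.eval [::] (tmap g t)) ->
  (forall P : {poly gsub Y}, (map_poly (@emb C Y) P).[x] = 0 <-> (map_poly j P).[x'] = 0) ->
  iso (Y `|` [set x]) (upd g x x').
Proof.
move=> jP jx t tY.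
suff [P [E1 E2]] : exists P : {poly gsub Y},
    GRing.eval [::] t = (map_poly (@emb C Y) P).[x] /\
    GRing.eval [::] (tmap (upd g x x') t) = (map_poly j P).[x'].
  by rewrite E1 E2.
elim: t tY => //= [i _|c Yc|n _|t1 h1 t2 h2 [/h1[P1 [-> ->]] /h2[P2 [-> ->]]]|
    t h /h[P [-> ->]]|t h n /h[P [-> ->]]|
    t1 h1 t2 h2 [/h1[P1 [-> ->]] /h2[P2 [-> ->]]]|t h n /h[P [-> ->]]].
- by exists 0; rewrite !rmorph0 !horner0 nth_nil.
- have [->|cx] := eqVneq c x.
    by exists 'X; rewrite /upd eqxx !map_polyX !hornerX.
  have {}Yc : Y c by case: Yc => // e; rewrite e eqxx in cx.
  have [a cE] := emb_surj (sub_gen_field Yc).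
  exists a%:P; rewrite !map_polyC !hornerC /= /upd (negbTE cx); split=> //.
  by rewrite [RHS](jP (GRing.Const c)).
- by exists n%:R; rewrite !rmorph_nat -!polyC_natr !hornerC.
- by exists (P1 + P2); rewrite !rmorphD !hornerD.
- by exists (- P); rewrite !rmorphN !hornerN.
- by exists (P *+ n); rewrite !rmorphMn !hornerMn.
- by exists (P1 * P2); rewrite !rmorphM !hornerM.
- by exists (P ^+ n); rewrite !rmorphXn !horner_exp.
Qed.

Lemma iso_transcendental Y g x x' : iso Y g -> ~ algcl Y x -> ~ algcl (g @` Y) x' ->
  iso (Y `|` [set x]) (upd g x x').
Proof.
move=> gI nclx nclx'; have [j [jP jgen]] := iso_rmorph gI.
apply: iso_upd jP _ => P; split=> P0.
  suff -> : P = 0 by rewrite rmorph0 horner0.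
  by apply: contrapT => /eqP Pn0; apply: nclx; exists P => //; exact/rootP.
suff -> : P = 0 by rewrite rmorph0 horner0.
apply: contrapT => /eqP Pn0; apply: nclx'; apply/clP.
exists (map_poly j P); split; [by rewrite map_poly_eq0| |exact/rootP].
by move=> i; rewrite coef_map; exact: jgen.
Qed.

End Iso.

(** * Extension of partial isomorphisms by saturation *)

Section Saturated.
Variables (kappa : Type) (C : closedFieldType).
Hypothesis hsat : sufficiently_saturated kappa C.
Implicit Types (X Y W : set C) (t : GRing.term C) (g h : C -> C) (x : C).

Let kappa_unc : ~ countable [set: kappa] := proj1 hsat.
Let sU := @smallU kappa C kappa_unc.
Let small0 : small kappa (@set0 C) := small_finite kappa_unc (finite_set0 C).
Let small1 x : small kappa [set x] := small_finite kappa_unc (finite_set1 x).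

(** The type that denies every nontrivial equation over W is finitely satisfiable, since a product
    of finitely many nonzero polynomials has a non-root. *)
Lemma exists_transcendental W : small kappa W -> exists x, ~ algcl W x.
Proof.
move=> sW; pose nz t := GRing.Not (GRing.Equal t (GRing.NatConst _ 0)).
pose Sigma f := exists t, [/\ f = nz t, Lterm W t & exists y, GRing.eval [:: y] t <> 0].
have [||x hx] := (proj2 hsat) W sW Sigma.
- by move=> _ [t [-> tW _]].
- move=> S0 S0fin S0S.
  have /choice[Pf PfP] : forall f, exists P : {poly C}, P != 0 /\
      (S0 f -> forall x, P.[x] != 0 -> GRing.holds [:: x] f).
    move=> f; have [/S0S[t [-> tW [y ty]]]|nS] := pselect (S0 f); last first.
      by exists 1; rewrite oner_neq0.
    have [P [_ PE]] := term_poly tW; exists P; split.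
      by apply: contra_notN ty => /eqP P0; rewrite PE P0 horner0.
    by move=> _ x Px /=; rewrite PE; exact/eqP.
  have /finite_seqP[s sE] := finite_image Pf S0fin.
  have /closed_nonrootP[x xs] : \prod_(P <- s) P != 0.
    rewrite prodf_seq_neq0; apply/allP => P Ps.
    have : [set` s] P by [].
    by rewrite -sE => -[f _ <-]; have [] := PfP f.
  exists x => f S0f; apply: (proj2 (PfP f)) => //.
  have fs : Pf f \in s by have : [set` s] (Pf f) by rewrite -sE; exists f.
  by apply: contraNneq xs => fx; rewrite (big_rem _ fs) rootM /=; apply/orP; left; exact/rootP.
- exists x => /cl_term[t [tW tx ty]].
  by have /= := hx (nz t); apply=> //; exists t.
Qed.

Lemma iso_ext1 Y W g x : small kappa Y -> small kappa W -> iso Y g ->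
  exists x', [/\ iso (Y `|` [set x]) (upd g x x'), Y x -> x' = g x &
    ~ algcl Y x -> ~ algcl (g @` Y `|` W) x'].
Proof.
move=> sY sW gI; have [Yx|nYx] := pselect (Y x).
  exists (g x); split=> // [|/(_ (sub_cl Yx))//].
  apply: (@eq_iso _ _ g); first by move=> y _; rewrite /upd; case: eqP => // ->.
  by apply: isoS gI => y [//|->].
have [clx|nclx] := pselect (algcl Y x).
  have [j [jP jgen]] := iso_rmorph gI.
  have [x' x'P] := algebraic_extension j clx; exists x'; split=> //.
  exact: iso_upd jP x'P.
have [|x' x'algcl] := @exists_transcendental (g @` Y `|` W).
  by apply: sU => //; exact: small_image.
exists x'; split=> //; apply: iso_transcendental => //.
by apply: contra_not x'algcl; apply: cl_subset => z; left.
Qed.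

Lemma iso_add Y W g x : small kappa Y -> small kappa W -> iso Y g ->
  exists h, [/\ iso (Y `|` [set x]) h, forall y, Y y -> h y = g y &
    ~ algcl Y x -> ~ algcl (g @` Y `|` W) (h x)].
Proof.
move=> sY sW gI; have [x' [x'I x'Y x'algcl]] := iso_ext1 x sY sW gI.
exists (upd g x x'); split=> // [y Yy|]; last by rewrite /upd eqxx.
by rewrite /upd; case: eqP => // yx; rewrite x'Y -?yx.
Qed.

(** The inverse map is extended forwards and then inverted again. *)
Lemma iso_add_back Y g x' : small kappa Y -> iso Y g ->
  exists x h, [/\ iso (Y `|` [set x]) h, forall y, Y y -> h y = g y & h x = x'].
Proof.
move=> sY gI; have [k [kI kg]] := iso_inverse gI.
have [h [hI hk _]] := iso_add x' (small_image sY) small0 kI.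
have [l [lI lh]] := iso_inverse hI.
have hg y : Y y -> h (g y) = y by move=> Yy; rewrite hk ?kg //; exists y.
exists (h x'), l; split; last by rewrite lh //; right.
  apply: isoS lI => y [Yy|->]; last by exists x' => //; right.
  by exists (g y); [left; exists y|exact: hg].
by move=> y Yy; rewrite -{1}(hg _ Yy) lh //; left; exists y.
Qed.

Lemma map_set_nth g (e : seq C) i x : g 0 = 0 ->
  GRing.same_env (map g (set_nth 0 e i x)) (set_nth 0 (map g e) i (g x)).
Proof.
move=> g0 j; rewrite nth_set_nth /=.
have E (s : seq C) k : (map g s)`_k = g s`_k.
  by have [ks|ks] := ltnP k (size s); [rewrite (nth_map 0)|rewrite !nth_default ?size_map].
by rewrite !E nth_set_nth /=; case: eqP.
Qed.

Lemma eq_holdsE (e e' : seq C) f : GRing.same_env e e' -> GRing.holds e f <-> GRing.holds e' f.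
Proof. by move=> ee'; split; apply: GRing.eq_holds => // i; rewrite ee'. Qed.

(* Quantifier elimination by back-and-forth: saturation makes every partial
   isomorphism between small sets extendible to one more point on either side. *)
Lemma iso_holds f Y g e : small kappa Y -> iso Y g -> Lformula Y f -> [set` e] `<=` Y ->
  (GRing.holds e f <-> GRing.holds (map g e) (fmap g f)).
Proof.
move: f Y g e; have main f : forall Y g e, small kappa Y -> iso Y g -> Lformula Y f ->
    [set` e] `<=` Y -> Y 0 -> (GRing.holds e f <-> GRing.holds (map g e) (fmap g f)).
  have iso0 Y g : iso Y g -> Y 0 -> g 0 = 0.
    by move=> gI Y0; case: (gI (GRing.Const 0) Y0) => /= + _; apply.
  have setY Y (e : seq C) i x : [set` e] `<=` Y -> Y 0 ->
      [set` set_nth 0 e i x] `<=` Y `|` [set x].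
    move=> eY Y0 z /(nthP 0)[j _ <-]; rewrite nth_set_nth /=; case: eqP => _; first by right.
    by left; have [je|je] := ltnP j (size e); [apply: eY; exact: mem_nth|rewrite nth_default].
  pose IH f1 := forall Y g e, small kappa Y -> iso Y g -> Lformula Y f1 ->
    [set` e] `<=` Y -> Y 0 -> (GRing.holds e f1 <-> GRing.holds (map g e) (fmap g f1)).
  have key f1 Y g (e : seq C) i x h : IH f1 -> small kappa Y -> iso Y g -> Lformula Y f1 ->
      [set` e] `<=` Y -> Y 0 ->
      iso (Y `|` [set x]) h -> (forall y, Y y -> h y = g y) ->
      (GRing.holds (set_nth 0 e i x) f1 <->
       GRing.holds (set_nth 0 (map g e) i (h x)) (fmap g f1)).
    move=> h1 sY gI fY eY Y0 hI hg; rewrite (h1 (Y `|` [set x]) h) //; first last.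
    - by left.
    - exact: setY.
    - by apply: LformulaS fY => ?; left.
    - exact: sU.
    have E : map h e = map g e by apply/eq_in_map => z /eY /hg.
    rewrite (eq_fmap hg fY) -E.
    by apply: eq_holdsE; apply: map_set_nth; rewrite hg // (iso0 _ _ gI).
  move: f; elim => [b|t1 t2|t1|f1 h1 f2 h2|f1 h1 f2 h2|f1 h1 f2 h2|f1 h1|i f1 h1|i f1 h1]
      Y g e sY gI /=.
  - by [].
  - by move=> [t1Y t2Y] eY _; exact: iso_eqval gI t1Y t2Y eY.
  - by [].
  - by move=> [/(h1 _ _ e sY gI) i1 /(h2 _ _ e sY gI) i2] eY Y0; rewrite i1 // i2.
  - by move=> [/(h1 _ _ e sY gI) i1 /(h2 _ _ e sY gI) i2] eY Y0; rewrite i1 // i2.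
  - by move=> [/(h1 _ _ e sY gI) i1 /(h2 _ _ e sY gI) i2] eY Y0; rewrite i1 // i2.
  - by move=> /(h1 _ _ e sY gI) i1 eY Y0; rewrite i1.
  - move=> fY eY Y0; split=> [[x hx]|[x' hx']].
      by have [h [hI hg _]] := iso_add x sY small0 gI; exists (h x); rewrite -(key _ Y g e i x).
    have [x [h [hI hg hx]]] := iso_add_back x' sY gI.
    by exists x; rewrite (key _ Y g e i x h) // hx.
  - move=> fY eY Y0; split=> [hx x'|hx' x].
      have [x [h [hI hg <-]]] := iso_add_back x' sY gI.
      by rewrite -(key _ Y g e i x).
    by have [h [hI hg _]] := iso_add x sY small0 gI; rewrite (key _ Y g e i x h).
move=> f Y g e sY gI fY eY.
(* The point 0 is put into the domain because the quantifier steps of [main] pad environments with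
   it. *)
have [h [hI hg _]] := iso_add 0 sY small0 gI.
rewrite (main f (Y `|` [set 0]) h) //; [|exact: sU|by apply: LformulaS fY => ?; left|
  by move=> z /eY; left|by right].
rewrite (eq_fmap hg fY) (_ : map h e = map g e) //.
by apply/eq_in_map => z /eY /hg.
Qed.

Lemma iso_cl Y X g x : small kappa Y -> iso Y g -> X `<=` Y -> Y x ->
  (algcl X x <-> algcl (g @` X) (g x)).
Proof.
have impl Y' X' g' x' : small kappa Y' -> iso Y' g' -> X' `<=` Y' -> Y' x' ->
    algcl X' x' -> algcl (g' @` X') (g' x').
  move=> sY gI XY Yx /cl_term[t [tX tx ty]].
  have tY := LtermS XY tX; apply/cl_term; exists (tmap g' t); split.
  - by apply: Lterm_tmap tX => z Xz; exists z.
  - by apply: (proj1 (iso_eval gI tY _) tx) => z; rewrite /= inE => /eqP ->.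
  (* A point where t does not vanish may lie outside Y', so its existence is transferred as a
     formula. *)
  - pose f : GRing.formula C := GRing.Exists 0 (GRing.Not (GRing.Equal t (GRing.NatConst _ 0))).
    have fY : Lformula Y' f by split.
    have e0 : [set` [::]] `<=` Y' by move=> z; rewrite /= in_nil.
    by have [h _] := iso_holds sY gI fY e0; exact: (h ty).
move=> sY gI XY Yx; split; first exact: (impl Y X g x).
have [h [hI hg]] := iso_inverse gI.
move=> /(impl (g @` Y) (g @` X) h (g x) (small_image sY) hI).
rewrite hg // image_comp; have -> : (h \o g) @` X = X.
  apply/seteqP; split=> [_ [z Xz <-]|z Xz]; first by rewrite /= hg //; exact: XY.
  by exists z => //; rewrite /= hg //; exact: XY.
apply; last by exists x.
by move=> _ [z Xz <-]; exists z => //; exact: XY.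
Qed.

Lemma iso_rk Y X g s : small kappa Y -> iso Y g -> X `<=` Y -> [set` s] `<=` Y ->
  rk (g @` X) (map g s) = rk X s.
Proof.
move=> sY gI; elim: s X => //= a s IH X XY sY'.
have Ya : Y a by apply: sY'; rewrite /= mem_head.
rewrite (_ : g @` X `|` [set g a] = g @` (X `|` [set a])); last first.
  by rewrite image_setU image_set1.
rewrite IH; last by move=> z /= zs; apply: sY'; rewrite /= inE zs orbT.
  congr (_ + _)%N; case: asboolP => h; case: asboolP => h' //.
    by case: h'; apply/(iso_cl sY gI XY Ya).
  by case: h; apply/(iso_cl sY gI XY Ya).
by move=> z [/XY|->].
Qed.

(* The equality of ranks says that the image of X is independent from W over the
   image of Y. *)
Lemma iso_ext Y X W g : small kappa Y -> small kappa X -> small kappa W -> iso Y g ->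
  exists h, [/\ iso (Y `|` X) h, forall y, Y y -> h y = g y &
    forall s : seq C, [set` s] `<=` Y `|` X -> rk (g @` Y `|` W) (map h s) = rk Y s].
Proof.
move=> sY sX sW gI.
pose P K h := [/\ K `<=` Y `|` X, iso K h &
  forall s : seq C, [set` s] `<=` K -> rk (g @` Y `|` W) (map h s) = rk Y s].
have [|||K [h [[KYX hI hrk] YK hg Kmax]]] := @maximal_partial_map C P _ _ Y g.
- move=> K g1 h gh [KYX KI Krk]; split=> //; first exact: eq_iso gh KI.
  move=> s sK; rewrite -Krk //; congr (rk _ _); apply/eq_in_map => z zs.
  by rewrite gh //; exact: sK.
- move=> K h loc; split.
  + move=> z Kz; have [|K' [zK' K'K [K'YX _ _]]] := loc [:: z].
      by move=> y; rewrite /= inE => /eqP ->.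
    by apply: K'YX; apply: zK'; rewrite /= mem_head.
  + apply: iso_local => s sK; have [K' [sK' _ [_ K'I _]]] := loc s sK.
    by exists K'.
  + by move=> s sK; have [K' [sK' _ [_ _ K'rk]]] := loc s sK; exact: K'rk.
- split=> // s sY'.
  rewrite [RHS]rk_eq0 ?rk_eq0 //; last first.
    by move=> z zs; apply: sub_cl; exact: sY'.
  by move=> _ /mapP[z zs ->]; apply: sub_cl; left; exists z => //; exact: sY'.
have sK : small kappa K by apply: smallS KYX _; exact: sU.
have gY : g @` Y = h @` Y.
  by apply/seteqP; split=> _ [z Yz <-]; exists z => //; rewrite hg.
have -> : Y `|` X = K; last by exists h.
apply/seteqP; split=> // x YXx; apply: contrapT => nKx; apply: (nKx).
have [h' [h'I h'h h'algcl]] := iso_add x sK sW hI.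
apply: (Kmax (K `|` [set x]) h'); [|by left|exact: h'h|by right].
have sK' : small kappa (K `|` [set x]) by exact: sU.
split=> // [z [/KYX//|->//]|s sKx].
have maph s1 : [set` s1] `<=` K -> map h' s1 = map h s1.
  by move=> s1K; apply/eq_in_map => z /s1K /h'h.
have h'Y : h' @` Y = g @` Y.
  rewrite gY; apply/seteqP; split=> _ [z Yz <-]; exists z => //; rewrite h'h //; exact: YK.
have [xs|xs] := boolP (x \in s); last first.
  have s1K : [set` s] `<=` K.
    by move=> z zs; case: (sKx z zs) => // zx; rewrite -zx zs in xs.
  by rewrite maph // hrk.
pose s1 := [seq z <- s | z != x].
have s1K : [set` s1] `<=` K.
  by move=> z /=; rewrite mem_filter => /andP[zx /sKx[//|/eqP]]; rewrite (negbTE zx).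
have sE : s =i s1 ++ [:: x].
  move=> z; rewrite mem_cat mem_filter inE; case: eqP => [->|_]; first by rewrite xs.
  by rewrite orbF.
have sE' : map h' s =i map h' s1 ++ [:: h' x].
  by rewrite -[[:: h' x]]/(map h' [:: x]) -map_cat; exact: eq_mem_map.
rewrite (rk_mem Y sE) (rk_mem _ sE').
have [/cl_finite[s0 s0K xs0]|ncl] := pselect (algcl K x); last first.
  rewrite !rk_cat maph // hrk //= !asboolF //.
    by apply: contra_not ncl; apply: cl_subset => z [/YK//|/s1K].
  apply: contra_not (h'algcl ncl); apply: cl_subset => z [[[y Yy <-]|Wz]|].
  - by left; exists y; [exact: YK|rewrite hg].
  - by right.
  - by move=> /mapP[y ys ->]; left; exists y => //; exact: s1K.
(* The list t lies in K, where the ranks already agree. As u is algebraic over t on both sides, the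
   rank of t is that of u plus that of t over u. Neither summand grows when passing to the images
   over Z, so equality of the sums gives equality of each. *)
pose u := s1 ++ [:: x]; pose t := s1 ++ s0.
have tK : [set` t] `<=` K by move=> z /=; rewrite mem_cat => /orP[/s1K|/s0K].
have uK : [set` u] `<=` K `|` [set x].
  by move=> z /=; rewrite mem_cat inE => /orP[/s1K ?|/eqP ->]; [left|right].
have xs0' : algcl (h' @` [set` s0]) (h' x).
  have s0K' : [set` s0] `<=` K `|` [set x] by move=> z /s0K; left.
  by apply/(iso_cl sK' h'I s0K') => //; right.
set Z := g @` Y `|` W.
have YK' : Y `<=` K `|` [set x] by move=> z /YK; left.
have e1 : (rk Y u + rk (Y `|` [set` u]) t = rk Y t)%N.
  rewrite rk_catC (rk_eq0 (X := Y `|` _) (s := u)) ?addn0 // => z /=.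
  rewrite mem_cat inE => /orP[zs1|/eqP ->].
    by apply: sub_cl; right; rewrite /= mem_cat zs1.
  by apply: cl_subset xs0 => y ys0; right; rewrite /= mem_cat ys0 orbT.
have e2 : (rk Z (map h' u) + rk (Z `|` [set` map h' u]) (map h' t) = rk Z (map h' t))%N.
  rewrite rk_catC (rk_eq0 (X := Z `|` _) (s := map h' u)) ?addn0 // => _ /mapP[z + ->].
  rewrite mem_cat inE => /orP[zs1|/eqP ->].
    by apply: sub_cl; right; rewrite /= map_f // mem_cat zs1.
  apply: cl_subset xs0' => _ [y ys0 <-]; right; rewrite /= map_f //.
  by rewrite mem_cat; apply/orP; right.
have e3 : rk Z (map h' t) = rk Y t by rewrite maph // hrk.
have e4 : (rk Z (map h' u) <= rk Y u)%N.
  rewrite -(iso_rk sK' h'I YK' uK) h'Y; apply: rk_anti => z Yz; apply: sub_cl; by left.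
have e5 : (rk (Z `|` [set` map h' u]) (map h' t) <= rk (Y `|` [set` u]) t)%N.
  have tK' : [set` t] `<=` K `|` [set x] by move=> z /tK; left.
  have YuK : Y `|` [set` u] `<=` K `|` [set x] by move=> z [/YK'//|/uK].
  rewrite -(iso_rk sK' h'I YuK tK').
  apply: rk_anti => _ [z [Yz|zu] <-]; apply: sub_cl.
    by left; left; rewrite -h'Y; exists z.
  by right; rewrite /= map_f.
have -> : map h' s1 ++ [:: h' x] = map h' u by rewrite /u map_cat.
rewrite -/u; move: e1 e2 e3 e4 e5; lia.
Qed.

End Saturated.

(** * Morley rank *)

Section Definable.
Variable C : closedFieldType.
Implicit Types (X Y : set C) (n : nat).

Lemma definableS X Y n (S : set (n.-tuple C)) : X `<=` Y -> definable X S -> definable Y S.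
Proof. by move=> XY [f fX fS]; exists f => //; exact: LformulaS XY fX. Qed.

Lemma definableI X n (S T : set (n.-tuple C)) :
  definable X S -> definable X T -> definable X (S `&` T).
Proof.
move=> [f fX fS] [g gX gT]; exists (GRing.And f g) => //= v.
by split=> [[/fS ? /gT]|[/fS ? /gT]].
Qed.

Lemma definableD X n (S T : set (n.-tuple C)) :
  definable X S -> definable X T -> definable X (S `\` T).
Proof.
move=> [f fX fS] [g gX gT]; exists (GRing.And f (GRing.Not g)) => //= v.
by split=> [[/fS ? h]|[/fS ? h]]; split=> // /gT.
Qed.

Lemma definable_term X n (t : GRing.term C) : Lterm X t ->
  definable X [set v : n.-tuple C | GRing.eval v t = 0].
Proof.
by move=> tX; exists (GRing.Equal t (GRing.NatConst _ 0)).
Qed.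

Lemma Lterm_tsubst X t s : Lterm X t -> Lterm X s.2 -> Lterm X (@GRing.tsubst C t s).
Proof.
move=> + sX; elim: t => //= [i _|t1 h1 t2 h2 []|t1 h1 t2 h2 []].
- by case: ifP.
- by move=> /h1 ? /h2.
- by move=> /h1 ? /h2.
Qed.

Lemma Lformula_fsubst X f s : Lformula X f -> Lterm X s.2 -> Lformula X (@GRing.fsubst C f s).
Proof.
move=> + sX; elim: f => //= [t1 t2 []|f1 h1 f2 h2 []|f1 h1 f2 h2 []|f1 h1 f2 h2 []|i f1 h1|i f1 h1].
- by move=> /Lterm_tsubst h1 /Lterm_tsubst h2; split; [exact: h1|exact: h2].
- by move=> /h1 ? /h2.
- by move=> /h1 ? /h2.
- by move=> /h1 ? /h2.
- by case: ifP.
- by case: ifP.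
Qed.

(** Parameters are substituted from the last one backwards, so that the remaining variables keep
    their positions. *)
Lemma definable_section X n (b : seq C) f : Lformula X f ->
  definable (X `|` [set` b]) [set x : n.-tuple C | GRing.holds (x ++ b) f].
Proof.
elim/last_ind: b X f => [|b c IH] X f fX.
  by exists f; [apply: LformulaS fX => ?; left|move=> v /=; rewrite cats0].
pose Y := X `|` [set` rcons b c].
have cY : Y c by right; rewrite /= mem_rcons mem_head.
have fY : Lformula Y (GRing.fsubst f (n + size b, GRing.Const c)%N).
  by apply: Lformula_fsubst => //; apply: LformulaS fX => ?; left.
have [g gX gP] := IH _ _ fY; exists g.
  apply: LformulaS gX => z [//|zb]; right.
  by rewrite /= mem_rcons inE; apply/orP; right.
move=> v; rewrite -gP /= GRing.holds_fsubst; apply: eq_holdsE => i.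
rewrite nth_set_nth /= -rcons_cat nth_rcons size_cat size_tuple.
case: ltngtP => // h; rewrite nth_default // size_cat size_tuple; exact: ltnW.
Qed.

End Definable.

Section MorleyRank.
Variables (kappa : Type) (C : closedFieldType).
Hypothesis hsat : sufficiently_saturated kappa C.
Implicit Types (X Y : set C) (n k : nat).

Let kappa_unc : ~ countable [set: kappa] := proj1 hsat.
Let sU := @smallU kappa C kappa_unc.
Let small0 : small kappa (@set0 C) := small_finite kappa_unc (finite_set0 C).
Let small1 (x : C) : small kappa [set x] := small_finite kappa_unc (finite_set1 x).
Let smalls (s : seq C) : small kappa [set` s] := small_finite kappa_unc (finite_seq s).

Lemma cl_expr X x i : algcl X (x ^+ i.+1) -> algcl X x.
Proof.
move=> clxi; apply: (@clS _ (X `|` [set x ^+ i.+1])).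
  by move=> z [|->//]; exact: sub_cl.
apply/clP; exists ('X^(i.+1) - (x ^+ i.+1)%:P); split.
- by rewrite monic_neq0 // monicXnsubC.
- have h : 'X^(i.+1) - (x ^+ i.+1)%:P \is a polyOver (gfp (X `|` [set x ^+ i.+1])).
    rewrite rpredB ?rpredX ?polyOverX // polyOverC.
    by apply/gfpP/sub_gen_field; right.
  by move=> j; apply/gfpP/(polyOverP h).
- by apply/rootP; rewrite hornerD hornerN hornerXn hornerC subrr.
Qed.

Lemma expr_inj_transcendental X x i j : ~ algcl X x -> x ^+ i.+1 = x ^+ j.+1 -> i = j.
Proof.
move=> nclx; wlog ij : i j / (i < j)%N => [W e|].
  by have [/W ->//|/W <-//|//] := ltngtP i j.
move=> e; case: nclx; apply/clP; exists ('X^(j.+1) - 'X^(i.+1)); split.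
- apply: contraTneq isT => /(congr1 (fun P : {poly C} => P`_j.+1)).
  rewrite coefB !coefXn eqxx coef0 eqSS gtn_eqF // subr0 => /eqP.
  by rewrite oner_eq0.
- have h : 'X^(j.+1) - 'X^(i.+1) \is a polyOver (gfp X) by rewrite rpredB ?rpredX ?polyOverX.
  by move=> l; apply/gfpP/(polyOverP h).
- by apply/rootP; rewrite hornerD hornerN !hornerXn e subrr.
Qed.

(* Only this half of the equality of Morley rank and transcendence degree is
   needed.  The disjoint subsets of rank k are the fibres of a transcendental
   coordinate over its powers, which are pairwise conjugate over X. *)
Lemma MRge_rk k n X (S : set (n.-tuple C)) (a : n.-tuple C) :
  small kappa X -> definable X S -> S a -> (k <= rk X a)%N -> MRge k S.
Proof.
elim: k X S a => [|k IH] X S a sX SX Sa ka; first by exists a.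
have [j nclj] : exists j, ~ algcl X (tnth a j).
  apply: contrapT => h; move: ka; rewrite rk_eq0 // => _ /tnthP[j ->].
  by apply: contrapT => nj; apply: h; exists j.
pose c i := tnth a j ^+ i.+1.
have nclc i : ~ algcl X (c i) by apply: contra_not nclj; exact: cl_expr.
exists (fun i => S `&` [set v | GRing.eval v
  (GRing.Add (GRing.Var C j) (GRing.Opp (GRing.Const (c i)))) = 0]).
have Fdef i : definable (X `|` [set c i]) (S `&` [set v | GRing.eval v
  (GRing.Add (GRing.Var C j) (GRing.Opp (GRing.Const (c i)))) = 0]).
  apply: definableI; first by apply: definableS SX => ?; left.
  by apply: definable_term; split=> //=; right.
split=> [i|i v []//|i l _ _ [v [[_ vi] [_ vl]]]|i].
- exact: definableS (Fdef i).
- apply: (expr_inj_transcendental nclj); rewrite -/(c i) -/(c l).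
  have vE r : GRing.eval v (GRing.Add (GRing.Var C j) (GRing.Opp (GRing.Const (c r)))) = 0
      -> c r = v`_j by move=> /= /eqP; rewrite subr_eq0 => /eqP.
  by rewrite (vE i vi) (vE l vl).
(* The coordinate and its power are both transcendental over X, hence conjugate over X. *)
have gI : iso (X `|` [set tnth a j]) (upd id (tnth a j) (c i)).
  by apply: iso_transcendental => //; [exact: iso_id|rewrite image_id].
have idX y : X y -> upd id (tnth a j) (c i) y = y.
  by move=> Xy; rewrite /upd; case: eqP => // yj; case: nclj; rewrite -yj; exact: sub_cl.
have [h [hI hg _]] := iso_ext hsat (sU sX (@small1 (tnth a j))) (@smalls a) small0 gI.
have hX y : X y -> h y = y by move=> Xy; rewrite hg ?idX //; left.
have hj : h (tnth a j) = c i by rewrite hg /upd ?eqxx //; right.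
set Y := X `|` [set tnth a j] in hI hg.
have sY : small kappa (Y `|` [set` a]) by apply: sU (@smalls a); exact: sU.
have aY : [set` a] `<=` Y `|` [set` a] by move=> z; right.
apply: (IH _ _ (map_tuple h a) (sU sX (@small1 (c i))) (Fdef i)).
  split; last by rewrite /= -tnth_nth tnth_map hj subrr.
  have [f fX fS] := SX; apply/fS; move/fS: Sa.
  rewrite (iso_holds hsat sY hI _ aY) ?(fmap_id hX fX) //.
  by apply: LformulaS fX => z Xz; left; left.
have -> : X `|` [set c i] = h @` Y.
  rewrite /Y image_setU image_set1 hj; congr (_ `|` _).
  by apply/seteqP; split=> [z Xz|_ [z Xz <-]]; [exists z; rewrite ?hX|rewrite hX].
rewrite (iso_rk hsat sY hI _ aY); last by move=> ?; left.
(* Adjoining the coordinate to X lowers the rank of a by exactly one. *)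
have : rk X (tnth a j :: a) = rk X a.
  by apply: rk_mem => z; rewrite inE; case: eqP => // ->; rewrite mem_tnth.
by rewrite /= asboolF //= add1n => e; rewrite -ltnS e.
Qed.

(** Each of the infinitely many disjoint pieces has, by induction, rank at least k inside S or
    inside T, and one of the two cases occurs infinitely often. *)
Lemma MRgeU k n (S T : set (n.-tuple C)) : definable setT S -> definable setT T ->
  MRge k (S `|` T) -> MRge k S \/ MRge k T.
Proof.
move=> Sd Td; elim: k S T Sd Td => [|k IH] S T Sd Td /=.
  by move=> [a [Sa|Ta]]; [left|right]; exists a.
move=> [F [Fd FST Ftriv Fk]].
have key (U : set (n.-tuple C)) : definable setT U ->
    infinite_set [set i | MRge k (F i `&` U)] -> MRge k.+1 U.
  move=> Ud /infinite_injection[s [sI sP]]; exists (fun i => F (s i) `&` U).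
  split=> [i|i v []//|i l _ _ [v [[Fi _] [Fl _]]]|i]; [exact: definableI| |exact: sP].
  by apply/sI/Ftriv => //; exists v.
have [Sfin|Sinf] := pselect (finite_set [set i | MRge k (F i `&` S)]); last first.
  by left; exact: key Sinf.
have [Tfin|Tinf] := pselect (finite_set [set i | MRge k (F i `&` T)]); last first.
  by right; exact: key Tinf.
exfalso; apply: infinite_nat.
have cover : setT `<=` [set i | MRge k (F i `&` S)] `|` [set i | MRge k (F i `&` T)].
  move=> i _; apply: IH; [by apply: definableI|by apply: definableI|].
  by rewrite -setIUr setIidl.
by apply: sub_finite_set cover _; rewrite finite_setU.
Qed.

(** An equation over X satisfied by only one of the points would cut S into two definable parts of
    rank at least k, against degree 1. Equations suffice, because [iso_tuple_map] makes a partial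
    isomorphism out of them. *)
Lemma generic_same_type k n X (S : set (n.-tuple C)) (a a' : n.-tuple C) t :
  small kappa X -> definable X S -> rank_degree1 k S -> S a -> S a' ->
  (k <= rk X a)%N -> (k <= rk X a')%N -> Lterm X t ->
  (GRing.eval a t = 0 <-> GRing.eval a' t = 0).
Proof.
move=> sX Sd [_ deg1] Sa Sa' ka ka' tX.
have main (b b' : n.-tuple C) : S b -> S b' -> (k <= rk X b)%N -> (k <= rk X b')%N ->
    GRing.eval b t = 0 -> GRing.eval b' t = 0.
  move=> Sb Sb' kb kb' bt; apply: contrapT => b't; apply: deg1.
  have Td := @definable_term _ _ n _ tX.
  exists [set v | GRing.eval v t = 0]; split; first exact: definableS Td.
    by apply: MRge_rk kb => //; exact: definableI.
  by apply: MRge_rk kb' => //; exact: definableD.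
by split; exact: main.
Qed.

(** If x were transcendental over the parameters of its defining formula, it would have a conjugate
    independent from it; the conjugate satisfies the same formula and is therefore x itself. *)
Lemma dcl_cl X : dcl X `<=` algcl X.
Proof.
move=> x [f /Lformula_finite[s sX fs] fx].
suff : algcl [set` s] x by exact: cl_subset.
apply: contrapT => nx.
have [h [hI hid hrk]] := iso_ext hsat (@smalls s) (@small1 x) (@small1 x)
  (@iso_id _ [set` s] id (fun _ _ => erefl)).
have sx : small kappa ([set` s] `|` [set x]) by exact: sU.
have xs : [set` [:: x]] `<=` [set` s] `|` [set x].
  by move=> z /=; rewrite inE => /eqP ->; right.
have hx : h x = x.
  have fs' : Lformula ([set` s] `|` [set x]) f by apply: LformulaS fs => ?; left.
  have [/(_ (proj2 (fx x) erefl)) + _] := iso_holds hsat sx hI fs' xs.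
  by rewrite (fmap_id hid fs) => /fx.
have := hrk [:: x] xs; rewrite /= hx asboolT ?asboolF //.
by apply: sub_cl; right.
Qed.

End MorleyRank.

(** * Self-sufficiency expressed by ranks *)

Section Strong.
Variables (p : nat) (C : closedFieldType).
Implicit Types (N X Y : set C) (s : seq C).

(* N is the set of black points of the ambient colored set: the white points
   contribute nonnegatively to delta, so only black ones have to be tested. *)
Definition strong N Y := forall s, uniq s -> [set` s] `<=` N `\` Y ->
  (size s <= p * rk Y s)%N.

(** The points of A in Y already belong to D, so the number of new black points does not depend on
    D; only the rank does. *)
Lemma delta_finE N (A D : {fset C}) Y : [set` A] `&` Y `<=` [set` D] -> [set` D] `<=` Y ->
  delta_fin p N A D = (p * rk [set` D] A)%:Z -
    (size [seq x <- A | (x \in N) && (x \notin Y)])%:Z.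
Proof.
move=> AYD DY; rewrite /delta_fin /delta.
rewrite (@trdegE _ _ [set` D] (enum_fset D)) //.
rewrite (@trdegE _ _ _ (D ++ A)); last first.
  by apply/seteqP; split=> z /=; rewrite mem_cat inE orbC.
rewrite rk_cat set0U.
have -> : #|` [fset x in (A `|` D)%fset | x \in N]%fset| =
   (#|` [fset x in D | x \in N]%fset| + size [seq x <- A | (x \in N) && (x \notin Y)])%N.
  have inN (B : {fset C}) z : (z \in [fset x in B | x \in N]%fset) = (z \in B) && (z \in N).
    by rewrite !inE.
  have E : perm_eq (enum_fset [fset x in (A `|` D)%fset | x \in N]%fset)
     (enum_fset [fset x in D | x \in N]%fset ++ [seq x <- A | (x \in N) && (x \notin Y)]).
    apply: uniq_perm; first exact: fset_uniq.
      rewrite cat_uniq fset_uniq filter_uniq ?fset_uniq // andbT.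
      apply/hasPn => z; rewrite mem_filter => /andP[/andP[zN zY] zA].
      by apply: contra zY; rewrite inN => /andP[zD _]; exact/mem_set/DY.
    move=> z; rewrite mem_cat mem_filter.
    rewrite [LHS](inN (A `|` D)%fset z) [X in _ = X || _](inN D z) in_fsetU.
    case zD : (z \in D); case zA : (z \in A); case zN : (z \in N) => //=;
      rewrite ?orbT ?orbF ?andbT ?andbF //.
    apply/esym/negP => /set_mem zY.
    by have := AYD z (conj zA zY); rewrite /= zD.
  by rewrite (perm_size E) size_cat.
rewrite mulnDr !PoszD; set u := rk _ _; set w := rk _ _; move: (p * u)%N (p * w)%N => *; lia.
Qed.

Lemma delta_overE N (A : {fset C}) Y : delta_over p N A Y = (p * rk Y A)%:Z -
    (size [seq x <- A | (x \in N) && (x \notin Y)])%:Z.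
Proof.
rewrite /delta_over; set E := (X in infimum _ X); set v := (X in _ = X).
have Ev : E v.
  have [t tY trk] := rk_finite Y A.
  (* The infimum is attained here: over t the set A has the same rank as over Y, and the points of A
     in Y are those which every admissible set must contain. *)
  pose D : {fset C} := [fset x in t ++ [seq x <- A | x \in Y]]%fset.
  have DE z : (z \in D) = (z \in t) || (z \in A) && (z \in Y).
    by rewrite in_fset /= mem_cat mem_filter [(z \in Y) && _]andbC.
  have DY : [set` D] `<=` Y.
    by move=> z /=; rewrite DE => /orP[/tY//|/andP[_ /set_mem]].
  have AD : [set` A] `&` Y `<=` [set` D].
    by move=> z [/= zA zY]; rewrite DE zA (mem_set zY) orbT.
  exists D => //; rewrite (delta_finE _ AD DY) /v; congr (_%:Z - _); congr (_ * _)%N.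
  apply/eqP; rewrite eqn_leq; apply/andP; split; last first.
    by apply: rk_anti; exact: subset_trans DY (@sub_cl _ _).
  by rewrite -trk; apply: rk_anti => z zt; apply: sub_cl; rewrite /= DE; apply/orP; left.
have Elb : lbound E v.
  move=> _ [D [AD DY] <-]; rewrite (delta_finE _ AD DY) /v lerB // lez_nat.
  by rewrite leq_mul2l rk_anti ?orbT //; exact: subset_trans DY (@sub_cl _ _).
rewrite /infimum; case: ifPn => [/eqP E0|_]; first by rewrite E0 in Ev.
case: xgetP => [y _ [yl yg]|/(_ v) []]; last by split=> // y /(_ _ Ev).
by apply/eqP; rewrite eq_le yg // yl.
Qed.

Lemma self_sufficientP (Y X : colored C) :
  self_sufficient p Y X <-> colored_sub Y X /\ strong (black X) (pts Y).
Proof.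
split=> -[YX h]; split=> //.
  move=> s us sX; pose A : {fset C} := [fset x in s]%fset.
  have AE : A =i s by move=> z; rewrite in_fset.
  have Asize : size [seq x <- A | (x \in black X) && (x \notin pts Y)] = size s.
    apply/perm_size/uniq_perm => //; first by rewrite filter_uniq ?fset_uniq.
    move=> z; rewrite mem_filter AE; case zs : (z \in s); rewrite ?andbF // andbT.
    have [zX zY] := sX z zs; rewrite (mem_set zX) /=.
    by apply/negP => /set_mem.
  have := h A; rewrite delta_overE Asize (rk_mem _ AE) subr_ge0 lez_nat; apply.
  by move=> z /=; rewrite AE => /sX[zX _]; exact: (@black_sub _ X).
move=> A AX; rewrite delta_overE subr_ge0 lez_nat.
apply: leq_trans (h _ _ _) _.
- by rewrite filter_uniq ?fset_uniq.
- move=> z /=; rewrite mem_filter => /andP[/andP[zX /negP zY] _].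
  by split=> [|zY']; [exact: set_mem|apply/zY/mem_set].
- by rewrite leq_mul2l rk_sub ?orbT // => z; rewrite mem_filter => /andP[].
Qed.

End Strong.

(** * Codes and pseudo-Morley sequences *)

Section Codes.
Variables (kappa : Type) (C : closedFieldType).
Hypothesis hsat : sufficiently_saturated kappa C.
Implicit Types (N X Y Z : set C).

Let kappa_unc : ~ countable [set: kappa] := proj1 hsat.
Let sU := @smallU kappa C kappa_unc.
Let smalls (s : seq C) : small kappa [set` s] := small_finite kappa_unc (finite_seq s).

Variables (n : nat) (al : code C n).
Hypothesis al_code : is_code al.
Implicit Types (a : n.-tuple C) (b : (cl al).-tuple C).

Lemma phi_at_definable b : definable [set` b] (phi_at al b).
Proof.
have [f f0 fE] := code_phi_def al_code.
have := @definable_section C set0 n b f f0; rewrite set0U => -[g gb gE].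
by exists g => // v; rewrite -gE; exact: fE.
Qed.

Lemma rk_phi_le a b : phi al a b -> (rk [set` b] a <= ck al)%N.
Proof.
move=> ab; have [[_ nk] _] := code_C1 al_code (ex_intro _ a ab).
rewrite leqNgt; apply/negP => kab; apply: nk.
exact: (MRge_rk hsat (@smalls b) (phi_at_definable b) ab kab).
Qed.

Lemma iso_phi Y h a b : small kappa Y -> iso Y h -> [set` a] `<=` Y -> [set` b] `<=` Y ->
  phi al a b -> phi al (map_tuple h a) (map_tuple h b).
Proof.
move=> sY hI aY bY; have [f f0 fE] := code_phi_def al_code.
have abY : [set` a ++ b] `<=` Y by move=> z /=; rewrite mem_cat => /orP[/aY|/bY].
move=> /fE; rewrite (iso_holds hsat sY hI _ abY); last exact: LformulaS f0.
by rewrite (@fmap_id _ set0) // map_cat => /fE.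
Qed.

Lemma iso_psi Y h (a : (cm al).-tuple (n.-tuple C)) b :
  small kappa Y -> iso Y h -> (forall i, [set` tnth a i] `<=` Y) -> [set` b] `<=` Y ->
  psi al a b -> psi al (map_tuple (map_tuple h) a) (map_tuple h b).
Proof.
move=> sY hI aY bY; have [f f0 fE] := code_psi_def al_code.
have abY : [set` flatten [seq val x | x <- a] ++ b] `<=` Y.
  move=> z /=; rewrite mem_cat => /orP[/flattenP[s /mapP[x /tnthP[i ->] ->]]|/bY//].
  exact: aY.
move=> /fE; rewrite (iso_holds hsat sY hI _ abY); last exact: LformulaS f0.
rewrite (@fmap_id _ set0) // map_cat map_flatten -map_comp => h1; apply/fE.
by rewrite -map_comp.
Qed.

(* Otherwise let b' be a conjugate of b over B and a, independent from b; then a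
   remains generic over b and b', so both instances of phi agree up to smaller
   rank and C3 forces b = b'. *)
Lemma phi_canonical_base B M a b : small kappa B -> B `<=` M ->
  phi al a b -> [set` b] `<=` algcl M -> (ck al <= rk M a)%N -> (rk B a <= rk M a)%N ->
  [set` b] `<=` algcl B.
Proof.
move=> sB BM ab bM kM BMa; apply: rk0_cl.
set d := rk B b; apply: contrapT => d0.
set Y := B `|` [set` a].
have sY : small kappa Y := sU sB (@smalls a).
have sYb : small kappa (Y `|` [set` b]) := sU sY (@smalls b).
have [h [hI hid hrk]] := iso_ext hsat sY (@smalls b) (@smalls b)
  (@iso_id _ Y id (fun _ _ => erefl)).
rewrite image_id in hrk.
pose b' := map_tuple h b.
have bY : [set` b] `<=` Y `|` [set` b] by move=> z; right.
have aY : [set` a] `<=` Y `|` [set` b] by move=> z za; left; right.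
have BY : B `<=` Y `|` [set` b] by move=> z Bz; left; left.
have ha : map_tuple h a = a.
  by apply/val_inj; rewrite /= -[RHS]map_id; apply/eq_in_map => z za; rewrite hid //; right.
have hB : h @` B = B.
  apply/seteqP; split=> [_ [z Bz <-]|z Bz]; first by rewrite hid //; left.
  by exists z => //; rewrite hid //; left.
(* The rank of a does not drop from B to M, and b is algebraic over M; hence a and b are independent
   over B. *)
have Yb : rk Y b = d.
  have e1 : (rk B a + rk (B `|` [set` a]) b = rk B b + rk (B `|` [set` b]) a)%N.
    exact: rk_catC.
  have e2 : (rk M a <= rk (B `|` [set` b]) a)%N.
    by apply: rk_anti => z [/BM/sub_cl//|/bM].
  have e3 : (rk (B `|` [set` b]) a <= rk B a)%N.
    by apply: rk_anti => z Bz; apply: sub_cl; left.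
  rewrite -/Y -/d in e1; lia.
have Ybb' : rk (Y `|` [set` b]) b' = d by rewrite [LHS]hrk.
have bb' : b <> b'.
  move=> bb'; apply: d0; rewrite -Ybb' -bb'; apply: rk_eq0.
  by move=> z zb; apply: sub_cl; right.
have Bb' : rk B b' = d by rewrite -hB [LHS](iso_rk hsat sYb hI BY bY).
(* Together b and b' have rank 2d over B and a, and at most 2d over B; by additivity a loses no rank
   when they are added to B. *)
have kbb' : (ck al <= rk [set` b ++ b'] a)%N.
  have e1 : (rk B a + rk Y (b ++ b') =
      rk B (b ++ b') + rk (B `|` [set` b ++ b']) a)%N := rk_catC B a (b ++ b').
  have e4 : rk Y (b ++ b') = (d + d)%N.
    by rewrite rk_cat Yb; congr (_ + _)%N; exact: Ybb'.
  have e2 : (rk B (b ++ b') <= d + d)%N.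
    rewrite rk_cat leq_add2l -Bb'; apply: rk_anti => z Bz; apply: sub_cl; left.
    exact: Bz.
  have e3 : (rk (B `|` [set` b ++ b']) a <= rk [set` b ++ b'] a)%N.
    by apply: rk_anti => z ?; apply: sub_cl; right.
  rewrite e4 in e1; apply: leq_trans kM _; apply: leq_trans e3.
  have e5 : (rk M a <= rk B a)%N by apply: rk_anti => z /BM; exact: sub_cl.
  rewrite -(leq_add2l (rk B (b ++ b'))) -e1 addnC; exact: leq_add.
have ab' : phi al a b' by rewrite -ha; exact: iso_phi sYb hI aY bY ab.
(* The common part of the two instances contains a and so has full rank; by degree 1 what is left of
   either has smaller rank. *)
have key c c' : [set` c] `<=` [set` b ++ b'] -> [set` c'] `<=` [set` b ++ b'] ->
    phi al a c -> phi al a c' -> ~ MRge (ck al) (phi_at al c `\` phi_at al c').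
  move=> cs cs' ac ac' h1; have [_ deg1] := code_C1 al_code (ex_intro _ a ac).
  have dc' := phi_at_definable c'; have dc := phi_at_definable c.
  apply: deg1; exists (phi_at al c'); split=> //; first exact: definableS dc'.
  apply: (MRge_rk hsat (@smalls (b ++ b')) _ _ kbb') => //.
  by apply: definableI; [exact: definableS dc|exact: definableS dc'].
have sb : [set` b] `<=` [set` b ++ b'] by move=> z /=; rewrite mem_cat => ->.
have sb' : [set` b'] `<=` [set` b ++ b'] by move=> z /= zb'; rewrite mem_cat zb' orbT.
apply: bb'; apply: (code_C3 al_code); first by exists a.
have dT c : definable setT (phi_at al c) by exact: definableS (phi_at_definable c).
by case/(MRgeU (definableD (dT b) (dT b')) (definableD (dT b') (dT b))); exact: key.
Qed.

End Codes.

Section GoodCodes.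
Variables (kappa : Type) (p : nat) (C : closedFieldType).
Hypothesis hsat : sufficiently_saturated kappa C.
Hypothesis p_gt0 : (0 < p)%N.
Implicit Types (N X Y Z : set C).

Variables (n : nat) (al : code C n).
Hypothesis al_code : is_code al.
Hypothesis al_good : good p al.
Implicit Types (a : n.-tuple C) (b : (cl al).-tuple C).

Definition outside Y (s : seq C) : seq C := [seq x <- s | ~~ `[< Y x >]].

Lemma mem_outside Y s x : x \in outside Y s <-> x \in s /\ ~ Y x.
Proof.
rewrite mem_filter; split=> [/andP[/asboolPn nYx xs]//|[-> nYx]].
by rewrite andbT; apply/asboolPn.
Qed.

Lemma size_outside Y a :
  size (outside Y a) = (n - #|[set i : 'I_n | `[< Y (tnth a i) >]]%SET|)%N.
Proof.
rewrite size_filter -{1}(map_tnth_enum a) count_map.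
set s := [set i : 'I_n | _]%SET.
have -> : (n - #|s|)%N = #|(~: s)%SET| by rewrite [RHS]cardsCs finset.setCK card_ord.
rewrite cardE [in RHS]/enum_mem -enumT size_filter; apply: eq_count => i /=.
by rewrite !inE.
Qed.

(** Goodness is applied to the set of positions whose coordinates lie in Y, which is nonempty and
    proper. *)
Lemma good_mixed Y Z a b : phi al a b -> Y `<=` algcl Z -> [set` b] `<=` algcl Z ->
  (exists2 x, x \in a & Y x) -> (exists2 x, x \in a & ~ Y x) ->
  (p * rk Z a < size (outside Y a))%N.
Proof.
move=> ab YZ bZ [x xa Yx] [y ya nYy]; rewrite size_outside.
set s := [set i : 'I_n | _]%SET.
have sP i : i \in s <-> Y (tnth a i) by rewrite inE; split=> /asboolP.
apply: leq_ltn_trans (good_trdeg al_good ab (s := s) _); last first.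
  apply/andP; split.
    by case/tnthP: xa Yx => i -> Yi; apply/card_gt0P; exists i; apply/sP.
  rewrite -[X in (_ < X)%N]card_ord -cardsT; apply/proper_card/properP.
  split; first exact: finset.subsetT.
  case/tnthP: ya nYy => i -> nYi; exists i; first by rewrite finset.in_setT.
  by apply/negP => /sP.
rewrite leq_mul2l (@trdegE _ _ _ a) // rk_anti ?orbT // => z [[i /sP Yi ->]|/bZ//].
exact: YZ.
Qed.

(** A realization that meets Y without being contained in it would have negative delta over Y, by
    [good_mixed]. One that misses Y adds n = p k black points, so self-sufficiency gives it rank at
    least k over Y. *)
Lemma strong_realization N Y a b : strong p N Y -> phi al a b ->
  [set` b] `<=` algcl Y -> [set` a] `<=` N ->
  [set` a] `<=` Y \/ (forall x, x \in a -> ~ Y x) /\ (ck al <= rk Y a)%N.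
Proof.
move=> sN ab bY aN; have [ua _] := good_distinct al_good ab.
have sout : (size (outside Y a) <= p * rk Y a)%N.
  apply: leq_trans (sN (outside Y a) _ _) _; first by rewrite filter_uniq.
    by move=> z /mem_outside[/aN].
  by rewrite leq_mul2l rk_sub ?orbT // => z /mem_outside[].
have [aY|/existsNP[y /not_implyP[ya nYy]]] := pselect ([set` a] `<=` Y); first by left.
right; have nY x : x \in a -> ~ Y x.
  move=> xa Yx; move: sout; rewrite leqNgt => /negP; apply.
  by apply: (good_mixed (b := b)) => //; [exact: sub_cl|exists x|exists y].
split=> //; rewrite -(leq_pmul2l p_gt0) -(good_n al_good).
apply: leq_trans sout; rewrite (_ : outside Y a = a) ?size_tuple //.
by apply/all_filterP/allP => z /nY; exact: (introN (asboolP _)).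
Qed.

Section Sequence.
Variables (r : nat) (a : 'I_r -> n.-tuple C) (b : (cl al).-tuple C).
Hypothesis a_phi : forall i, phi al (a i) b.
Hypothesis a_disj : forall i j, i != j -> forall x, x \in a i -> x \notin a j.
Hypothesis a_psi : forall h : 'I_(cm al) -> 'I_r, injective h ->
  psi al [tuple a (h i) | i < cm al] b.

Lemma sequence_dcl Z (h : 'I_(cm al) -> 'I_r) : injective h ->
  (forall i, [set` a (h i)] `<=` Z) -> [set` b] `<=` algcl Z.
Proof.
move=> hI hZ; apply: subset_trans (code_C4 al_code (a_psi hI)) _.
apply: (subset_trans (@dcl_cl _ _ hsat _)); apply: cl_subset => x [i [j ->]].
by apply: (hZ i); rewrite tnth_mktuple /= mem_tnth.
Qed.

Lemma injection_into (I : {set 'I_r}) : (cm al <= #|I|)%N ->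
  exists h : 'I_(cm al) -> 'I_r, injective h /\ forall i, h i \in I.
Proof.
move=> mI; exists (fun i => enum_val (widen_ord mI i)); split=> [i j|i]; last exact: enum_valP.
by move/enum_val_inj/(congr1 val) => /= e; exact: val_inj.
Qed.

Definition outs Y (Q : seq 'I_r) := flatten [seq outside Y (a i) | i <- Q].

Lemma mem_outs Y Q x : x \in outs Y Q -> exists2 i, i \in Q & x \in a i /\ ~ Y x.
Proof. by case/flattenP => s /mapP[i iQ ->] /mem_outside ?; exists i. Qed.

Lemma uniq_outs Y Q : uniq Q -> uniq (outs Y Q).
Proof.
elim: Q => //= i Q IH /andP[iQ uQ]; rewrite cat_uniq IH // andbT.
have [ua _] := good_distinct al_good (a_phi i); rewrite filter_uniq //=.
apply/hasPn => x /mem_outs[j jQ [xj _]]; apply/negP => /mem_outside[xi _].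
have ij : i != j by apply: contraNneq iQ => ->.
by have := a_disj ij xi; rewrite xj.
Qed.

(** Each mixed member lowers delta by at least one, also over its predecessors: [good_mixed] only
    asks that Y and b be algebraic over the base, which may grow. *)
Lemma rk_outs_mixed Y Z Q : Y `<=` algcl Z -> [set` b] `<=` algcl Z ->
  (forall i, i \in Q -> (exists2 x, x \in a i & Y x) /\ (exists2 x, x \in a i & ~ Y x)) ->
  (p * rk Z (outs Y Q) + size Q <= size (outs Y Q))%N.
Proof.
elim: Q Z => [|i Q IH] Z YZ bZ Qmix; first by rewrite /outs /= muln0.
rewrite /outs /= rk_cat size_cat -/(outs Y Q) mulnDr.
have [mix1 mix2] := Qmix i (mem_head _ _).
have h1 := good_mixed (a_phi i) YZ bZ mix1 mix2.
have h2 : (p * rk Z (outside Y (a i)) <= p * rk Z (a i))%N.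
  by rewrite leq_mul2l rk_sub ?orbT // => z /mem_outside[].
have sub : algcl Z `<=` algcl (Z `|` [set` outside Y (a i)]).
  by apply: cl_subset => z; left.
have h3 := IH (Z `|` [set` outside Y (a i)]) (subset_trans YZ sub) (subset_trans bZ sub)
  (fun j jQ => Qmix j (mem_behead (s := i :: Q) jQ)).
by rewrite addnS -addnA -addSn; exact: (leq_add (leq_ltn_trans h2 h1) h3).
Qed.

(* Fewer than cm members disjoint from Y and fewer than cm inside Y leave more
   than (p - 1)(n - 1) cm members that meet Y without being contained in it, after
   discarding cm members that define b; each of them lowers delta over Y by one. *)
Lemma sequence_dichotomy N Y : strong p N Y -> (forall i, [set` a i] `<=` N) ->
  (((p - 1) * (n - 1) + 1) * cm al + cm al <= r)%N ->
  [set` b] `<=` algcl Y \/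
  exists h : 'I_(cm al) -> 'I_r, injective h /\ forall i x, x \in a (h i) -> ~ Y x.
Proof.
move=> sN aN hr.
pose I : {set 'I_r} := [set i | `[< [set` a i] `<=` Y >]]%SET.
pose O : {set 'I_r} := [set i | `[< forall x, x \in a i -> ~ Y x >]]%SET.
have [/injection_into[h [hI hO]]|Om] := leqP (cm al) #|O|.
  by right; exists h; split=> // i; have := hO i; rewrite inE => /asboolP.
have [/injection_into[h [hI hO]]|Im] := leqP (cm al) #|I|.
  by left; apply: (sequence_dcl hI) => i; have := hO i; rewrite inE => /asboolP.
left.
(* Members contained in Y come first. There are fewer than cm of them, so what follows the first cm
   members of [L] is entirely mixed. *)
pose M := (~: (I :|: O))%SET; pose L := enum I ++ enum M.
have uL : uniq L.
  rewrite cat_uniq !enum_uniq andbT; apply/hasPn => i; rewrite !mem_enum !inE.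
  by rewrite negb_or => /andP[].
have sL : (size L + cm al > r)%N.
  rewrite size_cat -!cardE.
  have cr : (#|[set: 'I_r]%SET| <= #|I| + #|M| + #|O|)%N.
    apply: leq_trans (_ : _ <= #|I :|: M :|: O|)%N _.
      apply/subset_leq_card/fintype.subsetP => i _; rewrite !inE.
      by case: asboolP; case: asboolP.
    apply: leq_trans (leq_card_setU _ _) _; rewrite leq_add2r.
    exact: leq_card_setU.
  rewrite cardsT card_ord in cr; apply: leq_ltn_trans cr _.
  by rewrite ltn_add2l.
pose F := take (cm al) L; pose G := drop (cm al) L.
have sF : size F = cm al.
  rewrite size_take; case: ltnP => // sLm; apply/eqP; rewrite eqn_leq sLm /=; nia.
have sG : (size G > (p - 1) * (n - 1) * cm al)%N by rewrite size_drop; nia.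
have uFG : uniq (F ++ G) by rewrite cat_take_drop.
have uF : uniq F by rewrite take_uniq.
have GM i : i \in G -> i \in M.
  rewrite /G /L drop_cat -cardE ltnNge (ltnW Im) /= => /mem_drop.
  by rewrite mem_enum.
have Gmix i : i \in G -> (exists2 x, x \in a i & Y x) /\ (exists2 x, x \in a i & ~ Y x).
  move=> /GM; rewrite !inE negb_or => /andP[/asboolPn nI /asboolPn nO]; split.
    by apply: contrapT => h; apply: nO => x xi Yx; apply: h; exists x.
  by apply: contrapT => h; apply: nI => x xi; apply: contrapT => nYx; apply: h; exists x.
have n0 : (0 < n)%N := code_n_gt0 al_code.
(* Every member of [L] meets Y: the mixed ones by choice, the contained ones because n > 0. *)
have Fout i : i \in F -> (size (outside Y (a i)) <= n - 1)%N.
  move=> /mem_take iL; rewrite size_outside leq_sub2l //.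
  have [x xa Yx] : exists2 x, x \in a i & Y x.
    apply: contrapT => h; have iO : i \in O.
      by rewrite inE; apply/asboolP => x xi Yx; apply: h; exists x.
    move: iL; rewrite mem_cat !mem_enum => /orP[|]; last first.
      by rewrite finset.in_setC finset.in_setU iO orbT.
    rewrite inE => /asboolP iY.
    by apply: h; exists (tnth (a i) (Ordinal n0)); [|apply: iY]; exact: mem_tnth.
  case/tnthP: xa Yx => j -> Yj; apply/card_gt0P; exists j.
  by rewrite inE; apply/asboolP.
exfalso.
have [i0 i0G] : exists i, i \in G.
  by case: (G) sG => // i G' _; exists i; exact: mem_head.
(* Z contains the cm members of [F], so by C4 it makes b algebraic. *)
pose Z := Y `|` [set` outs Y F].
have YZ : Y `<=` algcl Z by move=> z Yz; apply: sub_cl; left.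
have bZ : [set` b] `<=` algcl Z.
  pose h (i : 'I_(cm al)) := nth i0 F i.
  apply: (@sequence_dcl _ h) => [i j /eqP|i x xa].
    by rewrite nth_uniq ?sF // => /eqP/val_inj.
  have [Yx|nYx] := pselect (Y x); [by left|right].
  apply/flattenP; exists (outside Y (a (h i))); last by apply/mem_outside.
  by apply: map_f; rewrite mem_nth // sF.
have h1 := rk_outs_mixed YZ bZ Gmix.
have h2 : (size (outs Y F) <= (n - 1) * cm al)%N.
  rewrite -sF; elim: (F) Fout => //= i Q IH Qout.
  rewrite /outs /= size_cat mulnS leq_add ?Qout ?mem_head ?IH // => j jQ.
  by apply: Qout; rewrite inE jQ orbT.
have h3 : (size (outs Y F) + size (outs Y G) <=
    p * rk Y (outs Y F) + p * rk Z (outs Y G))%N.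
  rewrite -mulnDr -rk_cat -size_cat /outs -flatten_cat -map_cat.
  apply: sN; first exact: uniq_outs.
  by move=> x /mem_outs[i _ [/aN xN nYx]].
have h4 : (p * rk Y (outs Y F) <= p * size (outs Y F))%N by rewrite leq_mul2l rk_size orbT.
(* Each new coordinate of [F] raises delta over Y by at most p - 1 and each member of [G] lowers it
   by at least one, while the total is nonnegative. *)
have h5 : (size G <= (p - 1) * size (outs Y F))%N.
  have arith : forall x y z t g u : nat, (x + y <= z + t)%N -> (t + g <= y)%N -> (z <= u)%N ->
      (g <= u - x)%N by lia.
  by rewrite mulnBl mul1n; exact: arith h3 h1 h4.
have h6 : ((p - 1) * size (outs Y F) <= (p - 1) * ((n - 1) * cm al))%N by rewrite leq_mul2l h2 orbT.
by move: sG; rewrite ltnNge -mulnA (leq_trans h5 h6).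
Qed.

End Sequence.
End GoodCodes.

(** * Self-sufficiency and free amalgams *)

Lemma sub_image_seq (T U : eqType) (g : T -> U) (K : set T) (s : seq U) :
  [set` s] `<=` g @` K -> exists t : seq T, [set` t] `<=` K /\ s = map g t.
Proof.
elim: s => [|x s IH] sK; first by exists [::].
have [z zs|t [tK ->]] := IH; first by apply: sK; rewrite /= inE; apply/orP; right.
have [y Ky yx] := sK x (mem_head _ _).
exists (y :: t); split; last by rewrite /= yx.
by move=> z /=; rewrite inE => /orP[/eqP ->|/tK].
Qed.

Section StrongSets.
Variables (p : nat) (C : closedFieldType).
Implicit Types (N X Y : set C).

Lemma strong_trans N X Y : X `<=` Y -> strong p (N `&` Y) X -> strong p N Y -> strong p N X.
Proof.
move=> XY sX sY s us sN.
pose s1 := [seq x <- s | `[< Y x >]]; pose s2 := [seq x <- s | ~~ `[< Y x >]].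
have ss : perm_eq s (s1 ++ s2) by rewrite perm_sym perm_filterC.
rewrite (perm_size ss) (rk_perm X ss) size_cat rk_cat mulnDr leq_add //.
  apply: sX; first by rewrite filter_uniq.
  by move=> z /=; rewrite mem_filter => /andP[/asboolP Yz /sN[]].
apply: leq_trans (sY s2 _ _) _; first by rewrite filter_uniq.
  by move=> z /=; rewrite mem_filter => /andP[/asboolP nYz /sN[]].
rewrite leq_mul2l rk_anti ?orbT // => z Xz; apply: sub_cl; case: Xz => [/XY//|/=].
by rewrite mem_filter => /andP[/asboolP].
Qed.

(** As s has delta at most 0 over X, the nonnegative delta of s and t over X is at most the delta of
    t over X and s. *)
Lemma strong_extend N X s : strong p N X -> uniq s -> [set` s] `<=` N `\` X ->
  (p * rk X s <= size s)%N -> strong p N (X `|` [set` s]).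
Proof.
move=> sX us sN rks t ut tN.
have ust : uniq (s ++ t).
  rewrite cat_uniq us ut andbT; apply/hasPn => z /tN[_ nz].
  by apply/negP => zs; apply: nz; right.
have := sX _ ust; rewrite size_cat rk_cat mulnDr => h.
rewrite -(leq_add2l (size s)); apply: leq_trans (h _) _; last by rewrite leq_add2r.
move=> z /=; rewrite mem_cat => /orP[/sN//|/tN[Nz nz]].
by split=> // Xz; apply: nz; left.
Qed.

Variables (kappa : Type).
Hypothesis hsat : sufficiently_saturated kappa C.

Lemma strong_iso N X Y g : small kappa Y -> iso Y g -> X `<=` Y -> N `<=` Y ->
  strong p N X -> strong p (g @` N) (g @` X).
Proof.
move=> sY gI XY NY sX s us sN.
have [|t [tN st]] := @sub_image_seq _ _ g N s; first by move=> z /sN[].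
rewrite st (iso_rk hsat sY gI XY) ?size_map; last by move=> z /tN /NY.
apply: sX; first by move: us; rewrite st => /map_uniq.
move=> z zt; split; first exact: tN.
move=> Xz; have [|_ []] := sN (g z); first by rewrite st /= map_f.
by exists z.
Qed.

Lemma strong_local N K :
  (forall s : seq C, [set` s] `<=` K ->
     exists K', [/\ [set` s] `<=` K', K' `<=` K & strong p N K']) -> strong p N K.
Proof.
move=> loc t ut tN; have [s sK srk] := rk_finite K t; have [K' [sK' K'K K'N]] := loc s sK.
apply: leq_trans (K'N t ut _) _.
  by move=> z /tN[Nz nKz]; split=> // /K'K.
by rewrite -srk leq_mul2l rk_anti ?orbT // => z /sK'; exact: sub_cl.
Qed.

Lemma elementary_iso Y g : small kappa Y -> iso Y g -> elementary_on Y g.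
Proof.
move=> sY gI f f0 s sY'; rewrite (iso_holds hsat sY gI _ sY').
  by rewrite (@fmap_id _ set0).
exact: LformulaS f0.
Qed.

Definition tuple_map n (a a' : n.-tuple C) (x : C) : C :=
  if x \in a then nth 0 a' (index x a) else x.

(** A constant that occurs in a is replaced by the variable of its position; a term over X and a
    becomes a term over X evaluated at a. *)
Lemma iso_tuple_map X n (a a' : n.-tuple C) : uniq a ->
  (forall t, Lterm X t -> (GRing.eval a t = 0 <-> GRing.eval a' t = 0)) ->
  iso (X `|` [set` a]) (tuple_map a a').
Proof.
move=> ua aa' t tX.
suff [t' [t'X -> ->]] : exists t', [/\ Lterm X t', GRing.eval [::] t = GRing.eval a t' &
    GRing.eval [::] (tmap (tuple_map a a') t) = GRing.eval a' t'] by exact: aa'.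
elim: t tX => [i _|c Xc|m _|t1 h1 t2 h2 [/h1[u1 [? E1 F1]] /h2[u2 [? E2 F2]]]|
    t h /h[u [? E F]]|t h m /h[u [? E F]]|
    t1 h1 t2 h2 [/h1[u1 [? E1 F1]] /h2[u2 [? E2 F2]]]|//|t h m /h[u [? E F]]].
- by exists (GRing.NatConst _ 0); split=> //=; rewrite nth_nil.
- have [ca|ca] := boolP (c \in a).
    exists (GRing.Var _ (index c a)); split=> //=; first by rewrite nth_index.
    by rewrite /tuple_map ca.
  exists (GRing.Const c); split=> //=; first by case: Xc => // /= h; rewrite h in ca.
  by rewrite /tuple_map (negbTE ca).
- by exists (GRing.NatConst _ m).
- by exists (GRing.Add u1 u2); split=> //=; rewrite ?E1 ?E2 ?F1 ?F2.
- by exists (GRing.Opp u); split=> //=; rewrite ?E ?F.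
- by exists (GRing.NatMul u m); split=> //=; rewrite ?E ?F.
- by exists (GRing.Mul u1 u2); split=> //=; rewrite ?E1 ?E2 ?F1 ?F2.
- by exists (GRing.Exp u m); split=> //=; rewrite ?E ?F.
Qed.

End StrongSets.

Section FreeAmalgam.
Variables (p : nat) (C : closedFieldType).

Definition colored_union (M A : colored C) : colored C :=
  Colored (setUSS (@black_sub _ M) (@black_sub _ A)).

Variables (B : set C) (M A : colored C).
Hypothesis BM : B `<=` pts M.
Hypothesis BA : B `<=` pts A.
Hypothesis colorB : forall x, B x -> (black M x <-> black A x).
Hypothesis BsM : strong p (black M) B.
Hypothesis BsA : strong p (black A) B.
Hypothesis indep : forall s : seq C, [set` s] `<=` pts A -> rk (pts M) s = rk B s.

(** By additivity in both orders, s loses as much rank over a finite t as t loses over s, and by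
    [indep] the latter loses none. *)
Lemma indep_sym (s : seq C) : [set` s] `<=` pts M -> rk (pts A) s = rk B s.
Proof.
move=> sM; apply/eqP; rewrite eqn_leq rk_anti /=; last exact: subset_trans BA (@sub_cl _ _).
have [t tA <-] := rk_finite (pts A) s.
have e1 := rk_catC B t s.
have e2 : (rk B t <= rk (B `|` [set` s]) t)%N.
  by rewrite -indep // rk_anti // => z [/BM|/sM]; exact: sub_cl.
have e3 : (rk (B `|` [set` t]) s <= rk [set` t] s)%N.
  by apply: rk_anti => z tz; apply: sub_cl; right.
apply: leq_trans e3; rewrite -(leq_add2l (rk B t)) e1 addnC; exact: leq_add.
Qed.

(** By independence a common point is algebraic over B. A black one outside B would have delta -1
    over B, so common points outside B are white on both sides. *)
Lemma color_overlap x : pts M x -> pts A x -> (black M x <-> black A x).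
Proof.
move=> Mx Ax; have [/colorB//|nBx] := pselect (B x).
have rk0 : rk B [:: x] = 0%N.
  rewrite -indep ?rk_eq0 // => z /=; rewrite inE => /eqP -> //.
  exact: sub_cl.
have nb N : strong p N B -> ~ N x.
  move=> sN Nx; suff /(sN [:: x] isT) : [set` [:: x]] `<=` N `\` B by rewrite rk0 muln0.
  by move=> z; rewrite /= inE => /eqP ->.
by split=> [/(nb _ BsM)|/(nb _ BsA)].
Qed.

(** Black points outside M lie in A, where rank over M equals rank over B; the inequality is
    inherited from B in A. *)
Lemma strong_union_l : strong p (black (colored_union M A)) (pts M).
Proof.
move=> s us sN; have sA : [set` s] `<=` black A `\` pts M.
  by move=> z /sN[[bz|bz] nMz]; [case: nMz; exact: (black_sub bz)|].
rewrite indep; last by move=> z /sA[bz _]; exact: (black_sub bz).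
by apply: BsA => // z /sA[bz nMz]; split=> // /BM.
Qed.

Lemma strong_union_r : strong p (black (colored_union M A)) (pts A).
Proof.
move=> s us sN; have sM : [set` s] `<=` black M `\` pts A.
  by move=> z /sN[[bz|bz] nAz]; [|case: nAz; exact: (black_sub bz)].
rewrite indep_sym; last by move=> z /sM[bz _]; exact: (black_sub bz).
by apply: BsM => // z /sM[bz nAz]; split=> // /BA.
Qed.

Lemma union_l : self_sufficient p M (colored_union M A).
Proof.
apply/self_sufficientP; split; last exact: strong_union_l.
split=> [x|]; first by left.
apply/seteqP; split=> [x bx|x [Mx [//|bx]]]; first by split; [exact: (black_sub bx)|left].
by apply/color_overlap => //; exact: (black_sub bx).
Qed.

Lemma union_r : self_sufficient p A (colored_union M A).
Proof.
apply/self_sufficientP; split; last exact: strong_union_r.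
split=> [x|]; first by right.
apply/seteqP; split=> [x bx|x [Ax [bx|//]]]; first by split; [exact: (black_sub bx)|right].
by apply/color_overlap => //; exact: (black_sub bx).
Qed.

End FreeAmalgam.

(** * Amalgamation *)

Section Bounds.
Variables (p : nat) (kappa : Type) (C : closedFieldType).
Hypothesis p_gt0 : (0 < p)%N.
Hypothesis hsat : sufficiently_saturated kappa C.
Variables (CC : forall n : nat, set (code C n)) (mustar : forall n : nat, code C n -> nat).
Hypothesis hCC : code_family CC.
Hypothesis hmu : mustar_ok p CC mustar.

Let kappa_unc : ~ countable [set: kappa] := proj1 hsat.
Let sU := @smallU kappa C kappa_unc.
Let smalls (s : seq C) : small kappa [set` s] := small_finite kappa_unc (finite_seq s).
Let small0 : small kappa (@set0 C) := small_finite kappa_unc (finite_set0 C).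

Definition bounded (M : colored C) := forall n (al : code C n), good_codes p CC al ->
  forall b, theta al b -> forall r (a : 'I_r -> n.-tuple C),
  pseudo_morley M b a -> (r <= mu p mustar al)%N.

(** A sequence in A' is pulled back by the inverse map. The parameter b and a witness of [theta] may
    lie outside A', so the inverse is first extended to them. *)
Lemma bounded_image (A A' : colored C) g : small kappa (pts A) -> iso (pts A) g ->
  pts A' = g @` pts A -> black A' = g @` black A -> bounded A -> bounded A'.
Proof.
move=> sA gI A'E bA'E bA n al al_good b [x xb] r a [a_phi a_disj a_black a_psi].
have al_code : is_code al by apply: (family_code hCC); case: al_good.
have [k [kI kg]] := iso_inverse gI.
rewrite -A'E in kI.
have sA' : small kappa (pts A') by rewrite A'E; exact: small_image.
have [h [hI hk _]] := iso_ext hsat sA' (sU (@smalls b) (@smalls x)) small0 kI.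
set Y := _ `|` _ in hI.
have sY : small kappa Y by exact: sU (sU (@smalls b) (@smalls x)).
have bY : [set` b] `<=` Y by move=> z; right; left.
have xY : [set` x] `<=` Y by move=> z; right; right.
have aA i : [set` a i] `<=` pts A'.
  by apply: subset_trans (a_black i) (@black_sub _ A').
have aY i : [set` a i] `<=` Y by move=> z /aA; left.
apply: (bA n al al_good (map_tuple h b) _ r (fun i => map_tuple h (a i))).
  by exists (map_tuple h x); exact: (iso_phi hsat al_code sY hI xY bY).
split=> [i|i j ij y|i _ /mapP[y ya ->]|hh hhI].
- exact: (iso_phi hsat al_code sY hI (aY i) bY).
- move=> /mapP[z zi ->]; apply/negP => /mapP[w wj].
  move=> /(iso_inj hI (aY i z zi) (aY j w wj)) zw.
  by have := a_disj i j ij z zi; rewrite zw wj.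
- have := a_black i y ya; rewrite bA'E => -[w bw wy].
  have Aw : pts A w by exact: (black_sub bw).
  have hyw : h y = w by rewrite hk; [rewrite -wy kg|exact: (aA i)].
  by rewrite hyw.
- rewrite (_ : [tuple map_tuple h (a (hh i)) | i < cm al] =
      map_tuple (map_tuple h) [tuple a (hh i) | i < cm al]); last first.
    by apply: eq_from_tnth => i; rewrite [RHS]tnth_map !tnth_mktuple.
  apply: (iso_psi hsat al_code sY hI _ bY (a_psi hh hhI)) => i.
  by rewrite tnth_mktuple.
Qed.

Section Union.
Variables (B : set C) (M A : colored C).
Hypothesis sB : small kappa B.
Hypothesis BM : B `<=` pts M.
Hypothesis BA : B `<=` pts A.
Hypothesis colorB : forall x, B x -> (black M x <-> black A x).
Hypothesis BsM : strong p (black M) B.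
Hypothesis BsA : strong p (black A) B.
Hypothesis indep : forall s : seq C, [set` s] `<=` pts A -> rk (pts M) s = rk B s.
Hypothesis bM : bounded M.
Hypothesis bA : bounded A.

Let D := colored_union M A.

(* A member outside M1 is generic over M1 and independent from M1 over B, so its
   canonical parameter b is algebraic over B. *)
Lemma long_sequence_realization (M1 A1 : colored C) n (al : code C n) b r
    (a : 'I_r -> n.-tuple C) :
  B `<=` pts M1 ->
  (forall s : seq C, [set` s] `<=` pts A1 -> rk (pts M1) s = rk B s) ->
  self_sufficient p M1 D -> (forall x, black D x -> ~ pts M1 x -> black A1 x) ->
  bounded M1 -> good_codes p CC al -> theta al b -> pseudo_morley D b a ->
  (mu p mustar al < r)%N -> [set` b] `<=` algcl (pts M1) ->
  [set` b] `<=` algcl B /\ exists i, [/\ [set` a i] `<=` black A1,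
    forall x, x \in a i -> ~ pts M1 x & (ck al <= rk B (a i))%N].
Proof.
move=> BM1 ind1 /self_sufficientP[[M1D bM1] sM1] DA1 bnd gal thb [a_phi a_disj a_black a_psi].
move=> hr bcl; have [CCal al_good] := gal.
have al_code : is_code al by exact: (family_code hCC).
have [i ni] : exists i, ~ [set` a i] `<=` pts M1.
  apply: contrapT => h; move: hr; rewrite ltnNge => /negP; apply.
  apply: (bnd n al gal b thb r a); split=> // i x xa.
  rewrite bM1; split; last exact: (a_black i).
  by apply: contrapT => nx; apply: h; exists i => aiM; apply: nx; exact: aiM.
have [//|[nM1 kM1]] := strong_realization p_gt0 al_good sM1 (a_phi i) bcl (a_black i).
have aA1 : [set` a i] `<=` black A1.
  by move=> x xa; apply: DA1; [exact: a_black xa|exact: nM1].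
have rkE : rk (pts M1) (a i) = rk B (a i).
  by apply: ind1; exact: subset_trans aA1 (@black_sub _ A1).
split; last by exists i; split=> //; rewrite -rkE.
by apply: (phi_canonical_base hsat al_code sB BM1 (a_phi i) bcl kM1); rewrite rkE.
Qed.

(** The excluded configuration, a generic member on each side, is the one from which the maximal map
    of the final proof could be extended. *)
Lemma bounded_union :
  ~ (exists n (al : code C n) b (a a' : n.-tuple C),
      [/\ is_code al, good p al, phi al a b /\ phi al a' b & [set` b] `<=` algcl B] /\
      [/\ [set` a] `<=` black A `\` pts M, [set` a'] `<=` black M `\` pts A,
          (ck al <= rk B a)%N & (ck al <= rk B a')%N]) ->
  bounded D.
Proof.
move=> nconf n al gal b thb r a pm; rewrite leqNgt; apply/negP => hr.
have [CCal al_good] := gal; have al_code : is_code al by exact: (family_code hCC).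
have [a_phi a_disj a_black a_psi] := pm.
have ssM : self_sufficient p M D by exact: (@union_l p C B).
have ssA : self_sufficient p A D by exact: (@union_r p C B).
have DnM x : black D x -> ~ pts M x -> black A x.
  by move=> [bx nMx|//]; case: nMx; exact: (black_sub bx).
have DnA x : black D x -> ~ pts A x -> black M x.
  by move=> [//|bx nAx]; case: nAx; exact: (black_sub bx).
have indep' := indep_sym BM BA indep.
have realM := long_sequence_realization BM indep ssM DnM bM gal thb pm hr.
have realA := long_sequence_realization BA indep' ssA DnA bA gal thb pm hr.
have hr' : (((p - 1) * (n - 1) + 1) * cm al + cm al <= r)%N.
  have := mustar_ge hmu gal; move: hr; rewrite /mu; lia.
have /self_sufficientP[_ sM] := ssM.
have bB : [set` b] `<=` algcl B.
  have [/realM[]//|[h [hI hM]]] :=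
    sequence_dichotomy hsat p_gt0 al_code al_good a_phi a_disj a_psi sM a_black hr'.
  (* The cm members that miss M lie in A and define b, which is then algebraic over A. *)
  have [] // := realA; apply: (sequence_dcl hsat al_code a_psi hI) => i x xa.
  exact: (black_sub (DnM x (a_black _ x xa) (hM i x xa))).
have [|_ [i [iA niM ik]]] := realM; first exact: subset_trans bB (cl_subset BM).
have [|_ [j [jM njA jk]]] := realA; first exact: subset_trans bB (cl_subset BA).
apply: nconf; exists n, al, b, (a i), (a j); split; split=> //.
  by move=> x xa; split; [exact: iA|exact: niM].
by move=> x xa; split; [exact: jM|exact: njA].
Qed.

End Union.
End Bounds.

Theorem theorem6p1 (q p : nat) (hp : (2 <= p)%N)
    (kappa : Type) (C : closedFieldType)
    (hchar : has_characteristic C q)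
    (hsat : sufficiently_saturated kappa C)
    (CC : forall n : nat, set (code C n)) (hCC : code_family CC)
    (mustar : forall n : nat, code C n -> nat) (hmu : mustar_ok p CC mustar)
    (B M A : colored C)
    (hB : Kmu kappa p CC mustar B) (hM : Kmu kappa p CC mustar M)
    (hA : Kmu kappa p CC mustar A)
    (hBM : self_sufficient p B M) (hBA : self_sufficient p B A) :
  exists M' A' : colored C,
    [/\ Kmu kappa p CC mustar M', self_sufficient p M M',
        self_sufficient p B A', self_sufficient p A' M'
      & isomorphic_over B A A'].
Proof.
have p_gt0 : (0 < p)%N by exact: leq_trans hp.
have kappa_unc := proj1 hsat.
have /self_sufficientP[[BsubM bBM] sBM] := hBM.
have /self_sufficientP[[BsubA bBA] sBA] := hBA.
have sA := Kmu_small hA; have sM := Kmu_small hM.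
pose P (K : set C) (h : C -> C) := [/\ K `<=` pts A, iso K h,
  forall x, K x -> pts M (h x) /\ (black A x <-> black M (h x)),
  strong p (black A) K & strong p (black M) (h @` K)].
have [|||K [g0 [[KA g0I g0M sKA sKM] BK g0B Kmax]]] :=
    @maximal_partial_map C P _ _ (pts B) id.
- move=> K g h gh [KA KI KM sKA sKM]; split=> //.
  + exact: eq_iso gh KI.
  + by move=> x Kx; rewrite -gh //; exact: KM.
  + suff <- : g @` K = h @` K by [].
    by apply/seteqP; split=> _ [x Kx <-]; exists x; rewrite ?gh.
- move=> K h loc.
  have loc1 x : K x -> exists2 K', K' x & P K' h.
    move=> Kx; have [|K' [xK' _ PK']] := loc [:: x].
      by move=> z; rewrite /= inE => /eqP ->.
    by exists K' => //; apply: xK'; rewrite /= mem_head.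
  split.
  + by move=> x /loc1[K' xK' [K'A _ _ _ _]]; exact: K'A.
  + by apply: iso_local => s /loc[K' [sK' _ [_ ? _ _ _]]]; exists K'.
  + by move=> x /loc1[K' xK' [_ _ K'M _ _]]; exact: K'M.
  + apply: strong_local => s /loc[K' [sK' K'K [_ _ _ ? _]]]; by exists K'.
  + apply: strong_local => s sK.
    have [t [tK st]] := sub_image_seq sK.
    have [K' [tK' K'K [_ _ _ _ ?]]] := loc t tK.
    exists (h @` K'); split=> //; last exact: image_subset.
    by rewrite st => _ /mapP[z /tK' ? ->]; exists z.
- split=> //; first exact: iso_id.
    move=> x Bx; split; first exact: BsubM.
    split=> bx; first by have [] : (pts B `&` black M) x by rewrite -bBM bBA.
    by have [] : (pts B `&` black A) x by rewrite -bBA bBM.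
  by rewrite image_id.
have sK : small kappa K := smallS KA sA.
pose B0 := g0 @` K.
have [g [gI gg0 gind]] := iso_ext hsat sK sA sM g0I.
have KUA : K `|` pts A = pts A by apply/setUidPr.
rewrite KUA in gI gind.
have gK x : K x -> g x = g0 x by exact: gg0.
have B0E : B0 = g @` K by apply/seteqP; split=> _ [x Kx <-]; exists x; rewrite ?gK.
have gblack : g @` black A `<=` g @` pts A by apply: image_subset; exact: black_sub.
pose A' := Colored gblack.
have B0M : B0 `<=` pts M by move=> _ [x /g0M[? _] <-].
have B0A : B0 `<=` pts A' by rewrite B0E; exact: image_subset.
have sB0 : small kappa B0 by exact: small_image.
have gblackE x : pts A x -> (black A' (g x) <-> black A x).
  move=> Ax; split=> [[y by_ /(iso_inj gI) e]|]; last by exists x.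
  by rewrite -e //; exact: black_sub.
have colorB0 x : B0 x -> (black M x <-> black A' x).
  move=> [y Ky <-]; have [_ <-] := g0M y Ky.
  by rewrite -gK // gblackE //; exact: KA.
have sB0A : strong p (black A') B0.
  by rewrite B0E; apply: (strong_iso hsat sA gI) => //; exact: black_sub.
have ind (s : seq C) : [set` s] `<=` pts A' -> rk (pts M) s = rk B0 s.
  move=> sA'; have [t [tA st]] := sub_image_seq sA'.
  have := gind t tA; rewrite -/B0 (_ : B0 `|` pts M = pts M); last by apply/setUidPr.
  rewrite -st => ->; rewrite st B0E (iso_rk hsat sA gI) //.
have conf : ~ (exists n (al : code C n) b (a a' : n.-tuple C),
      [/\ is_code al, good p al, phi al a b /\ phi al a' b & [set` b] `<=` algcl B0] /\
      [/\ [set` a] `<=` black A' `\` pts M, [set` a'] `<=` black M `\` pts A',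
          (ck al <= rk B0 a)%N & (ck al <= rk B0 a')%N]).
  (* With a0 the preimage of a under g, such a pair extends the maximal map by a0 -> a'. *)
  move=> [n [al [b [a [a' [[al_code al_good [ab a'b] bB0] [aA a'M ka ka']]]]]]].
  have [ua _] := good_distinct al_good ab; have [ua' _] := good_distinct al_good a'b.
  have n_gt0 := code_n_gt0 al_code.
  have [a0 [a0A aE]] : exists a0 : n.-tuple C, [set` a0] `<=` black A /\ a = map_tuple g a0.
    have [|t [tA st]] := @sub_image_seq _ _ g (black A) a; first by move=> z /aA[].
    have tn : size t == n by rewrite -(size_map g) -st size_tuple.
    by exists (Tuple tn); split=> //; exact: val_inj.
  have a0pts : [set` a0] `<=` pts A by move=> z /a0A; exact: black_sub.
  have a0K z : z \in a0 -> ~ K z.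
    move=> za0 Kz; have [|_] := aA (g z); first by rewrite aE /= map_f.
    by apply; apply: B0M; rewrite B0E; exists z.
  have B0a z : B0 z -> z \notin a.
    by move=> /B0M Mz; apply/negP => /aA[].
  have B0a' z : B0 z -> z \notin a'.
    by move=> /B0A Az; apply/negP => /a'M[].
  pose u := tuple_map a a'.
  have sameT t : Lterm B0 t -> (GRing.eval a t = 0 <-> GRing.eval a' t = 0).
    (* The instance is definable over b; adding b to B0, over which it is algebraic, does not lower
       the ranks of a and a'. *)
    move=> tB0; pose X := B0 `|` [set` b].
    have sX : small kappa X by apply: smallU => //; exact: small_finite (finite_seq b).
    have clX : X `<=` algcl B0 by move=> z [/sub_cl//|/bB0].
    have dX : definable X (phi_at al b).
      by apply: definableS (phi_at_definable al_code b) => z; right.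
    apply: (generic_same_type hsat sX dX (code_C1 al_code (ex_intro _ a ab)) ab a'b).
    - exact: leq_trans ka (rk_anti _ clX).
    - exact: leq_trans ka' (rk_anti _ clX).
    - by apply: LtermS tB0 => z; left.
  have uI : iso (B0 `|` [set` a]) u := iso_tuple_map ua sameT.
  have uB0 z : B0 z -> u z = z by move=> /B0a; rewrite /u /tuple_map => /negbTE ->.
  have ua'E : map u a = a'.
    apply: (@eq_from_nth _ 0); first by rewrite size_map !size_tuple.
    move=> i; rewrite size_map size_tuple => ilt.
    rewrite (nth_map 0) ?size_tuple // /u /tuple_map mem_nth ?size_tuple //.
    by rewrite index_uniq ?size_tuple.
  have KaA : K `|` [set` a0] `<=` pts A by move=> z [/KA|/a0pts].
  have gKa : g @` (K `|` [set` a0]) = B0 `|` [set` a].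
    rewrite image_setU -B0E; congr (_ `|` _); rewrite aE.
    apply/seteqP; split=> [_ [z za0 <-]|_ /mapP[z za0 ->]]; last by exists z.
    by rewrite /= map_f.
  have uB0a : u @` (B0 `|` [set` a]) = B0 `|` [set` a'].
    rewrite image_setU; congr (_ `|` _).
      apply/seteqP; split=> [_ [z Bz <-]|z Bz]; first by rewrite uB0.
      by exists z => //; rewrite uB0.
    have ua'E' z : (z \in a') = (z \in map u a) by rewrite ua'E.
    apply/seteqP; split=> [_ [z za <-]|z]; first by rewrite /= ua'E' map_f.
    by rewrite /= ua'E' => /mapP[y ya ->]; exists y.
  (* Since n = p k, the new tuple has delta at most 0 over B0, as [strong_extend] requires both for
     the domain and for the image. *)
  have rk_le_n (c : n.-tuple C) : phi al c b -> (p * rk B0 c <= n)%N.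
    move=> cb; rewrite [X in (_ <= X)%N](good_n al_good) leq_mul2l.
    by rewrite (leq_trans (rk_anti _ bB0) (rk_phi_le hsat al_code cb)) orbT.
  have PK : P (K `|` [set` a0]) (u \o g).
    split=> //.
    - apply: iso_comp; first exact: isoS gI.
      by rewrite gKa.
    - move=> x [Kx|xa0] /=.
        have [g0Mx gcol] := g0M x Kx; have B0x : B0 (g0 x) by exists x.
        by rewrite gK // uB0.
      have ugx : u (g x) \in a'.
        have : u (g x) \in map u a by rewrite map_f // aE /= map_f.
        by rewrite ua'E.
      have [bux _] := a'M _ ugx; have ax := a0A x xa0.
      by split; [exact: (black_sub bux)|split].
    - apply: (strong_extend sKA) => //.
      + by move: ua; rewrite aE => /map_uniq.
      + by move=> z za0; split; [exact: a0A|exact: a0K].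
      + rewrite size_tuple -(iso_rk hsat sA gI KA a0pts) -B0E.
        by have := rk_le_n a ab; rewrite aE.
    - rewrite -image_comp gKa uB0a.
      apply: strong_extend => //; last by rewrite size_tuple rk_le_n.
      by move=> z za'; split; [case: (a'M z za')|move=> /B0a'/negP; apply].
  have KKa := Kmax _ _ PK; have a0i := mem_tnth (Ordinal n_gt0) a0.
  apply: (a0K _ a0i); apply: KKa; [by move=> z; left| |by right].
  by move=> x Kx; rewrite /= gK // uB0 //; exists x.
have bndM' : bounded p CC mustar (colored_union M A').
  apply: (bounded_union p_gt0 hsat hCC hmu sB0 B0M B0A colorB0 sKM sB0A ind) => //.
    exact: (Kmu_bound hM).
  exact: (bounded_image hsat hCC sA gI (erefl (pts A')) (erefl (black A')) (Kmu_bound hA)).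
have ssM : self_sufficient p M (colored_union M A').
  exact: (union_l B0M colorB0 sKM sB0A ind).
exists (colored_union M A'), A'; split=> //.
- split=> //.
    by apply: smallU => //; exact: small_image.
  have /self_sufficientP[[_ _] s0M] := Kmu_strong hM.
  have /self_sufficientP[[MM' bMM'] sMM'] := ssM.
  apply/self_sufficientP; split; first by split=> //; rewrite set0I.
  by apply: strong_trans sMM' => //; rewrite setIC -bMM'.
- apply/self_sufficientP; split.
    split=> [x Bx|].
      by apply: B0A; exists x; [exact: BK|rewrite g0B].
    apply/seteqP; split=> [x bx|x [Bx bx]].
      have Bx : pts B x by exact: (black_sub bx).
      split=> //; exists x; last by rewrite gK ?g0B //; exact: BK.
      by move: bx; rewrite bBA => -[].
    rewrite bBA; split=> //; have Kx := BK x Bx.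
    by apply/(gblackE x (KA x Kx)); rewrite gK // g0B.
  (* As g fixes B, self-sufficiency of B in A is transported to A'. *)
  have -> : pts B = g @` pts B.
    apply/seteqP; split=> [x Bx|_ [x Bx <-]].
      by exists x => //; rewrite gK ?g0B //; exact: BK.
    by rewrite gK ?g0B //; exact: BK.
  by apply: (strong_iso hsat sA gI) => //; exact: black_sub.
- exact: (union_r B0M B0A colorB0 sKM sB0A ind).
- exists g; split=> //.
  + split=> [x Ax|x y|_ [x Ax <-]]; last by exists x.
      by exists x.
    by rewrite !inE => Ax Ay; exact: (iso_inj gI).
  + exact: (elementary_iso hsat sA gI).
  + by move=> x Bx; rewrite gK ?g0B //; exact: BK.
Qed.
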